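(* Let $K$ be a number field and let $E$ be an elliptic curve over $K$ with Weierstrass equation $w_E(x,y)=0$. Let $u\in K(E)$ be a polynomial of degree $1$ in $x$ and $y$ with coefficients in $K$ such that $K(u,[-1]^*u)=K(x,y)$, and let $n\geq 3$ be an integer. Then: (1) The $n$-th primitive division polynomial $\widetilde{\psi}_n\in K[X]$ has Galois group over $K$ isomorphic to $\rho_{E,n}(G_K)/\{\pm\mathrm{id}\}$. If the action of $G_K$ on the set of points of $E(\overline{K})$ of exact order $n$ is transitive, then $\widetilde{\psi}_n$ is irreducible over $K$. (2) The characteristic polynomial $\chi_{u,n}\in K[T]$ of multiplication by $u$ on the finite-dimensional $K$-algebra $K[X,Y]/(w_E,\widetilde{\psi}_n)$ has Galois group over $K$ isomorphic to $\rho_{E,n}(G_K)$. Moreover, $\chi_{u,n}$ is irreducible over $K$ if and only if $G_K$ acts transitively on the set of points of $E(\overline{K})$ of exact order $n$.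
   Context: $\overline{K}$ is an algebraic closure of $K$, $G_K=\mathrm{Gal}(\overline{K}/K)$, and $\rho_{E,n}:G_K\to\mathrm{Aut}(E[n])\simeq \mathrm{GL}_2(\mathbb{Z}/n\mathbb{Z})$ is the Galois representation on the $n$-torsion of $E$. The notation $\rho_{E,n}(G_K)/\{\pm\mathrm{id}\}$ means the image of $\rho_{E,n}(G_K)$ in $\mathrm{GL}_2(\mathbb{Z}/n\mathbb{Z})/\{\pm\mathrm{id}\}$ (whether or not $-\mathrm{id}\in\rho_{E,n}(G_K)$). The Galois group of a polynomial $f\in K[X]$ is the Galois group over $K$ of its splitting field in $\overline{K}$. $w_E(X,Y)=Y^2+a_1XY+a_3Y-X^3-a_2X^2-a_4X-a_6$ with $a_i\in K$, and $K(E)=K(x,y)$ is the function field. $[-1]^*u$ is the pull-back of $u$ by the inversion of $E$, i.e. $y$ is replaced by $-y-a_1x-a_3$. Let $(\psi_n)_{n\ge1}$ be the usual division polynomials of $E$ (with $\psi_1=1$, $\psi_2=2y+a_1x+a_3$, $\psi_n^2$ being a polynomial in $x$ with leading coefficient $n^2$ whose roots are the $x$-coordinates of the nonzero $n$-torsion points). The primitive division polynomials $\widetilde{\psi}_n$ are defined recursively by $\psi_n=\prod_{m\mid n}\widetilde{\psi}_m$. For $n\ge 3$, $\widetilde{\psi}_n$ is a polynomial in $K[X]$ in the variable $x$. *)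

(* Defs.v *)
From HB Require Import structures.
From mathcomp Require Import all_boot all_order all_algebra all_fingroup.
From mathcomp Require Import all_solvable all_field.
From mathcomp Require Import finmap.
From mathcomp Require Import boolp classical_sets cardinality.
From mathcomp Require Import zify ring.

Set Implicit Arguments.
Unset Strict Implicit.
Unset Printing Implicit Defensive.

Import GRing.Theory.
Local Open Scope ring_scope.

Section PolyGalois.

Let map_poly_ext (F : fieldType) (L : fieldExtType F) :=
  map_poly (in_alg L) : {poly F} -> {poly L}.
Local Notation "p ^%:A" := (map_poly_ext _ p) : ring_scope.

Lemma irreducible_factor (F : fieldType) (p : {poly F}) : (1 < size p)%N ->
  {r : {poly F} | r %| p & irreducible_poly r}.
Proof.
move=> p_gt1; pose P r := (r %| p) /\ irreducible_poly r.
suff /cid[r [? ?]] : exists r, P r by exists r.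
rewrite /P {P}; have [n] := ubnP (size p); elim: n p p_gt1 => // n IHn p p_gt1 lepn.
have [irr_p|red_p] := pselect (irreducible_poly p); first by exists p.
have [q [q_neq1 q_dv q_neq]] :
    exists q : {poly F}, [/\ size q != 1%N, q %| p & ~~ (q %= p)].
  apply: contrapT => noq; apply: red_p; split=> // q q1 qp.
  by apply: contrapT => /negP qNp; apply: noq; exists q.
have p_neq0 : p != 0 by rewrite -size_poly_gt0 ltnW.
have q_neq0 := dvdpN0 q_dv p_neq0.
have q_gt1 : (1 < size q)%N by rewrite ltn_neqAle eq_sym q_neq1 size_poly_gt0.
have lt_qp : (size q < size p)%N.
  by rewrite ltn_neqAle dvdp_leq// andbT dvdp_size_eqp.
have [r [rq irr_r]] := IHn q q_gt1 (leq_trans lt_qp lepn).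
by exists r; split=> //; apply: dvdp_trans rq q_dv.
Qed.

Lemma splittingField_exists (F : fieldType) (p : {poly F}) :
  p != 0 -> {L : splittingFieldType F | splittingFieldFor 1 p^%:A {:L}}.
Proof.
have mapXsubC (f : {rmorphism _ -> _}) x:
    map_poly f ('X - x%:P) = 'X - (f x)%:P.
  by rewrite rmorphB /= map_polyX map_polyC.
move=> nz_p; pose splits q := {zs | q %= \prod_(z <- zs) ('X - z%:P)}.
suffices [L splitLp]: {L : fieldExtType F | splittingFieldFor 1 p^%:A {:L}}.
  have axL : SplittingField.axiom L.
    by exists p^%:A => //; apply/polyOver1P; exists p.
  by exists (HB.pack_for (splittingFieldType F) L
    (FieldExt_isSplittingField.Build F L axL)).
suffices [L [ys Dp]]: {L : fieldExtType F & splits L p^%:A}.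
  pose Lp := subvs_of <<1 & ys>>; pose toL := linfun (vsval : Lp -> L).
  have [zs Dys]: {zs | map toL zs = ys}.
    exists (map (vsproj _) ys); rewrite -map_comp map_id_in // => y ys_y.
    by rewrite /= lfunE /= vsprojK ?seqv_sub_adjoin.
  exists Lp, zs.
    set lhs := (lhs in lhs %= _); set rhs := (rhs in _ %= rhs).
    suffices: map_poly toL lhs %= map_poly toL rhs by rewrite eqp_map.
    rewrite -Dys big_map in Dp; apply: etrans Dp; apply: congr2.
      by rewrite -map_poly_comp; apply/eq_map_poly=> x; apply: rmorph_alg.
    by rewrite rmorph_prod; apply/eq_bigr=> z _; apply: mapXsubC.
  set Lzs := LHS; pose Lys := (toL @: Lzs)%VS; apply/vspaceP=> u.
  have: val u \in Lys by rewrite /Lys aimg_adjoin_seq aimg1 Dys (valP u).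
  by case/memv_imgP=> v Lzs_v; rewrite memvf lfunE => /val_inj->.
move: {2}_.+1 (ltnSn (size p)) => n; elim: n => // n IHn in F p nz_p * => lbn.
have [Cp|C'p] := leqP (size p) 1.
  exists F^o, [::].
  by rewrite big_nil -size_poly_eq1 size_map_poly eqn_leq Cp size_poly_gt0.
have [r r_dv_p irr_r] := irreducible_factor C'p.
have{irr_r} [K _ [x rx0 defK]] := irredp_FAdjoin irr_r.
have{r rx0 r_dv_p} /factor_theorem/sig_eqW[q Dp]: root p^%:A x.
  by rewrite -(divpK r_dv_p) [_^%:A]rmorphM rootM rx0 orbT.
have Dszp: size p = size (q * ('X - x%:P)) by rewrite -Dp size_map_poly.
have nz_q: q != 0.
  by move: nz_p; rewrite -size_poly_eq0 Dszp size_poly_eq0 mulf_eq0 => /norP[].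
have [L [zs Dq]]: {L : fieldExtType K & splits L q^%:A}.
  apply: (IHn K q nz_q).
  by rewrite ltnS Dszp size_mul ?polyXsubC_eq0 ?size_XsubC ?addn2 in lbn.
suffices: splits L p^%:A^%:A.
  rewrite -[_^%:A]map_poly_comp.
  rewrite -(eq_map_poly (fun a : F => baseField_scaleE a 1)).
  by exists (baseFieldType L).
exists (x%:A :: zs); rewrite big_cons; set rhs := _ * _.
by rewrite Dp mulrC [_^%:A]rmorphM /= mapXsubC /= eqp_mull.
Qed.

(* Junk value at p = 0: the splitting field of 1. *)
Definition splittingField (F : fieldType) (p : {poly F}) : splittingFieldType F :=
  if pselect (p != 0) is left nz_p then sval (splittingField_exists nz_p)
  else sval (splittingField_exists (oner_neq0 {poly F})).

Lemma splittingFieldP (F : fieldType) (p : {poly F}) : p != 0 ->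
  splittingFieldFor 1 (map_poly (in_alg (splittingField p)) p)
    {:splittingField p}.
Proof.
by rewrite /splittingField; case: pselect => // nz_p _; case: splittingField_exists.
Qed.

Definition galoisGroup (F : fieldType) (p : {poly F}) :
    {group gal_of {:splittingField p}} :=
  'Gal({:splittingField p} / 1%AS)%G.

End PolyGalois.

Record weierstrass (R : Type) :=
  Weierstrass { a1 : R; a2 : R; a3 : R; a4 : R; a6 : R }.

Definition map_weierstrass (R S : Type) (f : R -> S) (E : weierstrass R) :=
  Weierstrass (f (a1 E)) (f (a2 E)) (f (a3 E)) (f (a4 E)) (f (a6 E)).

Section Invariants.
Variables (R : comNzRingType) (E : weierstrass R).

Definition b2 := a1 E ^+ 2 + 4 * a2 E.
Definition b4 := 2 * a4 E + a1 E * a3 E.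
Definition b6 := a3 E ^+ 2 + 4 * a6 E.
Definition b8 := a1 E ^+ 2 * a6 E + 4 * a2 E * a6 E - a1 E * a3 E * a4 E
                 + a2 E * a3 E ^+ 2 - a4 E ^+ 2.
Definition discriminant :=
  - b2 ^+ 2 * b8 - 8 * b4 ^+ 3 - 27 * b6 ^+ 2 + 9 * b2 * b4 * b6.

(* w_E(x, Y), as a polynomial in Y over R. *)
Definition wpoly (x : R) : {poly R} :=
  'X^2 + (a1 E * x + a3 E)%:P * 'X
  - (x ^+ 3 + a2 E * x ^+ 2 + a4 E * x + a6 E)%:P.

Lemma size_wpoly_lower (x : R) :
  (size ((a1 E * x + a3 E)%:P * 'X
    - (x ^+ 3 + a2 E * x ^+ 2 + a4 E * x + a6 E)%:P)%R
   < size ('X^2 : {poly R}))%N.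
Proof.
rewrite size_polyXn ltnS (leq_trans (size_polyD _ _))// geq_max size_polyN.
rewrite (leq_trans (size_polyC_leq1 _))// andbT.
rewrite (leq_trans (size_polyMleq _ _))// size_polyX addn2/=.
by rewrite ltnS size_polyC_leq1.
Qed.

Lemma size_wpoly (x : R) : size (wpoly x) = 3%N.
Proof.
by rewrite /wpoly -addrA size_polyDl ?size_wpoly_lower// size_polyXn.
Qed.

Lemma monic_wpoly (x : R) : wpoly x \is monic.
Proof.
by rewrite monicE /wpoly -addrA lead_coefDl ?size_wpoly_lower// lead_coefXn.
Qed.

End Invariants.

Section Points.
Variables (F : fieldType) (E : weierstrass F).

(* None is the point at infinity. *)
Definition ecpoint : Type := option (F * F).
HB.instance Definition _ := Choice.on ecpoint.

Definition on_curve (P : ecpoint) : bool :=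
  if P is Some (x, y) then
    y ^+ 2 + a1 E * x * y + a3 E * y
    == x ^+ 3 + a2 E * x ^+ 2 + a4 E * x + a6 E
  else true.

Definition oppP (P : ecpoint) : ecpoint :=
  if P is Some (x, y) then Some (x, - y - a1 E * x - a3 E) else None.

Definition addP (P Q : ecpoint) : ecpoint :=
  match P, Q with
  | None, _ => Q
  | _, None => P
  | Some (x1, y1), Some (x2, y2) =>
    if (x1 == x2) && (y1 == - y2 - a1 E * x2 - a3 E) then None else
    let l :=
      if x1 == x2 then
        (3 * x1 ^+ 2 + 2 * a2 E * x1 + a4 E - a1 E * y1)
        / (2 * y1 + a1 E * x1 + a3 E)
      else (y2 - y1) / (x2 - x1) in
    let x3 := l ^+ 2 + a1 E * l - a2 E - x1 - x2 in
    Some (x3, - (l * (x3 - x1) + y1) - a1 E * x3 - a3 E)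
  end.

Definition mulP (n : nat) (P : ecpoint) : ecpoint := iter n (addP P) None.

Definition torsion (n : nat) : set ecpoint :=
  [set P | on_curve P /\ mulP n P = None]%classic.

Definition exact_order (n : nat) (P : ecpoint) : Prop :=
  [/\ on_curve P, mulP n P = None &
      forall m, (0 < m < n)%N -> mulP m P <> None].

(* fset_set A has the elements of A when A is finite (as is the torsion set
   when n > 0 and E is nonsingular), and is empty otherwise. *)
Definition torsion_fset (n : nat) : {fset ecpoint} := fset_set (torsion n).

End Points.

Local Notation "x %:F" := (@FracField.tofrac _ x) : ring_scope.

Section FractionRepr.
Local Open Scope quotient_scope.

Lemma fraction_repr (R : idomainType) (r : {fraction R}) :
  exists p q : R, q != 0 /\ r * q%:F = p%:F.
Proof.
exists \n_(generic_quotient.repr r), \d_(generic_quotient.repr r); split.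
  exact: denom_ratioP.
unlock FracField.tofrac.
rewrite -{1}[r]reprK -[LHS]FracField.pi_mul /FracField.mulf.
rewrite !numden_Ratio ?oner_neq0// mulr1.
apply/eqmodP; rewrite /= FracField.equivfE !numden_Ratio ?oner_neq0 ?denom_ratioP// mulr1.
by rewrite mulrC.
Qed.

End FractionRepr.

Lemma quad_clear (F : fieldType) (p q l c : F) : q != 0 ->
  (p / q) ^+ 2 + l * (p / q) - c = 0 -> p ^+ 2 + l * p * q = c * q ^+ 2.
Proof.
move=> nz_q eq0; apply/eqP; rewrite -subr_eq0; apply/eqP.
transitivity (0 * q ^+ 2); last by rewrite mul0r.
by rewrite -eq0; field.
Qed.

Lemma leq_sizeD (R : nzRingType) (p q : {poly R}) n :
  (size p <= n)%N -> (size q <= n)%N -> (size (p + q)%R <= n)%N.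
Proof. by move=> pn qn; rewrite (leq_trans (size_polyD _ _))// geq_max pn. Qed.

Lemma leq_sizeCXn (R : nzRingType) (c : R) k : (size (c%:P * 'X^k)%R <= k.+1)%N.
Proof.
by rewrite mul_polyC (leq_trans (size_scale_leq _ _))// size_polyXn.
Qed.

Lemma quad_cubic_neq (K : fieldType) (L C p q : {poly K}) :
    (size L <= 2)%N -> size C = 4%N -> q != 0 ->
  p ^+ 2 + L * p * q != C * q ^+ 2.
Proof.
move=> szL szC nz_q.
have nz_C : C != 0 by rewrite -size_poly_gt0 szC.
have q_gt0 : (0 < size q)%N by rewrite size_poly_gt0.
have szR : size (C * q ^+ 2) = (size q).*2.+2.
  rewrite size_mul ?expf_neq0// szC expr2 size_mul//.
  by case: (size q) q_gt0 => // k _; lia.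
apply/eqP => /(congr1 (fun f : {poly K} => size f)).
rewrite {}szR; set S := p ^+ 2 + _.
have szLpq : (size (L * p * q)%R <= size p + size q)%N.
  rewrite (leq_trans (size_polyMleq _ _))// -subn1 leq_subLR addnA leq_add2r.
  rewrite (leq_trans (size_polyMleq _ _))//.
  by move: szL; move: (size p) (size L) => a b; lia.
have szp2 : (size (p ^+ 2) <= (size p + size p).-1)%N by apply: size_polyMleq.
have [le_pq|lt_qp] := leqP (size p) (size q).+1.
  move=> eS; suff : (size S <= (size q).*2.+1)%N by rewrite eS ltnn.
  apply: leq_sizeD; [apply: leq_trans szp2 _|apply: leq_trans szLpq _].
    by move: le_pq; move: (size p) (size q) => a b; lia.
  by move: le_pq; move: (size p) (size q) => a b; lia.
have nz_p : p != 0 by rewrite -size_poly_gt0 (leq_trans _ lt_qp).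
have szp2E : size (p ^+ 2) = (size p + size p).-1 by rewrite expr2 size_mul.
rewrite /S size_polyDl szp2E.
  by move: lt_qp; move: (size p) (size q) => a b; lia.
apply: leq_ltn_trans szLpq _.
by move: lt_qp; move: (size p) (size q) => a b; lia.
Qed.

Section FunctionField.
Variables (K : fieldType) (E : weierstrass K).

Let Kx := {fraction {poly K}}.

Definition wKx : {poly Kx} :=
  wpoly (map_weierstrass (fun c : K => (c%:P)%:F) E) ('X%:F : Kx).

Lemma wKx_irreducible : monic_irreducible_poly wKx.
Proof.
split; last exact: monic_wpoly.
apply: cubic_irreducible; first by rewrite size_wpoly.
move=> r; apply/negP; rewrite /root /wKx /wpoly !hornerE /=.
have [p [q [nz_q rq]]] := fraction_repr r.
have nz_qF : q%:F != 0 by rewrite tofrac_eq0.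
have {rq} -> : r = p%:F / q%:F by rewrite -rq mulfK.
pose L : {poly K} := (a1 E)%:P * 'X + (a3 E)%:P.
pose C : {poly K} :=
  'X ^+ 3 + ((a2 E)%:P * 'X ^+ 2 + (a4 E)%:P * 'X + (a6 E)%:P).
move=> /eqP eq0.
have {eq0}: p ^+ 2 + L * p * q = C * q ^+ 2.
  have eqF : p%:F ^+ 2 + L%:F * p%:F * q%:F = C%:F * q%:F ^+ 2.
    apply: (quad_clear nz_qF); rewrite -eq0 /L /C !addrA.
    by rewrite !tofracD !tofracM (exprSr 'X%:F 2) !expr2 !mulrA.
  move: eqF; rewrite -!tofracXn.
  rewrite -!tofracM -tofracD => /eqP; rewrite tofrac_eq => /eqP.
  by [].
apply/eqP/quad_cubic_neq => //.
  rewrite /L leq_sizeD// ?(leq_trans (size_polyC_leq1 _))//.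
  exact: (leq_sizeCXn _ 1).
rewrite /C size_polyDl size_polyXn// ltnS !leq_sizeD//.
- exact: leq_sizeCXn.
- exact: leq_trans (leq_sizeCXn _ 1) _.
- by rewrite (leq_trans (size_polyC_leq1 _)).
Qed.

(* K(E) as K(X)[Y]/(w_E). *)
Definition functionField : fieldType := {poly %/ wKx with wKx_irreducible}.

Definition polyFF (f : {poly K}) : functionField :=
  qfpoly_const wKx_irreducible f%:F.
Definition constFF (c : K) : functionField := polyFF c%:P.
Definition xFF : functionField := polyFF 'X.
Definition yFF : functionField := in_qpoly wKx 'X.

(* K(u, v) = K(E): no proper subfield contains K, u and v. *)
Definition generatesFF (u v : functionField) : Prop :=
  forall S : {pred functionField}, divring_closed S ->
    (forall c, constFF c \in S) -> u \in S -> v \in S -> forall z, z \in S.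

(* The function alpha x + beta y + gamma, and its pull-back by the inversion. *)
Definition affFF (alpha beta gamma : K) : functionField :=
  constFF alpha * xFF + constFF beta * yFF + constFF gamma.
Definition affFF_opp (alpha beta gamma : K) : functionField :=
  constFF alpha * xFF
  + constFF beta * (- yFF - constFF (a1 E) * xFF - constFF (a3 E))
  + constFF gamma.

Local Notation EF := (map_weierstrass constFF E).

Definition psi2 : functionField := 2 * yFF + a1 EF * xFF + a3 EF.
Definition psi3 : functionField :=
  3 * xFF ^+ 4 + b2 EF * xFF ^+ 3 + 3 * b4 EF * xFF ^+ 2 + 3 * b6 EF * xFF
  + b8 EF.
Definition psi4 : functionField :=
  psi2 * (2 * xFF ^+ 6 + b2 EF * xFF ^+ 5 + 5 * b4 EF * xFF ^+ 4
    + 10 * b6 EF * xFF ^+ 3 + 10 * b8 EF * xFF ^+ 2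
    + (b2 EF * b8 EF - b4 EF * b6 EF) * xFF + (b4 EF * b8 EF - b6 EF ^+ 2)).

(* The usual recursion, in K(E), for n = 2m + 1 and n = 2m; any fuel >= n gives
   the same value. *)
Fixpoint psi_rec (fuel n : nat) : functionField :=
  if fuel is k.+1 then
    match n with
    | 0 => 0
    | 1 => 1
    | 2 => psi2
    | 3 => psi3
    | 4 => psi4
    | _ =>
      let m := n./2 in
      if odd n then
        psi_rec k m.+2 * psi_rec k m ^+ 3
        - psi_rec k m.-1 * psi_rec k m.+1 ^+ 3
      else
        psi_rec k m
        * (psi_rec k m.+2 * psi_rec k m.-1 ^+ 2
           - psi_rec k m.-2 * psi_rec k m.+1 ^+ 2) / psi2
    end
  else 0.

Definition psi (n : nat) : functionField := psi_rec n n.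

(* psi n is the product of the primpsi m for m dividing n (n > 0). *)
Fixpoint primpsi_rec (fuel n : nat) : functionField :=
  if fuel is k.+1 then
    psi n / \prod_(m <- divisors n | m != n) primpsi_rec k m
  else 1.

Definition primpsi (n : nat) : functionField := primpsi_rec n n.

(* The f in K[X] such that f(x) = primpsi n, which exists when n >= 3; it is
   unique since x is transcendental over K. *)
Definition primdivpoly (n : nat) : {poly K} :=
  xget 0 [set f | polyFF f = primpsi n]%classic.

End FunctionField.

Section QuotientAlgebra.
Variables (K : fieldType) (E : weierstrass K) (f : {poly K}).

(* {poly %/ g} is the quotient by g only for g monic and nonconstant; f and its
   monic associate g generate the same ideal. *)
Let g : {poly K} := (lead_coef f)^-1 *: f.

Definition wquot : {poly {poly %/ g}} :=
  wpoly (map_weierstrass (@qpolyC _ g) E) 'qX.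

(* K[X, Y]/(w_E, f) as (K[X]/(f))[Y]/(w_E). *)
Definition quotAlg : predArgType := {poly %/ wquot}.

HB.instance Definition _ := GRing.ComNzRing.on quotAlg.

Definition quotAlg_scale (c : K) (v : quotAlg) : quotAlg :=
  (qpolyC g c : {poly %/ g}) *: (v : {poly %/ wquot}).

Fact quotAlg_scaleA a b v :
  quotAlg_scale a (quotAlg_scale b v) = quotAlg_scale (a * b) v.
Proof. by rewrite /quotAlg_scale scalerA rmorphM. Qed.

Fact quotAlg_scale1 : left_id 1 quotAlg_scale.
Proof. by move=> v; rewrite /quotAlg_scale rmorph1 scale1r. Qed.

Fact quotAlg_scaleDr : right_distributive quotAlg_scale +%R.
Proof. by move=> c u v; rewrite /quotAlg_scale scalerDr. Qed.

Fact quotAlg_scaleDl v : {morph quotAlg_scale^~ v : a b / a + b}.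
Proof. by move=> a b; rewrite /quotAlg_scale rmorphD scalerDl. Qed.

HB.instance Definition _ := GRing.Zmodule_isLmodule.Build K quotAlg
  quotAlg_scaleA quotAlg_scale1 quotAlg_scaleDr quotAlg_scaleDl.

Fact quotAlg_scaleAl (c : K) (u v : quotAlg) : c *: (u * v) = (c *: u) * v.
Proof. exact: (@scalerAl _ {poly %/ wquot}). Qed.

HB.instance Definition _ :=
  GRing.Lmodule_isLalgebra.Build K quotAlg quotAlg_scaleAl.

Fact quotAlg_scaleAr (c : K) (u v : quotAlg) : c *: (u * v) = u * (c *: v).
Proof. exact: (@scalerAr _ {poly %/ wquot}). Qed.

HB.instance Definition _ :=
  GRing.Lalgebra_isAlgebra.Build K quotAlg quotAlg_scaleAr.

Let d1 := (size (mk_monic wquot)).-1.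
Let d2 := (size (mk_monic g)).-1.

Fact quotAlg_vect_axiom : Vector.axiom (d1 * d2) quotAlg.
Proof.
pose toM (v : quotAlg) : 'M[K]_(d1, d2) :=
  \matrix_(i, j) (((v : {poly {poly %/ g}})`_i : {poly %/ g}) : {poly K})`_j.
pose ofM (M : 'M[K]_(d1, d2)) : quotAlg :=
  rVnpoly (\row_i (rVnpoly (row i M) : {poly %/ g})).
exists (mxvec \o toM).
  move=> c u v /=; rewrite -linearP; congr mxvec; apply/matrixP=> i j.
  have coefc (a b : {poly %/ g}) :
      ((qpolyC g c * a + b : {poly %/ g}) : {poly K})`_j = c * a`_j + b`_j.
    have -> : qpolyC g c * a = c *: a.
      by rewrite -[in RHS](mul1r a) scalerAl; congr (_ * _);
        apply/val_inj; rewrite /= alg_polyC.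
    by rewrite coefD coefZ.
  by rewrite !mxE /= coefD coefZ coefc.
exists (ofM \o vec_mx) => [v|M] /=.
  rewrite mxvecK /ofM -[RHS]npoly_rV_K; congr rVnpoly; apply/rowP=> i.
  rewrite !mxE -[RHS]npoly_rV_K; congr rVnpoly; apply/rowP=> j.
  by rewrite !mxE.
rewrite -[RHS]vec_mxK; congr mxvec; apply/matrixP=> i j; rewrite !mxE /ofM.
have coefV (R : nzRingType) n (w : 'rV[R]_n) (k : 'I_n) :
    (rVnpoly w : {poly R})`_k = w 0 k.
  by rewrite -[in RHS](rVnpolyK w) mxE.
by rewrite coefV !mxE coefV !mxE.
Qed.

HB.instance Definition _ := Lmodule_hasFinDim.Build K quotAlg quotAlg_vect_axiom.
HB.instance Definition _ := Algebra_isFalgebra.Build K quotAlg.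

Definition xA : quotAlg := qpolyC wquot 'qX.
Definition yA : quotAlg := 'qX.
Definition affA (alpha beta gamma : K) : quotAlg :=
  alpha *: xA + beta *: yA + gamma *: 1.

End QuotientAlgebra.

Definition char_poly_amull (K : fieldType) (A : falgType K) (u : A) : {poly K} :=
  char_poly (passmx.mxof (vbasis {:A}) (vbasis {:A}) (amull u)).

(* chi_{u,n} for u = alpha x + beta y + gamma. *)
Definition chi (K : fieldType) (E : weierstrass K) (alpha beta gamma : K)
    (n : nat) : {poly K} :=
  char_poly_amull (affA E (primdivpoly E n) alpha beta gamma).

(* The elements of Gal(L / iota K); an algebraic closure L gives G_K. *)
Record absGal (K L : fieldType) (iota : K -> L) := AbsGal {
  absGal_fun :> {rmorphism L -> L};
  absGal_bij : bijective absGal_fun;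
  absGal_fix : forall c, absGal_fun (iota c) = iota c }.

Section GaloisAction.
Variables (K L : fieldType) (iota : K -> L) (E : weierstrass K) (n : nat).

Local Notation EL := (map_weierstrass iota E).
Implicit Types (s : absGal iota) (P Q : ecpoint L).

Definition galP s P : ecpoint L := omap (fun xy => (s xy.1, s xy.2)) P.

Lemma galP_inj s : injective (galP s).
Proof.
by move=> [[x y]|] [[x' y']|] //= [/fmorph_inj-> /fmorph_inj->].
Qed.

Lemma galP_on_curve s P : on_curve EL P -> on_curve EL (galP s P).
Proof.
case: P => [[x y]|] //= /eqP/(congr1 s).
by rewrite !(rmorphD, rmorphM, rmorphXn)/= !absGal_fix => /eqP.
Qed.

Lemma galP_add s P Q : galP s (addP EL P Q) = addP EL (galP s P) (galP s Q).
Proof.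
case: P Q => [[x y]|] [[x' y']|] //=.
have -> : - s y' - iota (a1 E) * s x' - iota (a3 E)
    = s (- y' - iota (a1 E) * x' - iota (a3 E)).
  by rewrite !(rmorphB, rmorphN, rmorphM)/= !absGal_fix.
rewrite !(inj_eq (fmorph_inj s)); case: ifP => //= _.
set l := if _ then _ else _; set l' := if _ then _ else _.
have <- : s l = l'.
  rewrite /l /l'; case: ifP => _;
    by rewrite !(rmorphD, rmorphB, rmorphN, rmorphM, fmorphV, rmorphXn, rmorph_nat)/= ?absGal_fix.
by rewrite !(rmorphD, rmorphB, rmorphN, rmorphM, rmorphXn)/= !absGal_fix.
Qed.

Lemma galP_torsion s P : torsion EL n P -> torsion EL n (galP s P).
Proof.
move=> [PE nP]; split; first exact: galP_on_curve.
suff -> : mulP EL n (galP s P) = galP s (mulP EL n P) by rewrite nP.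
by rewrite /mulP; elim: n => //= m ->; rewrite galP_add.
Qed.

Lemma galP_torsion_fset s (P : torsion_fset EL n) :
  galP s (val P) \in torsion_fset EL n.
Proof.
move: (val P) (valP P) => {}P; rewrite /torsion_fset.
have [fin|infin] := pselect (finite_set (torsion EL n)).
  by rewrite !in_fset_set// !inE; apply: galP_torsion.
by rewrite /fset_set; case: pselect.
Qed.

Lemma galP_torsion_inj s :
  injective (fun P : torsion_fset EL n => [` galP_torsion_fset s P]%fset).
Proof. by move=> P Q /(congr1 val)/galP_inj/val_inj. Qed.

Definition rho s : {perm torsion_fset EL n} := perm (@galP_torsion_inj s).

(* The image of rho_{E,n} : Gal(L / K) -> Aut(E[n]), in the permutations of
   E[n]. *)
Definition rho_image : {set {perm torsion_fset EL n}} :=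
  [set g | `[< exists s, g = rho s >]].

(* {id, -id}. It is normalized by the image of rho, so rho_image / pm_id is the
   image of rho_image in Aut(E[n]) / {id, -id}, whether or not -id lies in
   rho_image. *)
Definition pm_id : {set {perm torsion_fset EL n}} :=
  [set g : {perm torsion_fset EL n} |
    [forall P, g P == P] || [forall P, val (g P) == oppP EL (val P)]].

Definition gal_transitive : Prop :=
  forall P Q, exact_order EL n P -> exact_order EL n Q ->
  exists s : absGal iota, galP s P = Q.

End GaloisAction.

(* Main.v *)
(* Associativity of the group law: attach to a point P the maximal ideal m_P of
   the coordinate ring F[X][t]/(t^2 - B); since m_P m_{-P} is principal and a
   line cuts out a product of three such ideals, P + Q + R is determined by the
   class of m_P m_Q m_R. The symmetric relation between x(P), x(Q) and x(P + Q)
   then yields the elliptic net relation for the division polynomials, hence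
   [n]P = O iff psi_n(P) = 0. A generic fibre of [n] has n^2 points, so #E[n] is
   n^2 for all n and E[n] is free of rank 2 over Z/n; comparing with the degree
   of psi_n shows that the n-th primitive division polynomial T_n is separable,
   its roots being the x-coordinates of the points of exact order n. Comparing
   the two leading coefficients, the mean of these roots is -b2/12 for every n.

   (1) An automorphism fixes the roots of T_n iff it maps each point of exact
   order n to itself or its opposite, and an endomorphism of E[n] with this
   property is id or -id.

   (2) The points of exact order n are the characters of K[X, Y]/(w_E, T_n), so
   the roots of chi are the u(P). That K(u, [-1]^*u) is all of K(E) gives
   beta != 0 and 2 alpha != beta a1, whence u(P) and u(-P) determine P. If chi
   is irreducible, its roots are simple and permuted transitively, hence so are
   the points. Conversely, let the points be permuted transitively. If
   u(P) = u(Q) with P != Q, then P, Q and R = -(P + Q) lie on a line of slope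
   l = -alpha / beta, and x(P) + x(Q) + x(R) = l^2 + a1 l - a2. Averaging over
   the Galois group replaces the left-hand side by -b2/4, which forces
   2 l + a1 = 0: a contradiction. So u is injective on the points of exact order
   n, and chi is separable with transitively permuted roots. *)

Require Import Defs.
From HB Require Import structures.
From mathcomp Require Import all_boot all_order all_algebra all_fingroup.
From mathcomp Require Import all_solvable all_field.
From mathcomp Require Import finmap.
From mathcomp Require Import boolp classical_sets cardinality.
From mathcomp Require Import zify ring.

Set Implicit Arguments.
Unset Strict Implicit.
Unset Printing Implicit Defensive.

Import GRing.Theory.
Local Open Scope ring_scope.

(** * The group law *)

(** All computations use t = 2y + a1 x + a3, in which the curve reads t^2 = B(x), inversion is t ->
    -t, and the mean of the roots of B is -b2/12. The obstacle with division polynomials is that the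
    formulas for x([k]P) divide by earlier psi_k, so the recurrences can be compared with the group
    law only at points where no earlier psi_k vanishes. The elliptic net relation is therefore
    proved at such points, becomes a polynomial identity because they are dense ([eds_defect0]), and
    is then specialised to every point, where it controls the zeros of k -> psi_k(P). The n^2 points
    of a generic fibre of [n] are read off the roots of phi_n - c psi_n^2, which are simple because
    a Wronskian with leading coefficient n^2 is nonzero. In the last step the third point R of the
    line may have any order d > 1 dividing n; hence the mean of the abscissas is needed for every
    such d, d = 2 included, and transitivity has to pass from n to d. *)

Ltac nlia :=
  repeat match goal with
  | H : forall _, _ |- _ => clear H
  | H : @eq ?T _ _ |- _ => lazymatch T with nat => fail | _ => clear H end
  | H : is_true (~~ (@eq_op ?T _ _)) |- _ =>
      lazymatch T with nat => fail | _ => clear H end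
  end; lia.

Section Chord.
Variables (F : fieldType) (E : weierstrass F).
Hypothesis two_neq0 : 2 != 0 :> F.

(** The ordinate after completing the square, which is also the value of psi_2: opposite points have
    opposite values. *)
Definition twoY (x y : F) : F := 2 * y + a1 E * x + a3 E.

Definition two_tors (x : F) : F :=
  4 * x ^+ 3 + b2 E * x ^+ 2 + 2 * b4 E * x + b6 E.

Lemma twoY_opp x y : twoY x (- y - a1 E * x - a3 E) = - twoY x y.
Proof. by rewrite /twoY; ring. Qed.

Lemma twoY_inj x : injective (twoY x).
Proof.
by move=> y y' /addIr/addIr/(mulfI two_neq0).
Qed.

Lemma on_curveE x y :
  on_curve E (Some (x, y)) = (twoY x y ^+ 2 == two_tors x).
Proof.
have nz4 : 4 != 0 :> F by rewrite (_ : 4 = 2 * 2) ?mulf_neq0//; ring.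
rewrite /= -(inj_eq (mulfI nz4)) -subr_eq0 -[RHS]subr_eq0.
by congr (_ == 0); rewrite /twoY /two_tors /b2 /b4 /b6; ring.
Qed.

(** Vieta's relations for B(x) - (m x + c)^2 = 4 (x - x1)(x - x2)(x - x3). In this form a tangent is
    just the case x1 = x2. *)
Definition on_line (m c x1 x2 x3 : F) :=
  [/\ m ^+ 2 - b2 E = 4 * (x1 + x2 + x3),
      b4 E - m * c = 2 * (x1 * x2 + x1 * x3 + x2 * x3)
    & c ^+ 2 - b6 E = 4 * (x1 * x2 * x3)].

Lemma on_lineP m c x1 x2 x3 x : on_line m c x1 x2 x3 ->
  two_tors x - (m * x + c) ^+ 2 = 4 * (x - x1) * (x - x2) * (x - x3).
Proof.
move=> [/eqP + /eqP + /eqP]; rewrite /two_tors !subr_eq => /eqP e1 /eqP e2 /eqP e3.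
have -> : b2 E = m ^+ 2 - 4 * (x1 + x2 + x3) by rewrite e1; ring.
have -> : b6 E = c ^+ 2 - 4 * (x1 * x2 * x3) by rewrite e3; ring.
by rewrite e2; ring.
Qed.

(** The difference of the equations at x1 and x2, divided by x1 - x2, yields the second relation of
    Vieta from the first; the equation at x1 then yields the third. *)
Lemma chord_on_line (m c x1 x2 x3 : F) : x1 != x2 ->
    (m * x1 + c) ^+ 2 = two_tors x1 -> (m * x2 + c) ^+ 2 = two_tors x2 ->
    m ^+ 2 - b2 E = 4 * (x1 + x2 + x3) ->
  on_line m c x1 x2 x3.
Proof.
rewrite /two_tors => nx h1 h2 e1; have nx' : x1 - x2 != 0 by rewrite subr_eq0.
have e2 : b4 E - m * c = 2 * (x1 * x2 + x1 * x3 + x2 * x3).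
  have hb2 : b2 E = m ^+ 2 - 4 * (x1 + x2 + x3) by rewrite -e1; ring.
  apply: (mulfI two_neq0); apply: (mulfI nx'); apply/eqP; rewrite -subr_eq0.
  set lhs := (X in X == 0); have -> : lhs
      = (4 * x1 ^+ 3 + b2 E * x1 ^+ 2 + 2 * b4 E * x1 + b6 E - (m * x1 + c) ^+ 2)
      - (4 * x2 ^+ 3 + b2 E * x2 ^+ 2 + 2 * b4 E * x2 + b6 E - (m * x2 + c) ^+ 2).
    by rewrite /lhs hb2; ring.
  by rewrite h1 h2 !subrr.
split=> //; have hb2 : b2 E = m ^+ 2 - 4 * (x1 + x2 + x3) by rewrite -e1; ring.
have hb4 : b4 E = m * c + 2 * (x1 * x2 + x1 * x3 + x2 * x3) by rewrite -e2; ring.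
have -> : b6 E = (m * x1 + c) ^+ 2 - (4 * x1 ^+ 3 + b2 E * x1 ^+ 2 + 2 * b4 E * x1).
  by rewrite h1; ring.
by rewrite hb2 hb4; ring.
Qed.

(** Here the derivative at the double root x1 replaces the second point of a chord. *)
Lemma tangent_on_line (m c x1 x3 : F) :
    (m * x1 + c) ^+ 2 = two_tors x1 ->
    2 * m * (m * x1 + c) = 12 * x1 ^+ 2 + 2 * b2 E * x1 + 2 * b4 E ->
    m ^+ 2 - b2 E = 4 * (x1 + x1 + x3) ->
  on_line m c x1 x1 x3.
Proof.
rewrite /two_tors => h1 h2 e1.
have hb2 : b2 E = m ^+ 2 - 4 * (x1 + x1 + x3) by rewrite -e1; ring.
have e2 : b4 E - m * c = 2 * (x1 * x1 + x1 * x3 + x1 * x3).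
  apply: (mulfI two_neq0).
  have -> : 2 * (b4 E - m * c)
      = 2 * m * (m * x1 + c) - 12 * x1 ^+ 2 - 2 * b2 E * x1 - 2 * m * c.
    by rewrite h2; ring.
  by rewrite hb2; ring.
have hb4 : b4 E = m * c + 2 * (x1 * x1 + x1 * x3 + x1 * x3) by rewrite -e2; ring.
split=> //.
have -> : b6 E = (m * x1 + c) ^+ 2 - (4 * x1 ^+ 3 + b2 E * x1 ^+ 2 + 2 * b4 E * x1).
  by rewrite h1; ring.
by rewrite hb2 hb4; ring.
Qed.

Lemma addP_line x1 y1 x2 y2 :
    on_curve E (Some (x1, y1)) -> on_curve E (Some (x2, y2)) ->
    Some (x1, y1) <> oppP E (Some (x2, y2)) ->
  exists x3 y3 m c,
    [/\ addP E (Some (x1, y1)) (Some (x2, y2)) = Some (x3, y3),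
        on_line m c x1 x2 x3,
        m * x1 + c = twoY x1 y1, m * x2 + c = twoY x2 y2
      & m * x3 + c = - twoY x3 y3].
Proof.
rewrite !on_curveE => /eqP c1 /eqP c2 nopp; rewrite /addP.
case: ifP => [/andP[/eqP ex /eqP ey]|nopp'].
  by case: nopp; rewrite /= ey ex.
set l := if _ then _ else _; set x3 := l ^+ 2 + _ - _ - _ - _.
set y3 := - _ - _ - _.
(* A line of slope l in (x, y) has slope 2 l + a1 in (x, t). Its third point is the opposite of the
   sum, whence the sign in [e3]. *)
pose m := 2 * l + a1 E; pose c := twoY x1 y1 - m * x1.
have e1 : m * x1 + c = twoY x1 y1 by rewrite /c; ring.
have e3 : m * x3 + c = - twoY x3 y3.
  by rewrite /c /m /y3 /twoY; ring.
have esum : m ^+ 2 - b2 E = 4 * (x1 + x2 + x3).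
  by rewrite /m /x3 /b2; ring.
have [ex|nx] := eqVneq x1 x2; last first.
  have e2 : m * x2 + c = twoY x2 y2.
    rewrite /c /m /l (negPf nx) /twoY; field.
    by rewrite subr_eq0 eq_sym.
  exists x3, y3, m, c; split=> //.
  by apply: chord_on_line => //; rewrite ?e1 ?e2.
have ey : y1 = y2.
  have /eqP : twoY x1 y1 ^+ 2 = twoY x1 y2 ^+ 2 by rewrite c1 ex c2.
  rewrite eqf_sqr => /orP[/eqP/twoY_inj//|].
  rewrite -twoY_opp => /eqP/twoY_inj eo.
  by move: nopp'; rewrite ex eqxx /= eo ex eqxx.
subst x2 y2.
have nz : twoY x1 y1 != 0.
  apply: contraFneq nopp' => t0; rewrite eqxx /=; apply/eqP/(@twoY_inj x1).
  by rewrite twoY_opp t0 oppr0.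
exists x3, y3, m, c; split=> //.
apply: tangent_on_line => //; rewrite e1 //.
rewrite /m /l eqxx /twoY /b2 /b4; move: nz; rewrite /twoY => nz; field.
by [].
Qed.

End Chord.

(* F[X][t]/(t^2 - B), the pair (p, q) standing for p + q t. *)
Definition coord_ring_of (F : fieldType) (B : {poly F}) : Type :=
  ({poly F} * {poly F})%type.

(** * The coordinate ring of t^2 = B and the ideals of its points *)

Section CoordinateRing.
Variables (F : fieldType) (B : {poly F}).

Local Notation coord_ring := (coord_ring_of B).
HB.instance Definition _ := GRing.Zmodule.on coord_ring.

Implicit Types f g h : coord_ring.
Definition coord_mul f g : coord_ring :=
  (f.1 * g.1 + f.2 * g.2 * B, f.1 * g.2 + f.2 * g.1).
Definition coord_one : coord_ring := (1, 0).

Fact coord_mulA : associative coord_mul.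
Proof. by move=> f g h; congr pair => /=; ring. Qed.
Fact coord_mulC : commutative coord_mul.
Proof. by move=> f g; congr pair => /=; ring. Qed.
Fact coord_mul1 : left_id coord_one coord_mul.
Proof. by case=> p q; congr pair => /=; ring. Qed.
Fact coord_mulD : left_distributive coord_mul +%R.
Proof. by move=> f g h; congr pair => /=; ring. Qed.
Fact coord_one_neq0 : coord_one != 0.
Proof. by rewrite xpair_eqE oner_eq0. Qed.

HB.instance Definition _ := GRing.Zmodule_isComNzRing.Build coord_ring
  coord_mulA coord_mulC coord_mul1 coord_mulD coord_one_neq0.

Definition cfun (p : {poly F}) : coord_ring := (p, 0).
Definition tfun : coord_ring := (0, 1).
Definition coord_norm f : {poly F} := f.1 ^+ 2 - f.2 ^+ 2 * B.
Definition coord_conj f : coord_ring := (f.1, - f.2).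

Lemma cfunB p q : cfun (p - q) = cfun p - cfun q.
Proof. by congr pair => /=; ring. Qed.
Lemma cfunM p q : cfun (p * q) = cfun p * cfun q.
Proof. by congr pair => /=; ring. Qed.
Lemma tfun2 : tfun * tfun = cfun B.
Proof. by congr pair => /=; ring. Qed.

Lemma coord_normM f g : coord_norm (f * g) = coord_norm f * coord_norm g.
Proof. by rewrite /coord_norm /=; ring. Qed.
Lemma coord_norm_cfun p : coord_norm (cfun p) = p ^+ 2.
Proof. by rewrite /coord_norm /=; ring. Qed.
Lemma coord_norm_conj f : coord_norm (coord_conj f) = coord_norm f.
Proof. by rewrite /coord_norm /=; ring. Qed.
Lemma coord_conjM f g : coord_conj (f * g) = coord_conj f * coord_conj g.
Proof. by congr pair => /=; ring. Qed.
Lemma coord_conjK : involutive coord_conj.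
Proof. by case=> p q; congr pair => /=; ring. Qed.
Lemma coord_conj_cfun p : coord_conj (cfun p) = cfun p.
Proof. by congr pair => /=; ring. Qed.

Lemma mul_cfun_inj p : p != 0 -> injective ( *%R (cfun p)).
Proof.
move=> nz [f1 f2] [g1 g2] /= [/eqP e1 /eqP e2].
move: e1 e2; rewrite !mul0r !addr0 => /eqP/(mulfI nz)-> /eqP/(mulfI nz)->.
by [].
Qed.

Implicit Types P : F * F.
Definition opp_pt P : F * F := (P.1, - P.2).
Definition coord_ev f P : F := f.1.[P.1] + f.2.[P.1] * P.2.

(** The ideal of -P is generated by X - x(P) and t + t(P): once f.2 (t + t(P)) is subtracted from f,
    what remains is a polynomial in X with root x(P). *)
Lemma coord_ev_opp f P : coord_ev f (opp_pt P) = 0 ->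
  exists u : coord_ring, f = cfun ('X - P.1%:P) * u + cfun f.2 * (tfun + cfun P.2%:P).
Proof.
rewrite /coord_ev /= => e0.
have /factor_theorem[q Dq] : root (f.1 - f.2 * P.2%:P) P.1.
  by rewrite /root !hornerE -[X in _ == X]e0; apply/eqP; ring.
exists (cfun q); case: f e0 Dq => f1 f2 /= _ Dq.
congr pair => /=; last by ring.
by rewrite [X in _ = X + _]addrC !mulr0 !mul0r addr0 add0r mulrC -Dq; ring.
Qed.

(* [vanish_on f a p D]: p times the product of the X - x(P), for P in D,
   divides f * a * prod_P g_P whenever each g_P vanishes at -P. As m_P * m_{-P}
   is generated by X - x(P), with a = p = 1 this says that f lies in the
   product of the maximal ideals m_P. *)
Fixpoint vanish_on f a (p : {poly F}) (D : seq (F * F)) : Prop :=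
  if D is P :: D' then
    forall g, coord_ev g (opp_pt P) = 0 ->
      vanish_on f (a * g) (p * ('X - P.1%:P)) D'
  else exists k, f * a = cfun p * k.

Lemma vanish_on_insert f a p D1 P D2 :
  vanish_on f a p (D1 ++ P :: D2) <-> vanish_on f a p (P :: D1 ++ D2).
Proof.
elim: D1 a p => // Q D1 IH a p /=; split=> H.
  by move=> g eg h eh; have /IH/(_ g eg) := H h eh; rewrite mulrAC [p * _ * _]mulrAC.
move=> h eh; apply/IH => g eg; have := H g eg h eh.
by rewrite mulrAC [p * _ * _]mulrAC.
Qed.

Lemma vanish_on_perm f a p D D' :
  perm_eq D D' -> vanish_on f a p D -> vanish_on f a p D'.
Proof.
elim: D D' a p => [|P D IH] D' a p.
  by move=> /perm_size/esym/size0nil->.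
move=> pe; have PD' : P \in D' by rewrite -(perm_mem pe) mem_head.
case/splitPr: PD' pe => D1 D2 pe.
move=> H; apply/vanish_on_insert => g eg; apply: IH (H g eg).
by move: pe; rewrite perm_sym perm_catC /= perm_cons perm_catC perm_sym.
Qed.

Lemma vanish_on_mul f f' a a' p p' D D' :
  vanish_on f a p D -> vanish_on f' a' p' D' ->
  vanish_on (f * f') (a * a') (p * p') (D ++ D').
Proof.
elim: D a p => [|P D IH] a p /= H H'; last first.
  by move=> g eg; have := IH _ _ (H g eg) H'; rewrite mulrAC [p * _ * _]mulrAC.
case: H => k Hk; elim: D' a' p' H' => [|P D' IH] a' p' /=.
  by case=> k' Hk'; exists (k * k'); rewrite cfunM mulrACA Hk Hk' mulrACA.
by move=> H' g eg; have := IH _ _ (H' g eg); rewrite !mulrA.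
Qed.

Lemma vanish_on_conj f a p D :
  vanish_on f a p D -> vanish_on (coord_conj f) (coord_conj a) p (map opp_pt D).
Proof.
elim: D a p => [|P D IH] a p /=.
  case=> k Hk; exists (coord_conj k).
  by rewrite -coord_conjM Hk coord_conjM coord_conj_cfun.
move=> H g; rewrite -[g]coord_conjK -coord_conjM => eg; apply/IH/H.
by move: eg; rewrite /coord_ev /= hornerN => <-; ring.
Qed.

(** Taking g_P = X - x(P) as test element, each P left in D contributes the same factor to both
    sides, and all these factors cancel together with r. *)
Lemma vanish_on_dvd f a r p D : r != 0 ->
  vanish_on f (a * cfun r) (p * r) D -> exists k, f * a = cfun p * k.
Proof.
elim: D r => [|P D IH] r nz /=.
  case=> k; rewrite !(mulrC _ r) cfunM mulrA !(mulrC _ (cfun r)) -mulrA.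
  by move=> /(mul_cfun_inj nz) Hk; exists k.
move=> /(_ (cfun ('X - P.1%:P))); rewrite -!mulrA -cfunM => H.
apply: (IH (r * ('X - P.1%:P))); last first.
  by apply: H; rewrite /coord_ev /= !hornerE subrr.
by rewrite mulf_neq0// polyXsubC_eq0.
Qed.

Lemma vanish_on_div p0 k a p D : p0 != 0 ->
  vanish_on (cfun p0 * k) a (p0 * p) D -> vanish_on k a p D.
Proof.
move=> nz; elim: D a p => [|P D IH] a p /=; last first.
  by move=> H g eg; apply: IH; rewrite mulrA; apply: H.
by case=> j; rewrite cfunM -!mulrA => /(mul_cfun_inj nz) Hj; exists j.
Qed.

Definition nonsingular : Prop :=
  forall x : F, B.[x] = 0 -> B^`().[x] != 0.

(* Here m_P * m_{-P} = (X - x(P)) is used, which is where nonsingularity enters. *)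
Lemma vanish_on_cancel P f a p D : nonsingular -> 2 != 0 :> F ->
    P.2 ^+ 2 = B.[P.1] ->
  vanish_on f a p (P :: opp_pt P :: D) -> vanish_on f a (p * ('X - P.1%:P)) D.
Proof.
move=> ns nz2 PB H.
have {H} : forall g1 g2, coord_ev g1 (opp_pt P) = 0 -> coord_ev g2 P = 0 ->
    vanish_on f (a * g1 * g2) (p * ('X - P.1%:P) ^+ 2) D.
  move=> g1 g2 e1 e2; rewrite expr2 mulrA; apply: (H g1 e1 g2).
  by case: P e2 {H PB e1} => x y /=; rewrite /opp_pt /= opprK.
elim: D a p => [|Q D IH] a p /= H; last first.
  move=> g eg; rewrite mulrAC; apply: IH => g1 g2 e1 e2.
  by have := H g1 g2 e1 e2 g eg; congr vanish_on; ring.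
set X0 := 'X - P.1%:P in H *.
have nzX : X0 != 0 by rewrite polyXsubC_eq0.
have evX Q : Q.1 = P.1 -> coord_ev (cfun X0) Q = 0.
  by move=> eQ; rewrite /coord_ev /= !hornerE eQ subrr.
(* What is needed is a nonzero constant multiple of X - x(P) in m_P m_{-P}. *)
suff [c [k [nzc Hk]]] : exists c k, c != 0 /\ cfun c%:P * cfun X0 * (f * a) = cfun (p * X0 ^+ 2) * k.
  exists (cfun c^-1%:P * k); apply: (mul_cfun_inj nzX).
  have -> : cfun X0 * (cfun (p * X0) * (cfun c^-1%:P * k))
      = cfun c^-1%:P * (cfun (p * X0 ^+ 2) * k) by rewrite expr2 !cfunM; ring.
  rewrite -Hk !mulrA -cfunM -polyCM mulVf// mul1r.
  by congr (_ * _ * _); congr pair => /=; ring.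
(* If t(P) != 0: X0 (t + t(P)) - X0 (t - t(P)) = 2 t(P) X0. *)
have [t0|nzt] := eqVneq P.2 0; last first.
  have [|| k1 Hk1] := H (cfun X0) (tfun - cfun P.2%:P).
  - exact: evX.
  - by rewrite /coord_ev /= !hornerE; ring.
  have [|| k2 Hk2] := H (tfun + cfun P.2%:P) (cfun X0).
  - by rewrite /coord_ev /= !hornerE; ring.
  - exact: evX.
  exists (2 * P.2), (k2 - k1); split; first by rewrite mulf_neq0.
  rewrite mulrBr -Hk1 -Hk2 polyCM cfunM.
  have -> : cfun 2%:P = 2 by congr pair; rewrite /= ?addr0// -polyCD.
  by ring.
(* If t(P) = 0: B = B1 X0 and B1 = B2 X0 + B1(x(P)), so that t^2 - B2 X0^2 = B1(x(P)) X0, with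
   B1(x(P)) = B'(x(P)) != 0. *)
have B0 : B.[P.1] = 0 by rewrite -PB t0 expr0n.
have /factor_theorem[B1 DB] : root B P.1 by apply/eqP.
have nzB1 : B1.[P.1] != 0.
  have := ns _ B0; rewrite DB derivM derivXsubC mulr1 !hornerE subrr mulr0 add0r.
  by [].
have /factor_theorem[B2 DB1] : root (B1 - B1.[P.1]%:P) P.1.
  by rewrite /root !hornerE subrr.
have [||k1 Hk1] := H tfun tfun; try by rewrite /coord_ev /= !hornerE t0; ring.
have [||k2 Hk2] := H (cfun X0) (cfun X0); try exact: evX.
exists B1.[P.1], (k1 - cfun B2 * k2); split=> //.
rewrite mulrBr -Hk1 [_ * (_ * k2)]mulrCA -Hk2.
have -> : f * (a * tfun * tfun) = f * a * cfun B by rewrite -tfun2; ring.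
have -> : B1.[P.1]%:P = B1 - B2 * X0 by rewrite -DB1; ring.
by rewrite [in RHS]DB cfunB !cfunM; ring.
Qed.

(** Amounts to m_P m_{-P} being contained in (X - x(P)): on generators, (t + t(P))(t - t(P)) = B -
    B(x(P)) is divisible by X - x(P). *)
Lemma vanish_on_vert P : P.2 ^+ 2 = B.[P.1] ->
  vanish_on (cfun ('X - P.1%:P)) 1 1 [:: P; opp_pt P].
Proof.
move=> PB g1 /coord_ev_opp[u1 ->] g2 /coord_ev_opp[u2 ->] /=.
set X0 := 'X - P.1%:P.
have /factor_theorem[B1 DB] : root (B - (P.2 ^+ 2)%:P) P.1.
  by rewrite /root !hornerE PB subrr.
set q1 := cfun g1.2; set q2 := cfun g2.2.
exists (cfun X0 * u1 * u2 + u1 * q2 * (tfun + cfun (- P.2)%:P)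
  + q1 * u2 * (tfun + cfun P.2%:P) + q1 * q2 * cfun B1).
have DBX : (tfun + cfun P.2%:P) * (tfun + cfun (- P.2)%:P) = cfun B1 * cfun X0.
  rewrite -cfunM -DB cfunB -tfun2 expr2 polyCM cfunM.
  have -> : cfun (- P.2)%:P = - cfun P.2%:P.
    by congr pair; rewrite /= ?oppr0 ?polyCN.
  by ring.
rewrite !cfunM (_ : cfun 1 = 1)//.
transitivity (cfun X0 * (cfun X0 * u1 * (cfun X0 * u2)
  + cfun X0 * u1 * q2 * (tfun + cfun (- P.2)%:P)
  + q1 * u2 * cfun X0 * (tfun + cfun P.2%:P)
  + q1 * q2 * ((tfun + cfun P.2%:P) * (tfun + cfun (- P.2)%:P)))).
  by ring.
by rewrite DBX; ring.
Qed.

(** The ideal of each -P_i is also generated by X - x(P_i) and the conjugate t + l. In a product of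
    three such elements, the term free of t + l carries all three factors X - x(P_i); the others
    acquire them after multiplication by t - l, since (t - l)(t + l) = B - l^2. *)
Lemma vanish_on_line (l : {poly F}) (c : F) P1 P2 P3 :
    l.[P1.1] = P1.2 -> l.[P2.1] = P2.2 -> l.[P3.1] = P3.2 ->
    B - l ^+ 2 = c%:P * ('X - P1.1%:P) * ('X - P2.1%:P) * ('X - P3.1%:P) ->
  vanish_on (tfun - cfun l) 1 1 [:: P1; P2; P3].
Proof.
move=> l1 l2 l3 DN; pose fb := tfun + cfun l.
have Hf : (tfun - cfun l) * fb = cfun (B - l ^+ 2).
  by rewrite cfunB -tfun2 [l ^+ 2]expr2 cfunM /fb; ring.
have gP P g : l.[P.1] = P.2 -> coord_ev g (opp_pt P) = 0 ->
    exists u : coord_ring, g = cfun ('X - P.1%:P) * u + cfun g.2 * fb.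
  move=> lP /coord_ev_opp[u Dg].
  have /factor_theorem[q Dq] : root (l - P.2%:P) P.1.
    by rewrite /root !hornerE lP subrr.
  exists (u - cfun g.2 * cfun q); rewrite {1}Dg /fb.
  have -> : cfun P.2%:P = cfun l - cfun q * cfun ('X - P.1%:P).
    by rewrite -cfunM -Dq -cfunB; congr cfun; ring.
  by ring.
move=> g1 /(gP _ _ l1)[u1 ->] g2 /(gP _ _ l2)[u2 ->] g3 /(gP _ _ l3)[u3 ->] /=.
set q1 := cfun g1.2; set q2 := cfun g2.2; set q3 := cfun g3.2.
set X1 := 'X - P1.1%:P in DN *; set X2 := 'X - P2.1%:P in DN *.
set X3 := 'X - P3.1%:P in DN *.
set f := tfun - cfun l in Hf *.
have Hf' : f * fb = cfun c%:P * cfun X1 * cfun X2 * cfun X3.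
  by rewrite Hf DN !cfunM.
have [k Dk] : exists k, (cfun X1 * u1 + q1 * fb) * (cfun X2 * u2 + q2 * fb)
    * (cfun X3 * u3 + q3 * fb) = cfun X1 * cfun X2 * cfun X3 * (u1 * u2 * u3) + fb * k.
  exists (q1 * (cfun X2 * u2 + q2 * fb) * (cfun X3 * u3 + q3 * fb)
    + cfun X1 * u1 * (q2 * (cfun X3 * u3 + q3 * fb) + cfun X2 * u2 * q3)).
  by ring.
exists (f * (u1 * u2 * u3) + cfun c%:P * k).
rewrite mul1r Dk !cfunM (_ : cfun 1 = 1)// mulrDr [f * (fb * k)]mulrA Hf'.
by ring.
Qed.

End CoordinateRing.

(** * Associativity of the addition of points *)

Section GroupLaw.
Variables (F : fieldType) (E : weierstrass F).
Hypothesis two_neq0 : 2 != 0 :> F.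

Definition two_tors_poly : {poly F} :=
  4%:P * 'X ^+ 3 + (b2 E)%:P * 'X ^+ 2 + (2 * b4 E)%:P * 'X + (b6 E)%:P.

Lemma horner_two_tors x : two_tors_poly.[x] = two_tors E x.
Proof. by rewrite /two_tors_poly /two_tors !hornerE. Qed.

Local Notation B := two_tors_poly.
Local Notation R := (coord_ring_of B).
Implicit Types (P Q S A C : ecpoint F).

Lemma four_neq0 : 4 != 0 :> F.
Proof. by rewrite (_ : 4 = 2 * 2) ?mulf_neq0//; ring. Qed.

Lemma size_two_tors_poly : size B = 4%N.
Proof.
rewrite /two_tors_poly -!addrA size_polyDl size_Cmul ?four_neq0// size_polyXn//.
rewrite ltnS !leq_sizeD//.
- exact: leq_sizeCXn.
- exact: leq_trans (leq_sizeCXn _ 1) _.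
- by rewrite (leq_trans (size_polyC_leq1 _)).
Qed.

Lemma on_curve_opp P : on_curve E (oppP E P) = on_curve E P.
Proof.
case: P => [[x y]|] //; rewrite /oppP -/(oppP E (Some (x, y))).
by rewrite !on_curveE// twoY_opp sqrrN.
Qed.

Lemma oppPK : involutive (oppP E).
Proof. by case=> [[x y]|] //=; congr (Some (_, _)); ring. Qed.

Lemma on_curve_add P Q :
  on_curve E P -> on_curve E Q -> on_curve E (addP E P Q).
Proof.
case: P Q => [[x1 y1]|] [[x2 y2]|] // c1 c2.
have [|npq] := pselect (Some (x1, y1) = oppP E (Some (x2, y2))).
  by case=> -> ->; rewrite /addP !eqxx.
have [x3 [y3 [m [c [-> ol _ _ e3]]]]] := addP_line two_neq0 c1 c2 npq.
rewrite on_curveE// eq_sym -subr_eq0 -sqrrN -e3 (on_lineP _ ol).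
by rewrite subrr mulr0.
Qed.

(** The list is empty at infinity, where no ideal of the coordinate ring is attached and no
    condition is imposed. *)
Definition aff P : seq (F * F) :=
  if P is Some (x, y) then [:: (x, twoY E x y)] else [::].

Definition vert P : {poly F} := \prod_(Q <- aff P) ('X - Q.1%:P).

Lemma aff_inj P Q : aff P = aff Q -> P = Q.
Proof.
by case: P Q => [[x y]|] [[x' y']|] //= [-> /(twoY_inj two_neq0)->].
Qed.

Lemma aff_opp P : aff (oppP E P) = map (@opp_pt _) (aff P).
Proof. by case: P => [[x y]|] //=; rewrite twoY_opp. Qed.

Lemma vert_none : vert None = 1.
Proof. exact: big_nil. Qed.

Lemma vert_opp P : vert (oppP E P) = vert P.
Proof. by case: P => [[x y]|] //=; rewrite /vert /= !big_seq1. Qed.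

Lemma vert_neq0 P : vert P != 0.
Proof.
case: P => [[x y]|]; rewrite /vert /= ?big_nil ?oner_neq0//.
by rewrite big_seq1 polyXsubC_eq0.
Qed.

(** L is the equation of the line through P, Q and -(P + Q). The line is vertical when exactly one
    of these points is at infinity, and L = 1 when all three are. *)
Lemma chord_function P Q : on_curve E P -> on_curve E Q ->
  exists (L : R) c, [/\ c != 0,
    vanish_on L 1 1 (aff P ++ aff Q ++ aff (oppP E (addP E P Q)))
    & coord_norm L = c%:P * (vert P * vert Q * vert (addP E P Q))].
Proof.
have vanO S : on_curve E S -> exists (L : R) c, [/\ c != 0,
    vanish_on L 1 1 (aff S ++ aff (oppP E S))
    & coord_norm L = c%:P * (vert S * vert S)].
  case: S => [[x y]|] cS; last first.
    exists 1, 1; split; rewrite ?oner_neq0//=; first by exists 1; rewrite mul1r.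
    by rewrite /vert /= !big_nil /coord_norm /=; ring.
  exists (cfun B ('X - x%:P)), 1; split; rewrite ?oner_neq0//=.
    rewrite twoY_opp; apply: (vanish_on_vert (P := (x, twoY E x y))) => /=.
    by rewrite horner_two_tors; apply/eqP; rewrite -on_curveE.
  by rewrite /vert /= !big_seq1 coord_norm_cfun expr2; ring.
case: P Q => [[x1 y1]|] [[x2 y2]|] // c1 c2; last 3 first.
- have [L [c [nz v N]]] := vanO _ c1; exists L, c; split=> //.
  by rewrite N vert_none mulr1.
- have [L [c [nz v N]]] := vanO _ c2; exists L, c; split=> //.
  by rewrite N vert_none mul1r.
- have [L [c [nz v N]]] := vanO _ c1; exists L, c; split=> //.
  by rewrite N !vert_none !mulr1.
have [e12|npq] := pselect (Some (x1, y1) = oppP E (Some (x2, y2))).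
  have [L [c [nz v N]]] := vanO _ c1; exists L, c; split=> //.
    have -> : addP E (Some (x1, y1)) (Some (x2, y2)) = None.
      by case: e12 => -> ->; rewrite /addP !eqxx.
    by rewrite e12 oppPK in v; rewrite e12 cats0.
  rewrite N {2}e12 vert_opp.
  have -> : addP E (Some (x1, y1)) (Some (x2, y2)) = None.
    by case: e12 => -> ->; rewrite /addP !eqxx.
  by rewrite vert_none mulr1.
have [x3 [y3 [m [c [-> ol e1 e2 e3]]]]] := addP_line two_neq0 c1 c2 npq.
pose l := m%:P * 'X + c%:P.
have DN : B - l ^+ 2 = 4%:P * ('X - x1%:P) * ('X - x2%:P) * ('X - x3%:P).
  case: ol => [/eqP + /eqP + /eqP]; rewrite !subr_eq => /eqP h2 /eqP h4 /eqP h6.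
  have -> : B = 4%:P * 'X ^+ 3 + (m ^+ 2 - 4 * (x1 + x2 + x3))%:P * 'X ^+ 2
    + (2 * (2 * (x1 * x2 + x1 * x3 + x2 * x3) + m * c))%:P * 'X
    + (c ^+ 2 - 4 * (x1 * x2 * x3))%:P.
    rewrite /two_tors_poly h4 h2 h6.
    by congr (_ + _%:P * _ + _ + _%:P); ring.
  by rewrite /l; ring.
exists (tfun B - cfun B l), (- 4); split.
- by rewrite oppr_eq0 four_neq0.
- apply: (vanish_on_line (c := 4) (P1 := (x1, twoY E x1 y1))
    (P2 := (x2, twoY E x2 y2)) (P3 := (x3, _))) DN; rewrite /= /l !hornerE//.
  by rewrite e3 twoY_opp.
rewrite /coord_norm /= /vert /= !big_seq1.
transitivity (- (B - l ^+ 2)); first by ring.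
by rewrite DN polyCN; ring.
Qed.

(** In the norm k.1^2 - k.2^2 B the two terms have degrees of different parity and cannot cancel;
    the second would have degree at least 3, so k.2 = 0. Then k.1^2 = c [vert P] [vert Q], whose
    even degree excludes that just one of the points is at infinity, and whose square form gives
    x(P) = x(Q) for affine points. Only the vanishing condition tells Q from -Q. *)
Lemma vanish_on_small_norm P Q (k : R) c :
    on_curve E P -> on_curve E Q -> c != 0 ->
    coord_norm k = c%:P * (vert P * vert Q) ->
    vanish_on k 1 1 (aff (oppP E P) ++ aff Q) ->
  P = Q.
Proof.
move=> cP cQ nzc; rewrite /coord_norm => N van.
have k2 : k.2 = 0.
  apply: contraTeq isT => nz2; have := congr1 (fun p : {poly F} => size p) N.
  have szR : (size (c%:P * (vert P * vert Q))%R <= 3)%N.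
    rewrite size_Cmul// (leq_trans (size_polyMleq _ _))//.
    have sv S : (size (vert S) <= 2)%N.
      case: S => [[x y]|]; rewrite /vert /= ?big_nil ?size_polyC ?oner_neq0//.
      by rewrite big_seq1 size_XsubC.
    by move: (sv P) (sv Q); move: (size (vert P)) (size (vert Q)) => a b; lia.
  have sz2 : size (k.2 ^+ 2 * B) = (size k.2).*2.+2.
    rewrite size_mul ?expf_neq0// -?size_poly_gt0 ?size_two_tors_poly// expr2.
    rewrite size_mul//; move: nz2; rewrite -size_poly_gt0.
    by case: (size k.2) => // j _; lia.
  have sk : (0 < size k.2)%N by rewrite size_poly_gt0.
  have [k10|nz1] := eqVneq k.1 0.
    rewrite k10 expr0n sub0r size_polyN sz2 => eS.
    by move: szR; rewrite -eS; move: sk; lia.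
  have sz1 : size (k.1 ^+ 2) = (size k.1).*2.-1.
    by rewrite expr2 size_mul// addnn.
  have sk1 : (0 < size k.1)%N by rewrite size_poly_gt0.
  have [lt|le] := ltnP (size (k.1 ^+ 2)) (size (k.2 ^+ 2 * B)).
    rewrite addrC size_polyDl size_polyN // sz2 => eS.
    by move: szR; rewrite -eS; move: sk; lia.
  rewrite size_polyDl ?size_polyN; last first.
    by rewrite ltn_neqAle le andbT sz1 sz2; move: sk1; lia.
  rewrite sz1 => eS; move: szR; rewrite -eS; move: le sk sk1.
  by rewrite sz1 sz2; lia.
move: N; rewrite k2 expr0n mul0r subr0 => N.
have odd_sz : odd (size (c%:P * (vert P * vert Q))).
  rewrite -N; have [k10|nz1] := eqVneq k.1 0.
    have /eqP := N; rewrite k10 expr0n eq_sym mulf_eq0 polyC_eq0 (negPf nzc).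
    by rewrite mulf_eq0 !(negPf (vert_neq0 _)).
  have : (0 < size k.1)%N by rewrite size_poly_gt0.
  by rewrite expr2 size_mul//; case: (size _) => // j _; rewrite addnS /= addnn odd_double.
move: odd_sz; rewrite size_Cmul//.
case: P Q cP cQ N van => [[x1 y1]|] [[x2 y2]|] // cP cQ N van;
  rewrite /vert /= ?big_seq1 ?big_nil ?mul1r ?mulr1 ?size_XsubC// => _.
move: N; rewrite /vert /= !big_seq1 /= => N.
have r1 x : x == x1 \/ x == x2 -> k.1.[x] = 0.
  move=> h; have := congr1 (horner^~ x) N; rewrite !hornerE /= => e.
  apply/eqP; rewrite -sqrf_eq0 e.
  by case: h => /eqP->; rewrite subrr ?(mulr0, mul0r).
have /factor_theorem[q Dq] : root k.1 x1 by rewrite /root r1// eqxx; left.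
have nzX x : 'X - x%:P != 0 :> {poly F} by rewrite polyXsubC_eq0.
have ex : x1 = x2.
  have e : q ^+ 2 * ('X - x1%:P) = c%:P * ('X - x2%:P).
    apply: (mulfI (nzX x1)).
    transitivity (k.1 ^+ 2); first by rewrite Dq; ring.
    by rewrite N; ring.
  have := congr1 (horner^~ x1) e; rewrite !hornerE subrr mulr0 => /esym/eqP.
  by rewrite mulf_eq0 (negPf nzc) /= subr_eq0 => /eqP.
have q2 : q ^+ 2 = c%:P.
  apply: (mulfI (nzX x1)); apply: (mulfI (nzX x1)).
  transitivity (k.1 ^+ 2); first by rewrite Dq; ring.
  by rewrite N -ex; ring.
have nzq : q != 0.
  by apply: contraTneq isT => q0; move/eqP: q2; rewrite q0 expr0n eq_sym polyC_eq0 (negPf nzc).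
have Dk : k = cfun B q * cfun B ('X - x1%:P).
  by rewrite -cfunM -Dq; case: (k) k2 => /= ? ? ->.
apply: aff_inj; rewrite /= -ex; congr [:: (_, _)].
(* These test elements vanish at P and at -Q. The t-component of their product with q is q (t(Q) -
   t(P)); X - x1 divides it, whereas q(x1) != 0. *)
have [] := van (tfun B - cfun B (twoY E x1 y1)%:P) _ (tfun B + cfun B (twoY E x2 y2)%:P).
- by rewrite /coord_ev /= !hornerE twoY_opp; ring.
- by rewrite /coord_ev /= /twoY !hornerE /=; ring.
move=> j /=; rewrite -ex Dk; set X1 := 'X - x1%:P.
set s := tfun B - _; set s' := tfun B + _ => Hj.
have {Hj} Hj : cfun B q * (s * s') = cfun B X1 * j.
  apply: (mul_cfun_inj (nzX x1)); rewrite -/X1.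
  transitivity (cfun B q * cfun B X1 * (1 * s * s')); first by ring.
  by rewrite Hj !cfunM (_ : cfun B 1 = 1)//; ring.
have := congr1 (fun f : R => f.2.[x1]) Hj.
have -> : (cfun B X1 * j).2.[x1] = 0 by rewrite /= !hornerE subrr; ring.
have -> : (cfun B q * (s * s')).2.[x1] = q.[x1] * (twoY E x1 y2 - twoY E x1 y1).
  by rewrite /= !hornerE /=; ring.
have nzq1 : q.[x1] != 0.
  have := congr1 (horner^~ x1) q2; rewrite !hornerE => e.
  by apply: contraTneq nzc; rewrite -e => ->; rewrite expr0n eqxx.
by move/eqP; rewrite mulf_eq0 (negPf nzq1) subr_eq0 => /eqP.
Qed.

Hypothesis E_nonsing : nonsingular two_tors_poly.

Lemma vanish_on_cancel_aff P (f a : R) p D : on_curve E P ->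
  vanish_on f a p (aff P ++ aff (oppP E P) ++ D) ->
  vanish_on f a (p * vert P) D.
Proof.
case: P => [[x y]|] cP; last by rewrite vert_none mulr1.
rewrite aff_opp /vert /= big_seq1 => /vanish_on_cancel; apply=> //=.
by rewrite horner_two_tors; apply/eqP; rewrite -on_curveE.
Qed.

(** The two chords leading to S = (A + Q) + C, times the conjugates of the two leading to S' = A +
    (Q + C), vanish at A, Q, C, U, W, at their opposites, and at -S and S'. Dividing by the five
    vertical lines leaves a function k to which [vanish_on_small_norm] applies. *)
Lemma addPA A C Q : on_curve E A -> on_curve E Q -> on_curve E C ->
  addP E A (addP E Q C) = addP E (addP E A Q) C.
Proof.
move=> cA cQ cC.
pose U := addP E A Q; pose W := addP E Q C.
have cU : on_curve E U by apply: on_curve_add.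
have cW : on_curve E W by apply: on_curve_add.
pose S := addP E U C; pose S' := addP E A W.
have cS : on_curve E S by apply: on_curve_add.
have cS' : on_curve E S' by apply: on_curve_add.
have [L1 [k1 [nz1 v1 N1]]] := chord_function cA cQ.
have [L2 [k2 [nz2 v2 N2]]] := chord_function cU cC.
have [L3 [k3 [nz3 v3 N3]]] := chord_function cQ cC.
have [L4 [k4 [nz4 v4 N4]]] := chord_function cA cW.
pose Phi : R := L1 * L2 * (coord_conj L3 * coord_conj L4).
have conj1 : coord_conj (1 : R) = 1 by congr pair; rewrite /= ?oppr0.
have v : vanish_on Phi 1 1 ((aff A ++ aff (oppP E A)) ++ (aff Q ++ aff (oppP E Q))
   ++ (aff C ++ aff (oppP E C)) ++ (aff U ++ aff (oppP E U))
   ++ (aff W ++ aff (oppP E W)) ++ (aff (oppP E S) ++ aff S')).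
  have := vanish_on_mul (vanish_on_mul v1 v2)
    (vanish_on_mul (vanish_on_conj v3) (vanish_on_conj v4)).
  rewrite conj1 !mulr1 -/Phi !map_cat -!aff_opp !oppPK -/U -/W -/S -/S'.
  apply: vanish_on_perm; apply/seq.permP => a.
  by rewrite !count_cat; ring.
move: v; rewrite -!catA.
do 5!move/vanish_on_cancel_aff => /(_ ltac:(assumption)).
rewrite mul1r; set Pi := _ * vert W => v.
have nzPi : Pi != 0 by rewrite /Pi !mulf_neq0 ?vert_neq0.
have [k Dk] : exists k : R, Phi = cfun B Pi * k.
  have [k Hk] := @vanish_on_dvd _ B Phi 1 1 Pi _ (oner_neq0 _)
    ltac:(rewrite (_ : cfun B 1 = 1)// !mulr1; exact: v).
  by exists k; rewrite -Hk mulr1.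
have vk : vanish_on k 1 1 (aff (oppP E S) ++ aff S').
  by apply: (vanish_on_div nzPi); rewrite -Dk mulr1.
suff Nk : coord_norm k = (k1 * k2 * (k3 * k4))%:P * (vert S * vert S').
  apply/esym; apply: vanish_on_small_norm Nk vk => //.
  by rewrite !mulf_neq0.
apply: (mulfI (expf_neq0 2 nzPi)).
transitivity (coord_norm Phi).
  by rewrite Dk coord_normM coord_norm_cfun.
rewrite !coord_normM !coord_norm_conj N1 N2 N3 N4 -/U -/W -/S -/S' /Pi !polyCM.
by ring.
Qed.

Lemma addPN P : on_curve E P -> addP E P (oppP E P) = None.
Proof.
case: P => [[x y]|] //= _; rewrite eqxx /= ifT//; apply/eqP; ring.
Qed.

Lemma addPC P Q : on_curve E P -> on_curve E Q -> addP E P Q = addP E Q P.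
Proof.
case: P Q => [[x1 y1]|] [[x2 y2]|] // c1 c2; rewrite /addP.
have -> : (x1 == x2) && (y1 == - y2 - a1 E * x2 - a3 E)
    = (x2 == x1) && (y2 == - y1 - a1 E * x1 - a3 E).
  rewrite eq_sym; have [->|//] := eqVneq x2 x1.
  by apply/eqP/eqP => ->; ring.
case: ifP => // nopp; have [ex|nx] := eqVneq x1 x2.
  suff -> : y1 = y2 by rewrite ex.
  move: c1 c2; rewrite !on_curveE// ex => /eqP <-; rewrite eqf_sqr.
  case/orP => [/eqP/(twoY_inj two_neq0)//|]; rewrite -twoY_opp.
  move=> /eqP/(twoY_inj two_neq0) ey.
  by move: nopp; rewrite ey ex !eqxx.
have -> : (y1 - y2) / (x1 - x2) = (y2 - y1) / (x2 - x1).
  by rewrite -(opprB y2) -(opprB x2) invrN mulrNN.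
set l := _ / _; have hl : y2 - y1 = l * (x2 - x1).
  by rewrite /l divfK// subr_eq0 eq_sym.
have -> : y2 = y1 + l * (x2 - x1) by rewrite -hl; ring.
by congr (Some (_, _)); ring.
Qed.

End GroupLaw.

Lemma deriv_two_tors (F : fieldType) (E : weierstrass F) x :
  (two_tors_poly E)^`().[x] = 12 * x ^+ 2 + 2 * b2 E * x + 2 * b4 E.
Proof.
by rewrite /two_tors_poly !derivE !hornerE /=; ring.
Qed.

Lemma four_b8 (F : fieldType) (E : weierstrass F) :
  4 * b8 E = b2 E * b6 E - b4 E ^+ 2.
Proof. by rewrite /b8 /b2 /b4 /b6; ring. Qed.

(** A common root x of B and B' expresses b4 and b6 through x and b2. The discriminant is multiplied
    by 4 so that b8 can be eliminated as well; it then vanishes identically. *)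
Lemma discriminant_nonsingular (F : fieldType) (E : weierstrass F) :
  2 != 0 :> F -> discriminant E != 0 -> nonsingular (two_tors_poly E).
Proof.
move=> nz2 nzD x; rewrite horner_two_tors /two_tors deriv_two_tors => B0.
apply: contraNneq nzD => B1; rewrite -(inj_eq (mulfI (four_neq0 nz2))).
have h4 : b4 E = - (6 * x ^+ 2 + b2 E * x).
  apply: (mulfI nz2); apply/eqP; rewrite -subr_eq0 -B1; apply/eqP; ring.
have h6 : b6 E = 8 * x ^+ 3 + b2 E * x ^+ 2.
  by apply/eqP; rewrite -subr_eq0 -B0 h4; apply/eqP; ring.
have -> : 4 * discriminant E = - b2 E ^+ 2 * (4 * b8 E) - 32 * b4 E ^+ 3
    - 108 * b6 E ^+ 2 + 36 * b2 E * b4 E * b6 E by rewrite /discriminant; ring.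
by rewrite four_b8 h4 h6 mulr0; apply/eqP; ring.
Qed.

(** * Division polynomials *)

Section AdditionFormulas.
Variables (F : fieldType) (E : weierstrass F).
Hypothesis two_neq0 : 2 != 0 :> F.

Definition sum_form (s p : F) : F :=
  2 * s * p * (s + p) + b2 E * s * p + b4 E * (s + p) + b6 E.
Definition prod_form (s p : F) : F :=
  s ^+ 2 * p ^+ 2 - b4 E * s * p - b6 E * (s + p) - b8 E.

(* When s = x(P), p = x(Q), the roots in T are x(P + Q) and x(P - Q). Its
   symmetry in s, p, T is the source of all the division polynomial identities. *)
Definition add_form (s p T : F) : F :=
  T ^+ 2 * (s - p) ^+ 2 - T * sum_form s p + prod_form s p.

Lemma add_formC13 s p T : add_form s p T = add_form T p s.
Proof. by rewrite /add_form /sum_form /prod_form; ring. Qed.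

(** The two chords have slopes (t2 - t1)/D and (t2 + t1)/D with D = x2 - x1, so the sum and the
    product of the third abscissas involve t1 and t2 only through their squares, that is through
    B(x1) and B(x2). *)
Lemma add_sub_forms x1 y1 x2 y2 xp yp xm ym :
    on_curve E (Some (x1, y1)) -> on_curve E (Some (x2, y2)) -> x1 != x2 ->
    addP E (Some (x1, y1)) (Some (x2, y2)) = Some (xp, yp) ->
    addP E (oppP E (Some (x1, y1))) (Some (x2, y2)) = Some (xm, ym) ->
  (xp + xm) * (x2 - x1) ^+ 2 = sum_form x2 x1
  /\ xp * xm * (x2 - x1) ^+ 2 = prod_form x2 x1.
Proof.
move=> c1 c2 nx ep em.
have nzD : x2 - x1 != 0 by rewrite subr_eq0 eq_sym.
have c1' : on_curve E (oppP E (Some (x1, y1))) by rewrite on_curve_opp.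
have nxo y y' : Some (x1, y) <> oppP E (Some (x2, y')).
  by case=> e _; rewrite e eqxx in nx.
have [x3 [y3 [m [c [ep' [s1 _ _] l1 l2 _]]]]] :=
  addP_line two_neq0 c1 c2 (@nxo _ _).
move: ep'; rewrite ep => -[? _]; subst x3.
have [x3 [y3' [m' [c' [em' [s2 _ _] l1' l2' _]]]]] :=
  addP_line two_neq0 c1' c2 (@nxo _ _).
case: (etrans (esym em') em) => ? _; subst x3.
move: c1 c2 l1 l2 l1' l2'; rewrite !on_curveE// twoY_opp.
set t1 := twoY E x1 y1; set t2 := twoY E x2 y2 => /eqP c1 /eqP c2 l1 l2 l1' l2'.
set D := x2 - x1 in nzD *.
have em1 : m * D = t2 - t1 by rewrite -l1 -l2 /D; ring.
have em2 : m' * D = t2 + t1 by rewrite -[t1]opprK -l1' -l2' /D; ring.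
have nz4 := four_neq0 two_neq0.
have hp : 4 * xp * D ^+ 2 = (t2 - t1) ^+ 2 - (b2 E + 4 * (x1 + x2)) * D ^+ 2.
  rewrite -em1 (_ : 4 * xp = m ^+ 2 - b2 E - 4 * (x1 + x2)); first by ring.
  by rewrite s1; ring.
have hm : 4 * xm * D ^+ 2 = (t2 + t1) ^+ 2 - (b2 E + 4 * (x1 + x2)) * D ^+ 2.
  rewrite -em2 (_ : 4 * xm = m' ^+ 2 - b2 E - 4 * (x1 + x2)); first by ring.
  by rewrite s2; ring.
split.
  apply: (mulfI nz4).
  transitivity (4 * xp * D ^+ 2 + 4 * xm * D ^+ 2); first by ring.
  rewrite hp hm; transitivity (2 * (t1 ^+ 2 + t2 ^+ 2)
    - 2 * (b2 E + 4 * (x1 + x2)) * D ^+ 2); first by ring.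
  by rewrite c1 c2 /two_tors /sum_form /D; ring.
apply: (mulfI nz4); apply: (mulfI nz4); apply: (mulfI (expf_neq0 2 nzD)).
transitivity ((4 * xp * D ^+ 2) * (4 * xm * D ^+ 2)); first by ring.
rewrite hp hm; set k := (_ + _) * D ^+ 2.
transitivity ((t1 ^+ 2 + t2 ^+ 2 - k) ^+ 2 - 4 * t1 ^+ 2 * t2 ^+ 2); first by ring.
rewrite c1 c2.
transitivity (4 * D ^+ 2 * (4 * (x2 ^+ 2 * x1 ^+ 2 - b4 E * x2 * x1
  - b6 E * (x2 + x1)) - 4 * b8 E)); last by rewrite /prod_form; ring.
by rewrite four_b8 /k /two_tors /D; ring.
Qed.

Lemma dup_form x y x2 y2 : on_curve E (Some (x, y)) -> twoY E x y != 0 ->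
    addP E (Some (x, y)) (Some (x, y)) = Some (x2, y2) ->
  twoY E x y ^+ 2 * x2 = prod_form x x.
Proof.
move=> c1 nzt e.
have nopp : Some (x, y) <> oppP E (Some (x, y)).
  case=> ey; move: nzt; rewrite -(inj_eq (mulfI two_neq0)) mulr0.
  by rewrite mulr_natl mulr2n {2}ey twoY_opp subrr eqxx.
have [x3 [y3 [m [c [e' [s1 s2 _] l1 _ _]]]]] := addP_line two_neq0 c1 c1 nopp.
move: e'; rewrite e => -[? _]; subst x3.
move: c1 l1; rewrite on_curveE//; set t := twoY E x y => /eqP ct l1.
have hm : m * t = 6 * x ^+ 2 + b2 E * x + b4 E.
  have -> : b4 E = 2 * (x * x + x * x2 + x * x2) + m * c by rewrite -s2; ring.
  by rewrite -l1 (_ : b2 E = m ^+ 2 - 4 * (x + x + x2)); [ring | rewrite -s1; ring].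
have nz4 := four_neq0 two_neq0.
apply: (mulfI nz4).
transitivity ((m * t) ^+ 2 - t ^+ 2 * (b2 E + 8 * x)).
  rewrite (_ : b2 E = m ^+ 2 - 4 * (x + x + x2)); [ring | rewrite -s1; ring].
rewrite hm ct /two_tors.
transitivity (4 * (x ^+ 2 * x ^+ 2 - b4 E * x * x - b6 E * (x + x)) - 4 * b8 E).
  by rewrite four_b8; ring.
by rewrite /prod_form; ring.
Qed.

Definition psi3_at (x : F) : F :=
  3 * x ^+ 4 + b2 E * x ^+ 3 + 3 * b4 E * x ^+ 2 + 3 * b6 E * x + b8 E.
Definition psi4_at (x : F) : F :=
  2 * x ^+ 6 + b2 E * x ^+ 5 + 5 * b4 E * x ^+ 4 + 10 * b6 E * x ^+ 3
  + 10 * b8 E * x ^+ 2 + (b2 E * b8 E - b4 E * b6 E) * x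
  + (b4 E * b8 E - b6 E ^+ 2).

Definition division_seq (x t : F) (e : nat -> F) : Prop :=
  [/\ e 0 = 0, e 1 = 1, e 2 = t, e 3 = psi3_at x & e 4 = t * psi4_at x] /\
  (forall m, (1 < m)%N ->
     e m.*2.+1 = e m.+2 * e m ^+ 3 - e m.-1 * e m.+1 ^+ 3) /\
  (forall m, (2 < m)%N ->
     e m.*2 * t = e m * (e m.+2 * e m.-1 ^+ 2 - e m.-2 * e m.+1 ^+ 2)).

Section Sequence.
Variables (x t : F) (e X : nat -> F).
Hypothesis e_div : division_seq x t e.
Hypothesis X1 : X 1 = x.
Hypothesis X2 : t ^+ 2 * X 2 = prod_form x x.
Hypothesis tE : t ^+ 2 = two_tors E x.

(** For s = p the term in T^2 disappears, since P - Q is then at infinity; the root left is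
    x(2P). *)
Lemma add_form_dup T : add_form x x T = - t ^+ 2 * (T - X 2).
Proof.
transitivity (t ^+ 2 * X 2 - t ^+ 2 * T); last by ring.
by rewrite X2 tE /add_form /sum_form /prod_form /two_tors; ring.
Qed.

(** Let h be the value that e (n + 2) must have for the relation to hold at (n + 1, 1). Two
    neighbouring pairs (a + 1, b) and (a, b + 1) on the line a + b = n + 2 occur in values of
    [add_form] that agree by its symmetry, so the relation with h travels along this line. Where it
    arrives at a - b = 1 or 2, comparison with the recurrence shows h = e (n + 2). *)
Lemma division_seq_step n : (2 < n)%N ->
    (forall k, (0 < k <= n.+1)%N -> e k != 0) ->
    (forall k, (1 < k <= n)%N -> forall T,
      (X k.+1 - T) * (X k.-1 - T) * (X k - x) ^+ 2 = add_form (X k) x T) ->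
    (forall a b, (0 < b < a)%N -> (a + b <= n.+1)%N ->
      (X a - X b) * (e a * e b) ^+ 2 = - (e (a + b)%N * e (a - b)%N)) ->
  forall a b, (0 < b < a)%N -> (a + b = n.+2)%N ->
    (X a - X b) * (e a * e b) ^+ 2 = - (e (a + b)%N * e (a - b)%N).
Proof.
move=> n_gt2 nz HX IH; have [[e0 e1 e2 e3 e4] [eodd eeven]] := e_div.
pose h := - (X n.+1 - x) * e n.+1 ^+ 2 / e n.
have IH1 a : (1 < a <= n)%N -> X a - x = - (e a.+1 * e a.-1) / e a ^+ 2.
  move=> /andP[a1 an]; have := IH a 1 a1; rewrite addn1 subn1 X1 e1 mulr1 ltnS.
  move=> /(_ an) <-; rewrite mulfK// expf_neq0// nz//; nlia.
have IHab a b : (0 < b < a)%N -> (a + b <= n.+1)%N ->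
    X a - X b = - (e (a + b)%N * e (a - b)%N) / (e a * e b) ^+ 2.
  move=> ba abn; rewrite -IH// mulfK// expf_neq0// mulf_neq0// nz//; nlia.
have key b : forall a, (b.+1 < a)%N -> (a + b.+1 = n.+2)%N ->
    X a - X b.+1 = - (h * e (a - b.+1)%N) / (e a * e b.+1) ^+ 2.
  elim: b => [|b IHb] a ba abn.
    have -> : a = n.+1 by nlia.
    rewrite X1 e1 subn1 /h /=; field.
    by rewrite !nz//; nlia.
  have := IHb a.+1 ltac:(nlia) ltac:(nlia).
  rewrite (_ : a.+1 - b.+1 = (a - b.+1).+1)%N; last by nlia.
  set D1 := X _ - _ => hD1.
  have [a' Da] : exists a', a = a'.+2 by exists a.-2; nlia.
  have hD2 := IHab a'.+1 b.+1 ltac:(nlia) ltac:(nlia).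
  have hD3 := IH1 a ltac:(nlia).
  have nza : e a != 0 by apply: nz; nlia.
  have nza1 : e a.+1 != 0 by apply: nz; nlia.
  have nza2 : e a'.+1 != 0 by apply: nz; nlia.
  have nzb : e b.+1 != 0 by apply: nz; nlia.
  have nzb2 : e b.+2 != 0 by apply: nz; nlia.
  have nzab : e (a'.+1 + b.+1)%N != 0 by apply: nz; nlia.
  have nzab' : e (a - b.+1).+1 != 0 by apply: nz; nlia.
  have Hk := HX a ltac:(nlia) (X b.+1).
  rewrite -/D1 (_ : a.-1 = a'.+1) in Hk; last by nlia.
  have ei : (a'.+1 - b.+1 = a - b.+2)%N by nlia.
  rewrite ei in hD2.
  (* The first move leads to X 2, which comes from duplication: [HX] starts at index 2. *)
  case: b IHb ba abn @D1 hD1 hD2 nzb nzb2 nzab nzab' Hk ei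
    => [|b] IHb ba abn D1 hD1 hD2 nzb nzb2 nzab nzab' Hk ei.
    rewrite X1 add_formC13 add_form_dup in Hk.
    have hD1' : D1 = - (h * e a) / e a.+1 ^+ 2.
      rewrite hD1 e1 mulr1; congr (- (_ * e _) / _); nlia.
    have hD2' : X a'.+1 - x = - (e a * e (a - 2)%N) / e a'.+1 ^+ 2.
      rewrite -X1 hD2 e1 mulr1; congr (- (e _ * _) / _); nlia.
    have nzt : t != 0 by rewrite -e2 nz//; nlia.
    have -> : X a - X 2 = - D1 * (X a'.+1 - x) * (X a - x) ^+ 2 / t ^+ 2.
      rewrite -(mulrA (- D1)) !mulNr mulrA Hk; field.
      by [].
    rewrite hD1' hD2' hD3 e2 (_ : a.-1 = a'.+1); last by nlia.
    by field; rewrite nza nza1 nza2 nzt.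
  have hD4 := IH1 b.+2 ltac:(nlia).
  have hD5 := IHab a b.+1 ltac:(nlia) ltac:(nlia).
  have Hk' := HX b.+2 ltac:(nlia) (X a).
  rewrite -add_formC13 -Hk /= in Hk'.
  have nzb1 : e b.+1 != 0 by apply: nz; nlia.
  rewrite /= in hD4.
  have ei2 : (a - b.+1 = (a - b.+2).+1)%N by nlia.
  have ei3 : (a'.+1 + b.+2 = a + b.+1)%N by nlia.
  rewrite ei2 in hD5; rewrite ei3 in hD2 nzab; rewrite (_ : a.-1 = a'.+1) in hD3; last by nlia.
  have nzD4 : X b.+2 - x != 0.
    by rewrite hD4 mulf_neq0 ?invr_eq0 ?expf_neq0 ?oppr_eq0// mulf_neq0.
  have nzD5 : X a - X b.+1 != 0.
    by rewrite hD5 mulf_neq0 ?invr_eq0 ?expf_neq0 ?oppr_eq0 ?mulf_neq0.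
  have -> : X a - X b.+3 = D1 * (X a'.+1 - X b.+2) * (X a - x) ^+ 2
      / ((X a - X b.+1) * (X b.+2 - x) ^+ 2).
    rewrite -Hk'; field.
    by rewrite nzD4 nzD5.
  rewrite hD1 hD2 hD3 hD4 hD5.
  field.
  by rewrite !oppr_eq0 !mulf_eq0 ?(negPf nza, negPf nza1, negPf nza2, negPf nzb, negPf nzb1, negPf nzb2, negPf nzab, negPf nzab').
(* The innermost pair is (m + 1, m) for n + 2 = 2 m + 1 and (m + 1, m - 1) for n + 2 = 2 m. *)
have hE : h = e n.+2.
  have [m Dm] : exists m, n.+2 = m.*2.+1 \/ n.+2 = m.*2.
    exists n.+2./2; have := odd_double_half n.+2.
    by case: (odd n.+2) => Dn; [left|right]; rewrite -[LHS]Dn.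
  case: Dm => Dm.
    have m_gt1 : (1 < m)%N by nlia.
    have := key m.-1 m.+1 ltac:(nlia) ltac:(nlia).
    rewrite prednK ?(ltnW m_gt1)// subSnn e1 mulr1 Dm eodd//.
    have := IH1 m ltac:(nlia); have := IH1 m.+1 ltac:(nlia) => /=.
    move=> h1 h2 h3.
    have {h3} h3 : - h = (X m.+1 - x - (X m - x)) * (e m.+1 * e m) ^+ 2.
      rewrite (_ : _ - _ = X m.+1 - X m); last by ring.
      by rewrite h3 mulfVK// expf_neq0// mulf_neq0// nz//; nlia.
    apply: oppr_inj; rewrite h3 h1 h2; field.
    by rewrite !nz//; nlia.
  have m_gt2 : (2 < m)%N by nlia.
  have := key m.-2 m.+1 ltac:(nlia) ltac:(nlia).
  rewrite (_ : m.-2.+1 = m.-1); last by nlia.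
  rewrite (_ : m.+1 - m.-1 = 2)%N; last by nlia.
  have nzt : t != 0 by rewrite -e2 nz//; nlia.
  have := IH1 m.-1 ltac:(nlia); have := IH1 m.+1 ltac:(nlia) => /=.
  rewrite (_ : m.-1.+1 = m); last by nlia.
  move=> h1 h2 h3; rewrite e2 in h3.
  have {h3} h3 : - (h * t) = (X m.+1 - x - (X m.-1 - x)) * (e m.+1 * e m.-1) ^+ 2.
    rewrite (_ : _ - _ = X m.+1 - X m.-1); last by ring.
    by rewrite h3 mulfVK// expf_neq0// mulf_neq0// nz//; nlia.
  apply: (mulIf nzt); apply: oppr_inj; rewrite h3 h1 h2 Dm eeven//; field.
  by rewrite !nz//; nlia.
move=> a [//|b] /andP[_ ba] abn; rewrite key// hE abn mulfVK//.
by rewrite expf_neq0// mulf_neq0// nz//; nlia.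
Qed.

End Sequence.
End AdditionFormulas.

Section Multiples.
Variables (F : fieldType) (E : weierstrass F).
Hypothesis two_neq0 : 2 != 0 :> F.
Hypothesis E_nonsing : nonsingular (two_tors_poly E).

Lemma addPKl P Q : on_curve E P -> on_curve E Q ->
  addP E (oppP E P) (addP E P Q) = Q.
Proof.
move=> cP cQ; have cN : on_curve E (oppP E P) by rewrite on_curve_opp.
by rewrite addPA// -{2}[P](oppPK E) addPN.
Qed.

Lemma on_curve_mulP n P : on_curve E P -> on_curve E (mulP E n P).
Proof.
by move=> cP; rewrite /mulP; elim: n => //= n IH; apply: on_curve_add.
Qed.

Lemma mulPS n P : mulP E n.+1 P = addP E P (mulP E n P).
Proof. by []. Qed.

Definition mulX n P : F := if mulP E n P is Some (x, _) then x else 0.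

Lemma addP_neqX x1 y1 x2 y2 : x1 != x2 ->
  addP E (Some (x1, y1)) (Some (x2, y2)) <> None.
Proof. by move=> nx; rewrite /addP (negPf nx). Qed.

Lemma addP_eq_None P Q : on_curve E P -> on_curve E Q ->
  addP E P Q = None -> Q = oppP E P.
Proof.
move=> cP cQ PQ; rewrite -[Q](addPKl cP cQ) PQ.
by case: (oppP E P) => [[]|].
Qed.

Lemma oppP_eq_twoY x y :
  (oppP E (Some (x, y)) == Some (x, y)) = (twoY E x y == 0).
Proof.
apply/eqP/eqP => [[ey]|t0].
  have := twoY_opp E x y; rewrite ey => /eqP.
  by rewrite -addr_eq0 -mulr2n -mulr_natl mulf_eq0 (negPf two_neq0) => /eqP.
congr (Some (x, _)); apply: (twoY_inj two_neq0 (E := E) (x := x)).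
by rewrite twoY_opp t0 oppr0.
Qed.

Section Point.
Variables (x y : F) (e : nat -> F).
Local Notation P := (Some (x, y)).
Local Notation t := (twoY E x y).
Local Notation X := (mulX^~ P).
Hypothesis cP : on_curve E P.
Hypothesis e_div : division_seq E x t e.

Lemma mulP_addsub k : (1 < k)%N -> mulP E k P <> None ->
    mulP E k.-1 P <> None -> X k != x -> forall T,
  (X k.+1 - T) * (X k.-1 - T) * (X k - x) ^+ 2 = add_form E (X k) x T.
Proof.
case: k => [|[|k]]// _ nk nk1 nx T; rewrite -[k.+2.-1]/(k.+1) in nk1 *.
have cK := on_curve_mulP k.+2 cP; have cK1 := on_curve_mulP k.+1 cP.
have nx' : mulP E k.+3 P <> None.
  move: nx; rewrite mulPS /mulX; case: (mulP E k.+2 P) nk => [[a b]|]// _ nx.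
  by apply: addP_neqX; rewrite eq_sym.
have eS := mulPS k.+2 P; have eB := addPKl cP cK1; rewrite -mulPS in eB.
rewrite /mulX in nx *; move: nk nk1 nx' nx cK eS eB.
case: (mulP E k.+2 P) => [[x2 y2]|]// _.
case: (mulP E k.+1 P) => [[xm ym]|]// _.
case: (mulP E k.+3 P) => [[xp yp]|]// _ nx cK /esym eS eB.
have nx2 : x != x2 by rewrite eq_sym.
have [hs hp] := add_sub_forms two_neq0 cP cK nx2 eS eB.
by rewrite /add_form -hs -hp; ring.
Qed.

Lemma mulX_dup : t != 0 -> t ^+ 2 * X 2 = prod_form E x x.
Proof.
move=> nzt; rewrite /mulX /= -/(addP E P P).
case D: (addP E P P) => [[x2 y2]|]; first exact: (dup_form two_neq0 cP nzt D).
by have /esym/eqP := addP_eq_None cP cP D; rewrite oppP_eq_twoY (negPf nzt).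
Qed.

(** The net relation at (3, 1), checked by hand because the recurrences start only at psi_5. *)
Lemma mulX_triple : t != 0 -> X 2 != x -> mulP E 2 P <> None ->
  (X 3 - x) * psi3_at E x ^+ 2 = - (t ^+ 2 * psi4_at E x).
Proof.
move=> nzt nx n2; have h2 := mulX_dup nzt.
have ct : t ^+ 2 = two_tors E x by apply/eqP; rewrite -on_curveE.
have := mulP_addsub (k := 2) isT n2.
have X1 : X 1 = x by [].
move=> /(_ ltac:(by []) nx) /=; rewrite X1 => hT.
(* The coefficient of T is recovered from the values at T = 0 and T = 1. *)
have hs : (X 3 + x) * (X 2 - x) ^+ 2 = sum_form E (X 2) x.
  have := hT 1; have := hT 0; rewrite /add_form => h0 h1.
  transitivity ((X 3 - 0) * (x - 0) * (X 2 - x) ^+ 2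
    - (X 3 - 1) * (x - 1) * (X 2 - x) ^+ 2 + (X 2 - x) ^+ 2); first by ring.
  by rewrite h0 h1; ring.
have h23 : t ^+ 2 * (X 2 - x) = - psi3_at E x.
  by rewrite mulrBr h2 ct /prod_form /two_tors /psi3_at; ring.
have hs' : (X 3 + x) * psi3_at E x ^+ 2 = 2 * prod_form E x x * x *
     (prod_form E x x + t ^+ 2 * x) + b2 E * t ^+ 2 * prod_form E x x * x
   + b4 E * t ^+ 2 * (prod_form E x x + t ^+ 2 * x) + b6 E * t ^+ 4.
  rewrite -sqrrN -h23 -h2.
  transitivity (t ^+ 4 * ((X 3 + x) * (X 2 - x) ^+ 2)); first by ring.
  by rewrite hs /sum_form; ring.
transitivity ((X 3 + x) * psi3_at E x ^+ 2 - 2 * x * psi3_at E x ^+ 2).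
  by ring.
rewrite hs' (_ : t ^+ 4 = t ^+ 2 * t ^+ 2); last by ring.
rewrite ct /prod_form /two_tors /psi3_at /psi4_at.
have -> : b8 E = (b2 E * b6 E - b4 E ^+ 2) / 4.
  by rewrite -four_b8 mulrC mulKf ?four_neq0.
by field; rewrite four_neq0.
Qed.

(** The two claims feed each other: the relation at (k, 1) gives x([k]P) != x(P) as long as
    psi_{k+1} psi_{k-1} != 0, so [k + 1]P is affine, and affine multiples allow the next level of
    the relation. That level goes up to a + b = n + 1, where e (n + 1) is allowed to vanish; this is
    what later detects the order of P. *)
Lemma mulP_division n : (0 < n)%N ->
    (forall k, (0 < k <= n)%N -> e k != 0) ->
  (forall k, (0 < k <= n)%N -> mulP E k P <> None) /\
  (forall a b, (0 < b < a)%N -> (a + b <= n.+1)%N ->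
     (X a - X b) * (e a * e b) ^+ 2 = - (e (a + b)%N * e (a - b)%N)).
Proof.
have [[e0 e1 e2 e3 e4] _] := e_div; have X1 : X 1 = x by [].
elim: n => // -[_ _ _|n IH _ nz].
  by split=> [[|[|k]]//|a b ba ab]; exfalso; lia.
have nzt : t != 0 by rewrite -e2; apply: nz.
have ct : t ^+ 2 = two_tors E x by apply/eqP; rewrite -on_curveE.
have {IH} [|fin eq] := IH isT.
  by move=> k kn; apply: nz; lia.
have finn : forall k, (0 < k <= n.+2)%N -> mulP E k P <> None.
  move=> k kn; have [kn'|kn'] := leqP k n.+1; first by apply: fin; lia.
  have -> : k = n.+2 by lia.
  case: n nz eq fin {k kn kn'} => [|n] nz eq fin.
    move=> /(addP_eq_None cP cP)/esym/eqP.
    by rewrite oppP_eq_twoY (negPf nzt).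
  rewrite mulPS; have := fin n.+2 ltac:(lia).
  have := eq n.+2 1 ltac:(lia) ltac:(lia).
  rewrite X1 e1 mulr1 addn1 subn1 /mulX.
  case: (mulP E n.+2 P) => [[x2 y2]|]// h _.
  apply: addP_neqX; apply: contraTneq isT => ex; move/eqP: h.
  by rewrite ex subrr mul0r eq_sym oppr_eq0 mulf_eq0 !(negPf (nz _ _))//; lia.
split=> // a b ba abn; have [abn'|abn'] := leqP (a + b) n.+2; first exact: eq.
have {abn abn'} abn : (a + b = n.+3)%N by lia.
have X2t := mulX_dup nzt.
case: n nz eq fin finn abn => [|n] nz eq fin finn abn.
  have [-> ->] : a = 2 /\ b = 1 by lia.
  rewrite X1 !e1 !mulr1 e2 e3.
  by rewrite mulrC mulrBr X2t ct /prod_form /two_tors /psi3_at; ring.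
have X2x : X 2 != x.
  have := eq 2 1 isT ltac:(lia); rewrite X1 !e1 !mulr1.
  by move=> h; apply: contraTneq isT => ex; move/eqP: h;
    rewrite ex subrr mul0r eq_sym oppr_eq0 (negPf (nz _ _)).
case: n nz eq fin finn abn => [|n] nz eq fin finn abn.
  have [-> ->] : a = 3 /\ b = 1 by lia.
  have h := mulX_triple nzt X2x (finn 2 isT).
  by rewrite X1 e1 mulr1 e3 h e4 e2; ring.
apply: (division_seq_step e_div X1 X2t ct _ nz _ eq ba abn) => //.
move=> k kn; apply: mulP_addsub.
- by lia.
- by apply: finn; lia.
- by apply: finn; lia.
have := eq k 1 ltac:(lia) ltac:(lia); rewrite X1 e1 mulr1 addn1 subn1 => h.
apply: contraTneq isT => ex; move/eqP: h.
rewrite ex subrr mul0r eq_sym oppr_eq0 mulf_eq0.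
by rewrite (negPf (nz _ _)) ?(negPf (nz _ _))//; lia.
Qed.

End Point.
End Multiples.

Section DivisionPolynomials.
Variables (F : fieldType) (E : weierstrass F).
Local Notation B := (two_tors_poly E).

Definition psi3_poly : {poly F} :=
  3%:P * 'X ^+ 4 + (b2 E)%:P * 'X ^+ 3 + (3 * b4 E)%:P * 'X ^+ 2
  + (3 * b6 E)%:P * 'X + (b8 E)%:P.
Definition psi4_poly : {poly F} :=
  2%:P * 'X ^+ 6 + (b2 E)%:P * 'X ^+ 5 + (5 * b4 E)%:P * 'X ^+ 4
  + (10 * b6 E)%:P * 'X ^+ 3 + (10 * b8 E)%:P * 'X ^+ 2
  + (b2 E * b8 E - b4 E * b6 E)%:P * 'X + (b4 E * b8 E - b6 E ^+ 2)%:P.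

Lemma horner_psi3 x : psi3_poly.[x] = psi3_at E x.
Proof. by rewrite /psi3_poly /psi3_at !hornerE. Qed.
Lemma horner_psi4 x : psi4_poly.[x] = psi4_at E x.
Proof. by rewrite /psi4_poly /psi4_at !hornerE. Qed.

(** In psi_{2m+1} one of the two products has four factors of even index, which give t^4 = B^2;
    hence the exponents. In psi_{2m} both products contain t^2, and the division by psi_2 leaves the
    single t that is split off. *)
Fixpoint dpoly_rec (fuel n : nat) : {poly F} :=
  if fuel is k.+1 then
    match n with
    | 0 => 0
    | 1 | 2 => 1
    | 3 => psi3_poly
    | 4 => psi4_poly
    | _ =>
      let m := n./2 in let d := dpoly_rec k in
      if odd n then
        B ^+ (~~ odd m).*2 * (d m.+2 * d m ^+ 3)
        - B ^+ (odd m).*2 * (d m.-1 * d m.+1 ^+ 3)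
      else d m * (d m.+2 * d m.-1 ^+ 2 - d m.-2 * d m.+1 ^+ 2)
    end
  else 0.

(* The n-th division polynomial is dpoly n for n odd and
   (2y + a1 x + a3) * dpoly n for n even. *)
Definition dpoly n := dpoly_rec n n.

Lemma half_lt n m : (4 < n)%N -> (m <= n./2.+2)%N -> (m < n)%N.
Proof. by move=> n4; have := odd_double_half n; case: (odd n) => /=; lia. Qed.

Lemma dpoly_recS k n : (4 < n)%N -> dpoly_rec k.+1 n =
  let m := n./2 in let d := dpoly_rec k in
  if odd n then
    B ^+ (~~ odd m).*2 * (d m.+2 * d m ^+ 3)
    - B ^+ (odd m).*2 * (d m.-1 * d m.+1 ^+ 3)
  else d m * (d m.+2 * d m.-1 ^+ 2 - d m.-2 * d m.+1 ^+ 2).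
Proof. by case: n => [|[|[|[|[|n]]]]]. Qed.

Lemma dpoly_recE k n : (n <= k)%N -> dpoly_rec k n = dpoly n.
Proof.
rewrite /dpoly; suff H k' : (n <= k)%N -> (n <= k')%N ->
    dpoly_rec k n = dpoly_rec k' n by move=> nk; apply: H.
elim: k n k' => [|k IH] n k'; first by rewrite leqn0 => /eqP->; case: k'.
case: k' => [|k']; first by rewrite leqn0 => _ /eqP->.
have [n4 nk nk'|] := ltnP 4 n; last by case: n => [|[|[|[|[|n]]]]].
have H m : (m <= n./2.+2)%N -> dpoly_rec k m = dpoly_rec k' m.
  by move=> /(half_lt n4) mn; apply: IH; rewrite -ltnS (leq_trans mn).
by rewrite !dpoly_recS//= !H//; clear; lia.
Qed.

Lemma dpolyE n : (4 < n)%N -> dpoly n =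
  let m := n./2 in
  if odd n then
    B ^+ (~~ odd m).*2 * (dpoly m.+2 * dpoly m ^+ 3)
    - B ^+ (odd m).*2 * (dpoly m.-1 * dpoly m.+1 ^+ 3)
  else dpoly m * (dpoly m.+2 * dpoly m.-1 ^+ 2 - dpoly m.-2 * dpoly m.+1 ^+ 2).
Proof.
case: n => // n n4; rewrite {1}/dpoly dpoly_recS//; cbv zeta.
have H m : (m <= n.+1./2.+2)%N -> dpoly_rec n m = dpoly m.
  by move=> /(half_lt n4) mn; apply: dpoly_recE.
by rewrite !H//; clear; lia.
Qed.

Lemma dpoly_odd m : (1 < m)%N -> dpoly m.*2.+1 =
  B ^+ (~~ odd m).*2 * (dpoly m.+2 * dpoly m ^+ 3)
  - B ^+ (odd m).*2 * (dpoly m.-1 * dpoly m.+1 ^+ 3).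
Proof.
move=> m1; have m4 : (4 < m.*2.+1)%N by lia.
by rewrite dpolyE//= uphalf_double odd_double.
Qed.

Lemma dpoly_even m : (2 < m)%N -> dpoly m.*2 =
  dpoly m * (dpoly m.+2 * dpoly m.-1 ^+ 2 - dpoly m.-2 * dpoly m.+1 ^+ 2).
Proof.
move=> m1; have m4 : (4 < m.*2)%N by lia.
by rewrite dpolyE//= doubleK odd_double.
Qed.

Definition dval x t n : F := (dpoly n).[x] * t ^+ (~~ odd n).

Lemma dval_division x t : t ^+ 2 = two_tors E x -> division_seq E x t (dval x t).
Proof.
move=> tB; have Bx : B.[x] = t ^+ 2 by rewrite horner_two_tors tB.
split; last split.
- rewrite /dval /dpoly /= horner_psi3 horner_psi4 hornerC !hornerE.
  by split; ring.
- move=> m m1; rewrite /dval dpoly_odd//; move: (B) Bx => b Bx.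
  rewrite !(hornerD, hornerN, hornerM, horner_exp) Bx.
  have -> : odd m.-1 = ~~ odd m by case: m m1 => //= m _; rewrite negbK.
  rewrite /= odd_double /= !negbK.
  by case: (odd m) => /=; rewrite !(expr0, expr1, mulr1, mul1r); ring.
move=> m m2; rewrite /dval dpoly_even// !(hornerD, hornerN, hornerM, horner_exp).
have -> : odd m.-1 = ~~ odd m by case: m m2 => //= m _; rewrite negbK.
have -> : odd m.-2 = odd m by case: m m2 => [|[|m]]//= _; rewrite negbK.
rewrite /= odd_double /= !negbK.
by case: (odd m) => /=; rewrite !(expr0, expr1, mulr1, mul1r); ring.
Qed.

End DivisionPolynomials.

Section Map.
Variables (F F' : fieldType) (f : {rmorphism F -> F'}) (E : weierstrass F).
Local Notation fE := (map_weierstrass f E).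

Lemma map_b2 : b2 fE = f (b2 E).
Proof. by rewrite /b2 /= !(rmorph_nat, rmorphD, rmorphM, rmorphXn). Qed.
Lemma map_b4 : b4 fE = f (b4 E).
Proof. by rewrite /b4 /= !(rmorph_nat, rmorphD, rmorphM, rmorphXn). Qed.
Lemma map_b6 : b6 fE = f (b6 E).
Proof. by rewrite /b6 /= !(rmorph_nat, rmorphD, rmorphM, rmorphXn). Qed.
Lemma map_b8 : b8 fE = f (b8 E).
Proof. by rewrite /b8 /= !(rmorph_nat, rmorphB, rmorphD, rmorphM, rmorphXn). Qed.
Lemma map_discriminant : discriminant fE = f (discriminant E).
Proof.
rewrite /discriminant map_b2 map_b4 map_b6 map_b8.
by rewrite !(rmorph_nat, rmorphB, rmorphN, rmorphD, rmorphM, rmorphXn).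
Qed.

Let mapE := (rmorphXn (map_poly f), rmorphD (map_poly f), rmorphM (map_poly f)).

Lemma map_two_tors_poly : two_tors_poly fE = map_poly f (two_tors_poly E).
Proof.
rewrite /two_tors_poly map_b2 map_b4 map_b6 !mapE /=.
by rewrite !(rmorph_nat, rmorphM) /= !map_polyX !map_polyC.
Qed.

Lemma map_psi3_poly : psi3_poly fE = map_poly f (psi3_poly E).
Proof.
rewrite /psi3_poly map_b2 map_b4 map_b6 map_b8 !mapE /=.
by rewrite !(rmorph_nat, rmorphM) /= !map_polyX !map_polyC.
Qed.

Lemma map_psi4_poly : psi4_poly fE = map_poly f (psi4_poly E).
Proof.
rewrite /psi4_poly map_b2 map_b4 map_b6 map_b8 !mapE /=.
by rewrite !(rmorph_nat, rmorphXn, rmorphB, rmorphM) /= !map_polyX !map_polyC.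
Qed.

Lemma map_dpoly n : dpoly fE n = map_poly f (dpoly E n).
Proof.
have [m] := ubnP n; elim: m n => // m IH n nm.
have [n4|] := ltnP 4 n; last first.
  case: n nm => [|[|[|[|[|n]]]]]// _ _; rewrite /dpoly /= ?rmorph0 ?rmorph1//.
    exact: map_psi3_poly.
  exact: map_psi4_poly.
have H k : (k <= n./2.+2)%N -> dpoly fE k = map_poly f (dpoly E k).
  by move=> /(half_lt n4) kn; apply: IH; rewrite -ltnS (leq_trans _ nm).
rewrite !dpolyE//=; case: ifP => _.
  rewrite rmorphB !(rmorphXn, rmorphM) /= map_two_tors_poly !H//; clear; lia.
rewrite rmorphM rmorphB !(rmorphXn, rmorphM) /= !H//; clear; lia.
Qed.

End Map.

(** * The two leading coefficients of a polynomial *)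

Section TopCoefficients.
Variable F : fieldType.
Implicit Types (p q r : {poly F}) (c rho mu : F).

(* p = c (X^d + rho X^(d-1) + ...), multiplied by X so that d = 0 needs no
   special treatment. *)
Definition top2 p (d : nat) c rho : Prop :=
  exists2 r : {poly F}, (size r <= d)%N &
    'X * p = c%:P * ('X^(d.+1) + rho%:P * 'X^d) + r :> {poly F}.

Lemma top2_size p d c rho : c != 0 -> top2 p d c rho ->
  size p = d.+1 /\ lead_coef p = c.
Proof.
move=> nzc [r sr Dp].
have szl : (size (rho%:P * 'X^d + c^-1%:P * r)%R < size ('X^(d.+1) : {poly F}))%N.
  rewrite size_polyXn ltnS leq_sizeD//; first exact: leq_sizeCXn.
  by rewrite size_Cmul ?invr_eq0// ltnW.
have {Dp} Dp : 'X * p = c%:P * ('X^(d.+1) + (rho%:P * 'X^d + c^-1%:P * r)).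
  by rewrite Dp !mulrDr [c%:P * (_ * r)]mulrA -polyCM mulfV// mul1r !addrA.
have szp : size ('X * p) = d.+2.
  by rewrite Dp size_Cmul// size_polyDl// size_polyXn.
have nzp : p != 0 by apply: contra_eq_neq szp => ->; rewrite mulr0 size_poly0.
split; first by apply: succn_inj; rewrite -szp mulrC size_mulX.
rewrite -(mul1r (lead_coef p)) -(lead_coefX F) -lead_coefM Dp lead_coefM.
by rewrite lead_coefC lead_coefDl// lead_coefXn mulr1.
Qed.

Lemma top2_uniq p d c rho rho' : c != 0 ->
  top2 p d c rho -> top2 p d c rho' -> rho = rho'.
Proof.
move=> nzc [r sr Dp] [r' sr' Dp']; apply: (mulfI nzc).
have := congr1 (fun q : {poly F} => q`_d) (etrans (esym Dp) Dp').
rewrite !coefD !coefCM !coefD !coefCM !coefXn eqxx ltn_eqF// !add0r !mulr1.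
by rewrite [r`_d]nth_default// [r'`_d]nth_default// !addr0.
Qed.

Lemma top2_exists p : p != 0 ->
  exists rho, top2 p (size p).-1 (lead_coef p) rho.
Proof.
move=> nzp; pose d := (size p).-1.
have nzc : lead_coef p != 0 by rewrite lead_coef_eq0.
exists (('X * p)`_d / lead_coef p).
exists (\poly_(i < d) ('X * p)`_i); first exact: size_poly.
apply/polyP => i; rewrite coefD coefCM coefD coefCM !coefXn coef_poly -/d.
have sz : size ('X * p) = d.+2.
  by rewrite mulrC size_mulX// /d prednK// size_poly_gt0.
have [id|di|->] := ltngtP i d.
- by rewrite (ltn_eqF (leqW id)) /= mulr0 addr0 mulr0 add0r.
- have [->|] := eqVneq i d.+1; first by rewrite mulr0 !addr0 mulr1 coefXM.
  rewrite mulr0 !addr0 mulr0 => nid; rewrite nth_default// sz.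
  by rewrite ltn_neqAle eq_sym nid.
by rewrite ltn_eqF// ?eqxx add0r mulr1 addr0 [lead_coef p * _]mulrC divfK.
Qed.

Lemma top2M p q d d' c c' rho rho' : top2 p d c rho -> top2 q d' c' rho' ->
  top2 (p * q) (d + d') (c * c') (rho + rho').
Proof.
move=> [r sr Dp] [r' sr' Dq].
pose s := 'X * (p * q) - (c * c')%:P * ('X^((d + d').+1) + (rho + rho')%:P * 'X^(d + d')).
exists s; last by rewrite /s addrC subrK.
suff : (size ('X * s)%R <= (d + d').+1)%N.
  have [->|nzs] := eqVneq s 0; first by rewrite size_poly0.
  by rewrite mulrC size_mulX.
have -> : 'X * s = (c * c' * rho * rho')%:P * 'X^(d + d')
    + c%:P * ('X * 'X^d * r') + (c * rho)%:P * ('X^d * r')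
    + c'%:P * ('X * 'X^d' * r) + (c' * rho')%:P * ('X^d' * r) + r * r'.
  rewrite /s mulrBr; have -> : 'X * ('X * (p * q)) = ('X * p) * ('X * q) by ring.
  by rewrite Dp Dq !exprS exprD !polyCM polyCD; ring.
have sM (u v : {poly F}) a b : (size u <= a)%N -> (size v <= b)%N ->
    (size (u * v)%R <= (a + b).-1)%N.
  by move=> ua vb; rewrite (leq_trans (size_polyMleq _ _))//; lia.
have sC (u : {poly F}) a b : (size u <= b)%N -> (size (a%:P * u)%R <= b)%N.
  by move=> ub; rewrite mul_polyC (leq_trans (size_scale_leq _ _)).
have sX k : (size ('X^k : {poly F}) <= k.+1)%N by rewrite size_polyXn.
have sX1 k : (size (('X : {poly F}) * 'X^k)%R <= k.+2)%N by rewrite -exprS size_polyXn.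
rewrite !leq_sizeD//.
- exact: sC.
- by apply/sC/(leq_trans (sM _ _ _ _ (sX1 _) sr')); lia.
- by apply/sC/(leq_trans (sM _ _ _ _ (sX _) sr')); lia.
- by apply/sC/(leq_trans (sM _ _ _ _ (sX1 _) sr)); lia.
- by apply/sC/(leq_trans (sM _ _ _ _ (sX _) sr)); lia.
by apply: (leq_trans (sM _ _ _ _ sr sr')); lia.
Qed.

Lemma top2B p q d c c' rho : top2 p d c rho -> top2 q d c' rho ->
  top2 (p - q) d (c - c') rho.
Proof.
move=> [r sr Dp] [r' sr' Dq]; exists (r - r').
  by rewrite leq_sizeD ?size_polyN.
by rewrite mulrBr Dp Dq polyCB; ring.
Qed.

Variable mu : F.

(* Over a splitting field, the roots of p have mean - mu. *)
Definition balanced p d c := top2 p d c (d%:R * mu).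

Lemma balancedM p q d d' c c' : balanced p d c -> balanced q d' c' ->
  balanced (p * q) (d + d') (c * c').
Proof. by rewrite /balanced natrD mulrDl; apply: top2M. Qed.

Lemma balanced1 : balanced 1 0 1.
Proof. by exists 0; rewrite ?size_poly0//; ring. Qed.

Lemma balancedX p d c k : balanced p d c -> balanced (p ^+ k) (k * d) (c ^+ k).
Proof.
move=> bp; elim: k => [|k IH]; first exact: balanced1.
by rewrite !exprS mulSn; apply: balancedM.
Qed.

Lemma balancedB p q d c c' : balanced p d c -> balanced q d c' ->
  balanced (p - q) d (c - c').
Proof. exact: top2B. Qed.

(** Relative to the leading coefficients, the second coefficients of factors add up to that of the
    product, so those of p and p q force that of q. *)
Lemma balanced_divl p q d d' c c' : c != 0 -> c' != 0 ->
  balanced (p * q) (d + d') (c * c') -> balanced p d c -> balanced q d' c'.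
Proof.
move=> nzc nzc' bpq bp.
have nz : c * c' != 0 by rewrite mulf_neq0.
have [szpq lpq] := top2_size nz bpq; have [szp lp] := top2_size nzc bp.
have nzpq : p * q != 0 by rewrite -size_poly_gt0 szpq.
have [nzp nzq] : p != 0 /\ q != 0 by move: nzpq; rewrite mulf_eq0 negb_or => /andP.
have szq : size q = d'.+1.
  by move: szpq; rewrite size_mul// szp addSn /= -addnS => /addnI.
have lq : lead_coef q = c'.
  by apply: (mulfI nzc); rewrite -lpq lead_coefM lp.
have [rho] := top2_exists nzq; rewrite szq lq /= => tq.
rewrite /balanced; suff <- : rho = d'%:R * mu by [].
have := top2_uniq nz (top2M bp tq) bpq; rewrite natrD mulrDl; exact: addrI.
Qed.

Lemma top2_prodXsubC (s : seq F) :
  top2 (\prod_(a <- s) ('X - a%:P)) (size s) 1 (- \sum_(a <- s) a).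
Proof.
elim: s => [|a s IH]; first by rewrite !big_nil oppr0; exists 0; rewrite ?size_poly0//; ring.
rewrite !big_cons opprD -[X in top2 _ _ X]mul1r -[size _]add1n; apply: top2M => //.
by exists 0; rewrite ?size_poly0// polyCN; ring.
Qed.

Lemma balanced_sum (s : seq F) c c' : c' != 0 ->
  balanced (c'%:P * \prod_(a <- s) ('X - a%:P)) (size s) c ->
  \sum_(a <- s) a = - ((size s)%:R * mu).
Proof.
move=> nzc' b.
have t : top2 (c'%:P * \prod_(a <- s) ('X - a%:P)) (0 + size s) (c' * 1)
    (0 + - \sum_(a <- s) a).
  apply: top2M (top2_prodXsubC s).
  by exists 0; rewrite ?size_poly0//; ring.
move: t; rewrite add0n add0r mulr1 => t.
have [_ lc] := top2_size nzc' t.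
have [k Dk] := b.
have cc' : c = c'.
  apply/eqP; have [c0|nzc] := eqVneq c 0; last by rewrite -(top2_size nzc b).2 lc.
  exfalso; case: b; rewrite c0 polyC0 mul0r => r sr; rewrite add0r => Dr.
  have := (top2_size nzc' t).1 => sz.
  have : size ('X * (c'%:P * \prod_(a <- s) ('X - a%:P))) = (size s).+2.
    by rewrite mulrC size_mulX ?sz// -size_poly_gt0 sz.
  by rewrite Dr => e; move: sr; rewrite e; lia.
by rewrite cc' in b; rewrite -(top2_uniq nzc' t b) opprK.
Qed.

End TopCoefficients.

Section DivisionPolynomialDegree.
Variables (F : fieldType) (E : weierstrass F).
Hypothesis char0 : forall n, (n%:R == 0 :> F) = (n == 0)%N.

(** The opposite of the mean root: the three roots of B = 4 x^3 + b2 x^2 + ... sum to -b2/4. *)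
Definition mean_x : F := b2 E / 12.

(** This is (n^2 - 1)/2 for n odd and (n^2 - 4)/2 for n even: the number of pairs of opposite points
    in E[n] outside E[2]. *)
Definition dpoly_deg n : nat :=
  if odd n then 2 * n./2 * (n./2).+1 else 2 * (n./2).-1 * (n./2).+1.
Definition dpoly_lead n : F := if odd n then n%:R else (n./2)%:R.

Lemma balanced_two_tors : balanced mean_x (two_tors_poly E) 3 4.
Proof.
have nz12 : 12 != 0 :> F by rewrite char0.
exists ((2 * b4 E)%:P * 'X ^+ 2 + (b6 E)%:P * 'X).
  rewrite leq_sizeD//; first exact: leq_sizeCXn.
  exact: leq_trans (leq_sizeCXn _ 1) _.
have -> : 3 * mean_x = b2 E / 4 by rewrite /mean_x; field; rewrite !char0.
rewrite /two_tors_poly; have -> : (b2 E)%:P = 4%:P * (b2 E / 4)%:P.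
  by rewrite -polyCM mulrC divfK// char0.
by ring.
Qed.

Lemma balanced_psi3 : balanced mean_x (psi3_poly E) 4 3.
Proof.
have nz12 : 12 != 0 :> F by rewrite char0.
exists ((3 * b4 E)%:P * 'X ^+ 3 + (3 * b6 E)%:P * 'X ^+ 2 + (b8 E)%:P * 'X).
  rewrite !leq_sizeD//; first exact: leq_sizeCXn.
    by apply: leq_trans (leq_sizeCXn _ 2) _.
  by apply: leq_trans (leq_sizeCXn _ 1) _.
have -> : 4 * mean_x = b2 E / 3 by rewrite /mean_x; field; rewrite !char0.
rewrite /psi3_poly; have -> : (b2 E)%:P = 3%:P * (b2 E / 3)%:P.
  by rewrite -polyCM mulrC divfK// char0.
by ring.
Qed.

Lemma balanced_psi4 : balanced mean_x (psi4_poly E) 6 2.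
Proof.
have nz12 : 12 != 0 :> F by rewrite char0.
exists ((5 * b4 E)%:P * 'X ^+ 5 + (10 * b6 E)%:P * 'X ^+ 4
  + (10 * b8 E)%:P * 'X ^+ 3 + (b2 E * b8 E - b4 E * b6 E)%:P * 'X ^+ 2
  + (b4 E * b8 E - b6 E ^+ 2)%:P * 'X).
  rewrite !leq_sizeD//; first exact: leq_sizeCXn.
  - by apply: leq_trans (leq_sizeCXn _ 4) _.
  - by apply: leq_trans (leq_sizeCXn _ 3) _.
  - by apply: leq_trans (leq_sizeCXn _ 2) _.
  by apply: leq_trans (leq_sizeCXn _ 1) _.
have -> : 6 * mean_x = b2 E / 2 by rewrite /mean_x; field; rewrite !char0.
rewrite /psi4_poly; have -> : (b2 E)%:P = 2%:P * (b2 E / 2)%:P.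
  by rewrite -polyCM mulrC divfK// char0.
by ring.
Qed.

Lemma dpoly_deg_odd j : dpoly_deg j.*2.+1 = (2 * j * j.+1)%N.
Proof. by rewrite /dpoly_deg /= odd_double uphalf_double. Qed.
Lemma dpoly_deg_even j : dpoly_deg j.+1.*2 = (2 * j * j.+2)%N.
Proof. by rewrite /dpoly_deg odd_double doubleK. Qed.
Lemma dpoly_lead_odd j : dpoly_lead j.*2.+1 = 2 * j%:R + 1.
Proof. by rewrite /dpoly_lead /= odd_double -natr1 -mul2n natrM. Qed.
Lemma dpoly_lead_even j : dpoly_lead j.+1.*2 = j%:R + 1.
Proof. by rewrite /dpoly_lead odd_double doubleK -natr1. Qed.

Lemma balanced_eq p d d' c c' : balanced mean_x p d c -> d = d' -> c = c' ->
  balanced mean_x p d' c'.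
Proof. by move=> b <- <-. Qed.

(** Polynomials with the same mean root are stable under products and under differences in equal
    degree, the leading coefficient 0 being allowed. What remains is bookkeeping of degrees and
    leading coefficients, according to n modulo 4. *)
Lemma balanced_dpoly n : (0 < n)%N ->
  balanced mean_x (dpoly E n) (dpoly_deg n) (dpoly_lead n).
Proof.
have [m] := ubnP n; elim: m n => // m IH n nm n0.
have [n4|] := ltnP 4 n; last first.
  case: n n0 nm {IH} => [|[|[|[|[|n]]]]]// _ _ _.
  - exact: balanced1.
  - exact: balanced1.
  - exact: balanced_psi3.
  - exact: balanced_psi4.
have H k : (0 < k)%N -> (k <= n./2.+2)%N ->
    balanced mean_x (dpoly E k) (dpoly_deg k) (dpoly_lead k).
  by move=> k0 /(half_lt n4) kn; apply: IH => //; rewrite -ltnS (leq_trans _ nm).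
have bB := balanced_two_tors.
have bo j : (j.*2.+1 <= n./2.+2)%N ->
    balanced mean_x (dpoly E j.*2.+1) (2 * j * j.+1) (2 * j%:R + 1).
  by move=> jn; have := H j.*2.+1 isT jn; rewrite dpoly_deg_odd dpoly_lead_odd.
have be j : (j.+1.*2 <= n./2.+2)%N ->
    balanced mean_x (dpoly E j.+1.*2) (2 * j * j.+2) (j%:R + 1).
  by move=> jn; have := H j.+1.*2 isT jn; rewrite dpoly_deg_even dpoly_lead_even.
have {m IH nm n0 H} [k Dk] : exists k, [\/ n = k.+1.*2.*2.+1, n = k.+1.*2.+1.*2.+1,
     n = k.+2.*2.*2 | n = k.+1.*2.+1.*2]%N.
  have := divn_eq n 4; have := ltn_pmod n (isT : (0 < 4)%N).
  case: (n %% 4)%N => [|[|[|[|]]]]// _ e.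
  - by exists (n %/ 4 - 2)%N; apply: Or43; lia.
  - by exists (n %/ 4).-1; apply: Or41; lia.
  - by exists (n %/ 4).-1; apply: Or44; lia.
  by exists (n %/ 4).-1; apply: Or42; lia.
case: Dk => Dk; rewrite {}Dk ?(doubleK, uphalf_double) /= in bo be n4 *.
- rewrite dpoly_odd//= odd_double /= expr0 mul1r.
  have T1 := balancedM (balancedX 2 bB)
    (balancedM (be k.+1 ltac:(clear; lia)) (balancedX 3 (be k ltac:(clear; lia)))).
  have T2 := balancedM (bo k ltac:(clear; lia)) (balancedX 3 (bo k.+1 ltac:(clear; lia))).
  have {}T2 := balanced_eq T2 (d' := 2 * k.+1.*2 * k.+1.*2.+1) ltac:(clear; nia) erefl.
  have {}T1 := balanced_eq T1 (d' := 2 * k.+1.*2 * k.+1.*2.+1) ltac:(clear; nia) erefl.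
  apply: (balanced_eq (balancedB T1 T2)); first by rewrite dpoly_deg_odd.
  by rewrite dpoly_lead_odd -!mul2n; ring.
- rewrite dpoly_odd//= odd_double /= expr0 mul1r.
  have T1 := balancedM (bo k.+2 ltac:(clear; lia)) (balancedX 3 (bo k.+1 ltac:(clear; lia))).
  have T2 := balancedM (balancedX 2 bB)
    (balancedM (be k ltac:(clear; lia)) (balancedX 3 (be k.+1 ltac:(clear; lia)))).
  have {}T2 := balanced_eq T2 (d' := 2 * k.+1.*2.+1 * k.+1.*2.+2) ltac:(clear; nia) erefl.
  have {}T1 := balanced_eq T1 (d' := 2 * k.+1.*2.+1 * k.+1.*2.+2) ltac:(clear; nia) erefl.
  apply: (balanced_eq (balancedB T1 T2)); first by rewrite (dpoly_deg_odd k.+1.*2.+1).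
  rewrite (dpoly_lead_odd k.+1.*2.+1) -!mul2n; ring.
- rewrite dpoly_even//=.
  have T1 := balancedM (be k.+2 ltac:(clear; lia)) (balancedX 2 (bo k.+1 ltac:(clear; lia))).
  have T2 := balancedM (be k ltac:(clear; lia)) (balancedX 2 (bo k.+2 ltac:(clear; lia))).
  have {}T2 := balanced_eq T2 (d' := 6 * k * k + 24 * k + 24) ltac:(clear; nia) erefl.
  have {}T1 := balanced_eq T1 (d' := 6 * k * k + 24 * k + 24) ltac:(clear; nia) erefl.
  apply: (balanced_eq (balancedM (be k.+1 ltac:(clear; lia)) (balancedB T1 T2))).
    by rewrite (dpoly_deg_even k.+1.*2.+1); clear; nia.
  rewrite (dpoly_lead_even k.+1.*2.+1) -!mul2n; ring.
rewrite dpoly_even//=.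
have T1 := balancedM (bo k.+2 ltac:(clear; lia)) (balancedX 2 (be k ltac:(clear; lia))).
have T2 := balancedM (bo k ltac:(clear; lia)) (balancedX 2 (be k.+1 ltac:(clear; lia))).
have {}T2 := balanced_eq T2 (d' := 6 * k * k + 18 * k + 12) ltac:(clear; nia) erefl.
have {}T1 := balanced_eq T1 (d' := 6 * k * k + 18 * k + 12) ltac:(clear; nia) erefl.
apply: (balanced_eq (balancedM (bo k.+1 ltac:(clear; lia)) (balancedB T1 T2))).
  by rewrite (dpoly_deg_even k.+1.*2); clear; nia.
rewrite (dpoly_lead_even k.+1.*2) -!mul2n; ring.
Qed.

Lemma dpoly_lead_neq0 n : (0 < n)%N -> dpoly_lead n != 0.
Proof.
rewrite /dpoly_lead => n0; case: ifP => on; rewrite char0; first by case: n n0 on.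
by case: n n0 on => [|[|n]].
Qed.

Lemma size_dpoly n : (0 < n)%N -> size (dpoly E n) = (dpoly_deg n).+1.
Proof.
by move=> n0; have [] := top2_size (dpoly_lead_neq0 n0) (balanced_dpoly n0).
Qed.

Lemma dpoly_neq0 n : (0 < n)%N -> dpoly E n != 0.
Proof. by move=> n0; rewrite -size_poly_gt0 size_dpoly. Qed.

End DivisionPolynomialDegree.

(** * Torsion points over an algebraically closed field *)

(** A nonconstant p takes the value -1, at a root of p + 1. *)
Lemma closed_nonroot (F : closedFieldType) (p : {poly F}) :
  p != 0 -> exists x, p.[x] != 0.
Proof.
move=> nzp; have [/eqP/size_poly1P[c nzc ->]|sz1] := eqVneq (size p) 1%N.
  by exists 0; rewrite hornerC.
have sz : (1 < size p)%N by rewrite ltn_neqAle eq_sym sz1 size_poly_gt0.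
have : size (p + 1) != 1%N by rewrite size_polyDl ?size_poly1.
case/closed_rootP => x; rewrite /root !hornerE => /eqP px.
exists x; apply: contraTneq isT => p0; move/eqP: px.
by rewrite p0 add0r oner_eq0.
Qed.

Section ClosedField.
Variables (F : closedFieldType) (E : weierstrass F).
Hypothesis char0 : forall n, (n%:R == 0 :> F) = (n == 0)%N.
Hypothesis E_nonsing : nonsingular (two_tors_poly E).

Local Notation B := (two_tors_poly E).
Local Notation d := (dpoly E).

Lemma two_neq0 : 2 != 0 :> F. Proof. by rewrite char0. Qed.

Lemma two_tors_poly_neq0 : B != 0.
Proof. by rewrite -size_poly_gt0 size_two_tors_poly// two_neq0. Qed.

Lemma exists_over x : exists y, on_curve E (Some (x, y)).
Proof.
have /closed_rootP[y] : size (wpoly E x) != 1%N by rewrite size_wpoly.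
rewrite /root /wpoly !hornerE => /eqP yP; exists y.
by rewrite /on_curve -subr_eq0; apply/eqP; rewrite -[RHS]yP /=; ring.
Qed.

Lemma twoY_sqr x y : on_curve E (Some (x, y)) -> twoY E x y ^+ 2 = two_tors E x.
Proof. by move=> cP; apply/eqP; rewrite -on_curveE// two_neq0. Qed.

(* For t^2 = B(x), the value at (x, t) of the elliptic net relation. *)
Definition eds_defect a b : {poly F} :=
  B ^+ (~~ odd (a + b)) * (d (a + b) * d (a - b))
  - B ^+ (odd a + ~~ odd b) * (d a.+1 * d a.-1 * d b ^+ 2)
  + B ^+ (odd b + ~~ odd a) * (d b.+1 * d b.-1 * d a ^+ 2).

Lemma eds_defectE a b x t : (0 < b <= a)%N -> t ^+ 2 = two_tors E x ->
  let e := dval E x t in (eds_defect a b).[x] =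
  e (a + b)%N * e (a - b)%N
  - (e a.+1 * e a.-1 * e b ^+ 2 - e b.+1 * e b.-1 * e a ^+ 2).
Proof.
move=> /andP[b0 ba] tB e; have Bx : B.[x] = t ^+ 2 by rewrite horner_two_tors.
rewrite /eds_defect /e /dval; move: (B) Bx => B' Bx.
rewrite !(hornerD, hornerN, hornerM, horner_exp) Bx oddD oddB//.
have op k : (0 < k)%N -> odd k.-1 = ~~ odd k by case: k => //= k _; rewrite negbK.
rewrite !op ?(leq_trans b0)//=.
by case: (odd a); case: (odd b);
  rewrite /= ?(expr0, expr1, mulr1, mul1r, addn0, addn1); ring.
Qed.

(** Otherwise some x would be a root neither of this polynomial nor of B nor of any psi_k with k <=
    a + b. At such a point [mulP_division] applies, and the relations at (a, 1) and (b, 1) eliminate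
    x([a]P) and x([b]P) from the one at (a, b). *)
Lemma eds_defect0 a b : (0 < b < a)%N -> eds_defect a b = 0.
Proof.
move=> ba; apply: contraTeq isT => nz.
pose q := B * \prod_(1 <= k < (a + b).+1) d k.
have nzq : q != 0.
  rewrite mulf_neq0 ?two_tors_poly_neq0// prodf_seq_neq0; apply/allP => k.
  by rewrite mem_index_iota => /andP[k0 _] /=; rewrite dpoly_neq0.
have [x] := closed_nonroot (mulf_neq0 nz nzq).
have [y cP] := exists_over x; have tB := twoY_sqr cP.
rewrite !hornerM !mulf_eq0 !negb_or horner_prod horner_two_tors -tB => /and3P[nzx nzt].
rewrite prodf_seq_neq0 => /allP dk.
have nzt' : twoY E x y != 0 by apply: contraNneq nzt => ->; rewrite expr0n.
pose e := dval E x (twoY E x y).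
have nze k : (0 < k <= a + b)%N -> e k != 0.
  move=> kab; rewrite mulf_neq0 ?expf_neq0//.
  by apply: dk; rewrite mem_index_iota ltnS.
have [_ eq] := mulP_division two_neq0 E_nonsing cP (dval_division tB)
  (ltac:(clear -ba; lia) : (0 < a + b)%N) nze.
move: nzx; rewrite (eds_defectE _ tB); last by lia.
rewrite -/e; pose X k := mulX E k (Some (x, y)); have X1 : X 1 = x by [].
have {}eq : forall a' b', (0 < b' < a')%N -> (a' + b' <= (a + b).+1)%N ->
  (X a' - X b') * (e a' * e b') ^+ 2 = - (e (a' + b')%N * e (a' - b')%N) := eq.
have e1 : e 1 = 1 by rewrite /e /dval hornerC mulr1.
have e0 : e 0 = 0 by rewrite /e /dval horner0 mul0r.
have h1 := eq a b ba ltac:(lia).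
have h2 := eq a 1 ltac:(lia) ltac:(lia); rewrite X1 e1 mulr1 addn1 subn1 in h2.
have h3 : (X b - x) * e b ^+ 2 = - (e b.+1 * e b.-1).
  have [b1|b1] := ltnP 1 b.
    by have := eq b 1 ltac:(lia) ltac:(lia); rewrite X1 e1 mulr1 addn1 subn1.
  have -> : b = 1 by lia.
  by rewrite X1 subrr mul0r e0 mulr0 oppr0.
suff -> : e (a + b)%N * e (a - b)%N
    = e a.+1 * e a.-1 * e b ^+ 2 - e b.+1 * e b.-1 * e a ^+ 2.
  by rewrite subrr eqxx.
apply: oppr_inj; rewrite -h1.
transitivity ((X a - x) * e a ^+ 2 * e b ^+ 2 - (X b - x) * e b ^+ 2 * e a ^+ 2).
  by ring.
by rewrite h2 h3; ring.
Qed.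

Section Point.
Variables (x y : F).
Local Notation P := (Some (x, y)).
Local Notation t := (twoY E x y).
Local Notation e := (dval E x t).
Hypothesis cP : on_curve E P.

Let tB : t ^+ 2 = two_tors E x. Proof. exact: twoY_sqr. Qed.
Let e0 : e 0 = 0. Proof. by rewrite /dval horner0 mul0r. Qed.
Let e1 : e 1 = 1. Proof. by rewrite /dval hornerC mulr1. Qed.
Let e2 : e 2 = t. Proof. by rewrite /dval hornerC mul1r. Qed.

Lemma dval_eds a b : (0 < b < a)%N -> e (a + b)%N * e (a - b)%N
  = e a.+1 * e a.-1 * e b ^+ 2 - e b.+1 * e b.-1 * e a ^+ 2.
Proof.
move=> ba; apply/eqP; rewrite -subr_eq0 -eds_defectE//; last by lia.
by rewrite eds_defect0// horner0.
Qed.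

(** Four times the right-hand side is 2 B B'' - B'^2, so a common root of psi_3 and B would be a
    root of B'. *)
Lemma psi3_disc : 4 * psi3_at E x = (12 * x + b2 E) * two_tors E x
  - (6 * x ^+ 2 + b2 E * x + b4 E) ^+ 2.
Proof.
transitivity (4 * (3 * x ^+ 4 + b2 E * x ^+ 3 + 3 * b4 E * x ^+ 2 + 3 * b6 E * x)
  + 4 * b8 E); first by rewrite /psi3_at; ring.
by rewrite four_b8 /two_tors; ring.
Qed.

(** The middle factor is B'/2: a common root of psi_3 and psi_4 / psi_2 is a root of B. *)
Lemma psi4_psi3 : psi4_at E x
  = psi3_at E x * (6 * x ^+ 2 + b2 E * x + b4 E) - two_tors E x ^+ 2.
Proof.
have nz4 : 4 != 0 :> F by rewrite char0.
rewrite /psi4_at /psi3_at /two_tors.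
have -> : b8 E = (b2 E * b6 E - b4 E ^+ 2) / 4.
  by rewrite -four_b8 mulrC mulKf.
by field.
Qed.

(** * The least index r with psi_r(P) = 0, and the vanishing at its multiples *)

Section Rank.
Variable r : nat.
Hypotheses (r_gt0 : (0 < r)%N) (er : e r = 0).
Hypothesis r_min : forall k, (0 < k < r)%N -> e k != 0.

Let r_gt1 : (1 < r)%N.
Proof.
case: r r_gt0 er => [|[|//]]//; rewrite e1 => _ /eqP.
by rewrite oner_eq0.
Qed.

(** If e r and e (r + 1) both vanish, the net relation gives e (r + k) = 0 for 0 < k < r. For r > 3
    the recurrence for the index 2 r - 3 = r + (r - 3) then reads e (r - 3) e (r - 1)^3 = 0, against
    minimality. For r = 3 and r = 2 the identities on psi_4 and psi_3 take over, the latter with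
    nonsingularity. *)
Lemma dval_rankS : e r.+1 != 0.
Proof.
apply/eqP => erS; have [[_ _ _ e3 e4] [eodd _]] := dval_division tB.
have [r4|r4] := ltnP 3 r.
  have ez k : (0 < k < r)%N -> e (r + k)%N = 0.
    move=> kr; have := dval_eds kr; rewrite er erS expr0n /= !(mul0r, mulr0) subr0.
    move/eqP; rewrite mulf_eq0 (negPf (r_min (k := r - k) _)); last by lia.
    by rewrite orbF => /eqP.
  have := eodd r.-2 ltac:(lia).
  rewrite (_ : r.-2.*2.+1 = r + (r - 3))%N; last by lia.
  rewrite ez; last by lia.
  rewrite (_ : r.-2.+2 = r); last by lia.
  rewrite er mul0r sub0r => /esym/eqP; rewrite oppr_eq0 mulf_eq0 expf_eq0 /=.
  by rewrite !(negPf (r_min _))//; lia.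
have [r3|r2] : r = 3 \/ r = 2 by lia.
  move: er erS; rewrite r3 e3 e4 => p3 /eqP; rewrite mulf_eq0 => /orP[/eqP t0|].
    by have := r_min (k := 2); rewrite r3 e2 t0 eqxx => /(_ isT).
  rewrite psi4_psi3 p3 mul0r sub0r oppr_eq0 expf_eq0 /= -tB expf_eq0 /= => /eqP t0.
  by have := r_min (k := 2); rewrite r3 e2 t0 eqxx => /(_ isT).
move: er erS; rewrite r2 e3 e2 => t0 p3.
have B0 : two_tors E x = 0 by rewrite -tB t0 expr0n.
have := psi3_disc; rewrite p3 B0 !mulr0 sub0r => /esym/eqP.
rewrite oppr_eq0 expf_eq0 /= => /eqP h.
have := E_nonsing (x := x); rewrite horner_two_tors B0 deriv_two_tors => /(_ erefl).
rewrite (_ : _ + _ = 2 * (6 * x ^+ 2 + b2 E * x + b4 E)); last by ring.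
by rewrite h mulr0 eqxx.
Qed.

(** At (m, r) the net relation reduces to e (m + r) e (m - r) = - e (r + 1) e (r - 1) e m^2, so for
    m > r nonvanishing at m spreads to m + r and m - r. *)
Lemma dval_rank n : (0 < n)%N -> (e n == 0) = (r %| n)%N.
Proof.
move=> n0; have eS := dval_rankS.
have eP : e r.-1 != 0 by apply: r_min; lia.
have up m : (r < m)%N -> e m != 0 -> e (m + r)%N != 0 /\ e (m - r)%N != 0.
  move=> rm em; apply/andP; rewrite -negb_or -mulf_eq0 dval_eds//; last by lia.
  rewrite er expr0n mulr0 sub0r oppr_eq0.
  by apply: mulf_neq0; [apply: mulf_neq0 | apply: expf_neq0].
have [q [s [Dn sr]]] : exists q s, n = (q * r + s)%N /\ (s < r)%N.
  by exists (n %/ r)%N, (n %% r)%N; rewrite -divn_eq ltn_pmod.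
rewrite Dn dvdn_addr ?dvdn_mull//.
have [s0|s0] := posnP s.
  have z k : e (k.+1 * r)%N = 0.
    elim: k => [|k IHk]; first by rewrite mul1n.
    apply/eqP/negPn/negP => nz; have [|_] := up (k.+2 * r)%N _ nz.
      by rewrite mulSn; lia.
    by rewrite mulSn addKn IHk eqxx.
  rewrite s0 dvdn0 addn0; case: q Dn => [|q _]; last by rewrite z eqxx.
  by rewrite s0 => Dn; rewrite Dn in n0.
rewrite gtnNdvd//; apply/negbTE; elim: q {Dn} => [|q IH].
  by rewrite mul0n add0n r_min// s0.
case: q IH => [_|q IH].
  rewrite mul1n; have sr' : (0 < s < r)%N by rewrite s0.
  have := dval_eds sr'; rewrite er expr0n mulr0 subr0 => h.
  have : e (r + s)%N * e (r - s)%N != 0.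
    by rewrite h; apply: mulf_neq0; [apply: mulf_neq0 | apply: expf_neq0 (r_min sr')].
  by rewrite mulf_eq0 => /norP[].
rewrite (_ : q.+2 * r + s = q.+1 * r + s + r)%N; last by rewrite mulSn; lia.
by have [] := up (q.+1 * r + s)%N _ IH; first by rewrite mulSn; lia.
Qed.

(** The relation at (r - 1, 1), valid although e r = 0, gives x([r - 1]P) = x(P). If [r - 1]P were P
    and not -P, then [r - 2]P = O would come too early. *)
Lemma mulP_rank : mulP E r P = None.
Proof.
have nz k : (0 < k <= r.-1)%N -> e k != 0 by move=> kr; apply: r_min; lia.
have [fin eq] := mulP_division two_neq0 E_nonsing cP (dval_division tB)
  (ltac:(lia) : (0 < r.-1)%N) nz.
have -> : r = r.-1.+1 by lia.
rewrite mulPS.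
suff -> : mulP E r.-1 P = oppP E P by rewrite addPN.
have [r2|r3] : r = 2 \/ (2 < r)%N by lia.
  have t0 : t = 0 by have := er; rewrite r2 e2.
  by rewrite r2; apply/esym/eqP; rewrite oppP_eq_twoY ?two_neq0// t0.
have := eq r.-1 1 ltac:(lia) ltac:(lia).
rewrite (_ : r.-1 + 1 = r)%N; last by lia.
rewrite er mul0r oppr0 => /eqP; rewrite mulf_eq0 expf_eq0 /= mulf_eq0.
rewrite !(negPf (r_min _)) ?orbF; [|lia..].
rewrite subr_eq0 /mulX; have := fin r.-1 ltac:(lia).
have cR : on_curve E (mulP E r.-1 P) by apply: on_curve_mulP; rewrite ?two_neq0.
have cQ : on_curve E (mulP E r.-2 P) by apply: on_curve_mulP; rewrite ?two_neq0.
have := mulPS E r.-2 P; rewrite (_ : r.-2.+1 = r.-1); last by lia.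
have X1 : mulP E 1 P = P by [].
rewrite X1; case: (mulP E r.-1 P) cR => [[x' y']|]// cR eS _ /eqP ex.
subst x'; have := twoY_sqr cR; rewrite -tB => /eqP; rewrite eqf_sqr -twoY_opp.
case/orP => /eqP/(twoY_inj two_neq0) ey; last by rewrite ey.
case: (fin r.-2 ltac:(lia)).
rewrite -(addPKl two_neq0 E_nonsing cP cQ) -eS ey.
by rewrite -{2}[Some (x, y)](oppPK E) addPN// on_curve_opp// two_neq0.
Qed.

End Rank.

(** Both sides single out the multiples of the least r with e r = 0; if there is no such r, all
    multiples of P are affine. *)
Lemma mulP_eq_None n : (0 < n)%N -> (mulP E n P = None) <-> (e n = 0).
Proof.
move=> n0; have [[k /andP[k0 ek]]|none] :=
  pselect (exists k, (0 < k)%N && (e k == 0)); last first.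
  have nz k : (0 < k <= n)%N -> e k != 0.
    by case/andP=> k0 _; apply: contra_notN none => ek; exists k; rewrite k0.
  have [fin _] := mulP_division two_neq0 E_nonsing cP (dval_division tB) n0 nz.
  have n1 : (0 < n <= n)%N by rewrite n0 leqnn.
  by split=> [/(fin n n1)|/eqP]//; rewrite (negPf (nz n n1)).
have ex : exists k, (0 < k)%N && (e k == 0) by exists k; rewrite k0.
case: (ex_minnP ex) => r /andP[r0 /eqP er] rmin.
have r_min j : (0 < j < r)%N -> e j != 0.
  case/andP=> j0 jr; apply: contraTN jr => ej; rewrite -leqNgt.
  by apply: rmin; rewrite j0.
have nr := mulP_rank r0 er r_min.
have per q s : mulP E (q * r + s) P = mulP E s P.
  elim: q => // q IH; rewrite mulSn -addnA addnC /mulP iterD.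
  by rewrite -/(mulP E r P) nr.
have -> : (e n = 0) <-> (r %| n)%N.
  by rewrite -(dval_rank r0 er r_min n0); split=> /eqP.
rewrite (divn_eq n r) per dvdn_addr ?dvdn_mull//.
have sr : (n %% r < r)%N by rewrite ltn_pmod.
have [->|s0] := posnP (n %% r)%N; first by rewrite dvdn0.
rewrite gtnNdvd//; split=> // ns; exfalso.
have nz k' : (0 < k' <= n %% r)%N -> e k' != 0.
  by move=> kr; apply: r_min; lia.
have [fin _] := mulP_division two_neq0 E_nonsing cP (dval_division tB) s0 nz.
by apply: (fin (n %% r)%N) => //; rewrite s0 leqnn.
Qed.

Lemma dval_consecutive n : (0 < n)%N -> e n = 0 -> e n.+1 != 0.
Proof.
move=> n0 en; have ex : exists k, (0 < k)%N && (e k == 0).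
  by exists n; rewrite n0 en eqxx.
case: (ex_minnP ex) => r /andP[r0 /eqP er] rmin.
have r_min j : (0 < j < r)%N -> e j != 0.
  case/andP=> j0 jr; apply: contraTN jr => ej; rewrite -leqNgt.
  by apply: rmin; rewrite j0.
apply/eqP => /eqP; rewrite (dval_rank r0 er r_min)// => rn1.
move/eqP: en; rewrite (dval_rank r0 er r_min)// => rn.
have : (r %| 1)%N by rewrite -(dvdn_addr _ rn) addn1.
rewrite dvdn1 => /eqP r1; move/eqP: er.
by rewrite r1 e1 oner_eq0.
Qed.

End Point.
End ClosedField.

Section GroupLemmas.
Variables (F : fieldType) (E : weierstrass F).
Hypothesis nz2 : 2 != 0 :> F.
Hypothesis E_nonsing : nonsingular (two_tors_poly E).
Implicit Types P Q A C : ecpoint F.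

Lemma addPACA A P Q C :
    on_curve E A -> on_curve E P -> on_curve E Q -> on_curve E C ->
  addP E (addP E A P) (addP E Q C) = addP E (addP E A Q) (addP E P C).
Proof.
move=> cA cP cQ cC; have ca := on_curve_add nz2.
rewrite -!(addPA nz2 E_nonsing) ?ca//; congr addP.
by rewrite !(addPA nz2 E_nonsing) ?ca//; congr addP; apply: addPC.
Qed.

Lemma mulP_add n P Q : on_curve E P -> on_curve E Q ->
  mulP E n (addP E P Q) = addP E (mulP E n P) (mulP E n Q).
Proof.
move=> cP cQ; elim: n => // n IH.
by rewrite !mulPS IH addPACA// on_curve_mulP.
Qed.

Lemma oppP_add P Q : on_curve E P -> on_curve E Q ->
  oppP E (addP E P Q) = addP E (oppP E P) (oppP E Q).
Proof.
move=> cP cQ; apply/esym/(addP_eq_None nz2 E_nonsing).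
- exact: on_curve_add.
- by apply: on_curve_add; rewrite ?on_curve_opp.
- by rewrite addPACA ?on_curve_opp// !addPN.
Qed.

Lemma mulP_opp n P : on_curve E P -> mulP E n (oppP E P) = oppP E (mulP E n P).
Proof.
move=> cP; elim: n => // n IH.
by rewrite !mulPS IH oppP_add// on_curve_mulP.
Qed.

Lemma mulPD m n P : on_curve E P ->
  mulP E (m + n) P = addP E (mulP E m P) (mulP E n P).
Proof.
move=> cP; elim: m => [|m IH]; first by case: (mulP E n P) => [[]|].
by rewrite addSn !mulPS IH addPA// ?on_curve_mulP.
Qed.

Lemma mulPM m n P : on_curve E P -> mulP E (m * n) P = mulP E m (mulP E n P).
Proof.
by move=> cP; elim: m => // m IH; rewrite mulSn mulPD// IH mulPS.
Qed.

Lemma mulP_None n : mulP E n None = None.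
Proof. by elim: n => // n IH; rewrite mulPS IH. Qed.

Lemma mulP_dvd m n P : on_curve E P -> (m %| n)%N -> mulP E m P = None ->
  mulP E n P = None.
Proof. by move=> cP /dvdnP[q ->] mP; rewrite mulPM// mP mulP_None. Qed.

Lemma oppP_eq_X P Q : on_curve E P -> on_curve E Q ->
  (if P is Some (x, _) then Some x else None)
  = (if Q is Some (x, _) then Some x else None) -> P = Q \/ P = oppP E Q.
Proof.
case: P Q => [[x y]|] [[x' y']|]//; last by left.
rewrite !on_curveE// => /eqP cP /eqP cQ [ex]; subst x'.
move: (cP); rewrite -cQ => /eqP; rewrite eqf_sqr.
case/orP=> /eqP; first by move/(twoY_inj nz2) ->; left.
by rewrite -twoY_opp => /(twoY_inj nz2) ->; right.
Qed.

End GroupLemmas.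

Lemma parityP n : (0 < n)%N -> exists j, n = j.*2.+1 \/ n = j.+1.*2.
Proof.
move=> n0; have := odd_double_half n; case: (odd n) => Dn.
  by exists n./2; left; rewrite -[LHS]Dn.
by exists n./2.-1; right; rewrite -[LHS]Dn add0n; congr _.*2; lia.
Qed.

(** * A fibre of multiplication by n with n^2 points *)

Section Counting.
Variables (F : closedFieldType) (E : weierstrass F).
Hypothesis char0 : forall n, (n%:R == 0 :> F) = (n == 0)%N.
Hypothesis E_nonsing : nonsingular (two_tors_poly E).

Local Notation B := (two_tors_poly E).
Local Notation d := (dpoly E).
Let nz2 : 2 != 0 :> F. Proof. by rewrite char0. Qed.

(** With t^2 replaced by B, these are psi_n^2, psi_{n+1} psi_{n-1} and the numerator of x([n]P) =
    [phi] / [psi_sq]. *)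
Definition psi_sq n : {poly F} := B ^+ (~~ odd n) * d n ^+ 2.
Definition psi_adj n : {poly F} := B ^+ odd n * (d n.+1 * d n.-1).
Definition phi n : {poly F} := 'X * psi_sq n - psi_adj n.

Lemma horner_psi_sq n x t : t ^+ 2 = two_tors E x ->
  (psi_sq n).[x] = dval E x t n ^+ 2.
Proof.
move=> tB; have Bx : B.[x] = t ^+ 2 by rewrite horner_two_tors.
rewrite /psi_sq /dval; move: (B) Bx => B' Bx.
rewrite !(hornerM, horner_exp) Bx.
by case: (odd n); rewrite /= ?(expr0, expr1); ring.
Qed.

Lemma horner_psi_adj n x t : (0 < n)%N -> t ^+ 2 = two_tors E x ->
  (psi_adj n).[x] = dval E x t n.+1 * dval E x t n.-1.
Proof.
move=> n0 tB; have Bx : B.[x] = t ^+ 2 by rewrite horner_two_tors.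
rewrite /psi_adj /dval; move: (B) Bx => B' Bx.
rewrite !(hornerM, horner_exp) Bx.
have -> : odd n.-1 = ~~ odd n by case: n n0 => //= n _; rewrite negbK.
by rewrite /= negbK; case: (odd n); rewrite /= ?(expr0, expr1); ring.
Qed.

Lemma psi_sq_top n : (0 < n)%N ->
  size (psi_sq n) = (n ^ 2)%N /\ lead_coef (psi_sq n) = (n ^ 2)%:R.
Proof.
move=> n0; pose mu := mean_x E.
have bB := balanced_two_tors E char0.
have bn := balanced_dpoly E char0 n0.
have nzN : (n ^ 2)%:R != 0 :> F by rewrite char0 -lt0n expn_gt0 n0.
suff b : balanced (mean_x E) (psi_sq n) (n ^ 2).-1 (n ^ 2)%:R.
  by have [-> ->] := top2_size nzN b; rewrite prednK// expn_gt0 n0.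
apply: balanced_eq (balancedM (balancedX _ bB) (balancedX 2 bn)) _ _.
  have [j [->|->]] := parityP n0; rewrite ?dpoly_deg_odd ?dpoly_deg_even /=;
    by rewrite ?odd_double -mul2n /=; clear; nia.
have [j [->|->]] := parityP n0; rewrite ?dpoly_lead_odd ?dpoly_lead_even /=.
  by rewrite odd_double -mul2n /= mul1r; ring.
by rewrite odd_double -mul2n /=; ring.
Qed.

Lemma psi_adj_top n : (1 < n)%N ->
  size (psi_adj n) = (n ^ 2).+1 /\ lead_coef (psi_adj n) = (n ^ 2).-1%:R.
Proof.
move=> n1; have n0 := ltnW n1.
have bB := balanced_two_tors E char0.
have bS := balanced_dpoly E char0 (ltn0Sn n).
have bP := balanced_dpoly E char0 (ltac:(clear -n1; lia) : (0 < n.-1)%N).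
have nzN : (n ^ 2).-1%:R != 0 :> F.
  by rewrite char0 -lt0n; move: n1; case: n {n0 bS bP} => [|[|n]]//; lia.
suff b : balanced (mean_x E) (psi_adj n) (n ^ 2) (n ^ 2).-1%:R.
  by have [-> ->] := top2_size nzN b.
have [j Dn] : exists j, n = j.+1.*2.+1 \/ n = j.+1.*2.
  have [j [Dn|Dn]] := parityP n0; last by exists j; right.
  by exists j.-1; left; rewrite prednK//; lia.
apply: balanced_eq (balancedM (balancedX _ bB) (balancedM bS bP)) _ _.
  case: Dn => -> ; rewrite ?[_.+1.-1]/(_.+1.*2) ?[_.*2.-1]/(j.*2.+1).
    rewrite -[j.+1.*2.+2]/(j.+2.*2) !dpoly_deg_even /= odd_double -!mul2n.
    by clear; nia.
  by rewrite !dpoly_deg_odd /= odd_double -!mul2n; clear; nia.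
case: Dn => -> ; rewrite ?[_.+1.-1]/(_.+1.*2) ?[_.*2.-1]/(j.*2.+1).
  have -> : (j.+1.*2.+1 ^ 2).-1 = (4 * (j.+1 * j.+2))%N.
    by rewrite -mul2n; clear; nia.
  by rewrite -[j.+1.*2.+2]/(j.+2.*2) !dpoly_lead_even /= odd_double; ring.
have -> : (j.+1.*2 ^ 2).-1 = ((2 * j + 1) * (2 * j + 3))%N.
  by rewrite -mul2n; clear; nia.
by rewrite !dpoly_lead_odd /= odd_double; ring.
Qed.

(** Both terms of [phi n] have degree n^2, with leading coefficients n^2 and n^2 - 1. *)
Lemma phi_top n : (1 < n)%N -> size (phi n) = (n ^ 2).+1 /\ phi n \is monic.
Proof.
move=> n1; have n0 := ltnW n1.
have [s1 l1] := psi_sq_top n0; have [s2 l2] := psi_adj_top n1.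
have szX : size ('X * psi_sq n) = (n ^ 2).+1.
  by rewrite mulrC size_mulX ?s1// -size_poly_gt0 s1 expn_gt0 n0.
have c1 : (phi n)`_(n ^ 2) = 1.
  rewrite coefB coefXM.
  have n20 : (0 < n ^ 2)%N by rewrite expn_gt0 n0.
  rewrite ifF; last by apply/negbTE; rewrite -lt0n.
  move: l1 l2; rewrite /lead_coef s1 s2 /= => -> ->.
  by rewrite -{1}(prednK n20) -natr1; ring.
have le : (size (phi n) <= (n ^ 2).+1)%N.
  by rewrite leq_sizeD ?size_polyN ?szX ?s2.
have sz : size (phi n) = (n ^ 2).+1.
  apply/eqP; rewrite eqn_leq le ltnNge; apply/negP => lt.
  by move/eqP: c1; rewrite nth_default// eq_sym oner_eq0.
by split=> //; rewrite monicE /lead_coef sz /= c1.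
Qed.

(** It vanishes at every multiple root of phi_n - c psi_n^2, whatever c. *)
Definition wronskian n : {poly F} :=
  (phi n)^`() * psi_sq n - phi n * (psi_sq n)^`().

(** For N = n^2 the coefficient of degree 2 N - 2 is N N - N (N - 1) = N. *)
Lemma wronskian_neq0 n : (1 < n)%N -> wronskian n != 0.
Proof.
move=> n1; have n0 := ltnW n1; have [s1 l1] := psi_sq_top n0.
have [s2 /monicP l2] := phi_top n1; pose N := (n ^ 2)%N.
have N1 : (1 < N)%N by rewrite /N; case: (n) n1 => [|[|k]]//; lia.
have nzN : N%:R != 0 :> F by rewrite char0; lia.
have top (p q : {poly F}) a b : (size p <= a.+1)%N -> (size q <= b.+1)%N ->
    (p * q)`_(a + b) = p`_a * q`_b.
  move=> pa qb; rewrite coefM.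
  have ab : (a < (a + b).+1)%N by lia.
  rewrite (bigD1 (Ordinal ab))//= addKn big1 ?addr0// => i ia.
  have [lt|gt|eq] := ltngtP i a.
  - by rewrite [q`__]nth_default ?mulr0// (leq_trans qb)//; clear -lt; lia.
  - by rewrite [p`__]nth_default ?mul0r// (leq_trans pa).
  by move: ia; rewrite -val_eqE /= eq eqxx.
have sd (p : {poly F}) a : (size p <= a.+1)%N -> (size p^`() <= a)%N.
  move=> pa; apply/leq_sizeP => j aj.
  by rewrite coef_deriv nth_default ?mul0rn// (leq_trans pa).
suff : (wronskian n)`_(N.-1 + N.-1) = N%:R.
  by move=> h; apply: contraNneq nzN => w0; rewrite -h w0 coef0.
have eN : N.-1.+1 = N by lia.
have eN2 : N.-2.+1 = N.-1 by lia.
rewrite /wronskian coefB top; last 2 first.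
- by rewrite eN; apply: sd; rewrite s2.
- by rewrite s1 eN.
have -> : (N.-1 + N.-1 = N + N.-2)%N by lia.
rewrite top; last 2 first.
- by rewrite s2.
- by rewrite eN2; apply: sd; rewrite s1 eN.
rewrite !coef_deriv eN eN2; move: l1 l2; rewrite /lead_coef s1 s2 /= => -> ->.
have nN : N%:R = N.-1%:R + 1 :> F by rewrite natr1 eN.
by rewrite -/N -[1 *+ N]mulr_natr -[_ *+ N.-1]mulr_natr nN; ring.
Qed.

Lemma exists_avoiding (s : seq F) : exists c, c \notin s.
Proof.
have [|c] := @closed_nonroot F (\prod_(a <- s) ('X - a%:P)).
  by rewrite prodf_seq_neq0; apply/allP => a _; rewrite polyXsubC_eq0.
by rewrite horner_prod prodf_seq_neq0 => /allP h; exists c;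
  apply/negP => /h; rewrite !hornerE subrr eqxx.
Qed.

Lemma roots_seq (p : {poly F}) : p != 0 ->
  exists s : seq F, forall x, (x \in s) = root p x.
Proof.
move=> nzp; have [s Dp] := closed_field_poly_normal p; exists s => x.
by rewrite Dp rootZ ?lead_coef_eq0// root_prod_XsubC.
Qed.

(** The abscissa c of R avoids the finitely many values of phi_n / psi_n^2 at roots of the
    Wronskian, of B and of the psi_k with k <= n. Then phi_n - c psi_n^2 has n^2 simple roots, and
    above each of them [n] sends one of two opposite points to R. *)
Lemma fibre_mulP n : (1 < n)%N -> exists R (s : seq (ecpoint F)),
  [/\ on_curve E R, uniq s, size s = (n ^ 2)%N &
      forall P, P \in s -> on_curve E P /\ mulP E n P = R].
Proof.
move=> n1; have n0 := ltnW n1.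
pose bad := wronskian n * \prod_(1 <= k < n.+1) d k.
have nzbad : bad != 0.
  rewrite mulf_neq0 ?wronskian_neq0// prodf_seq_neq0; apply/allP => k.
  by rewrite mem_index_iota => /andP[k0 _] /=; rewrite dpoly_neq0.
have nzB := two_tors_poly_neq0 E char0.
have [Z HZ] := roots_seq (mulf_neq0 nzbad nzB).
have [Z' HZ'] := roots_seq nzB.
have [c] := exists_avoiding
  ([seq (phi n).[x] / (psi_sq n).[x] | x <- Z] ++ Z').
rewrite mem_cat negb_or => /andP[cZ]; rewrite HZ' => nBc.
have [yc cR] := exists_over E c; pose R := Some (c, yc).
have tc : twoY E c yc != 0.
  apply: contraNneq nBc => t0; have := twoY_sqr char0 cR.
  by rewrite t0 expr0n /root horner_two_tors => <-.
pose f := phi n - c *: psi_sq n.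
have [s1 l1] := psi_sq_top n0; have [s2 mphi] := phi_top n1.
have szc : (size (- (c *: psi_sq n))%R < size (phi n))%N.
  by rewrite size_polyN s2 ltnS (leq_trans (size_scale_leq _ _))// s1.
have szf : size f = (n ^ 2).+1 by rewrite /f size_polyDl.
have mf : f \is monic by rewrite monicE lead_coefDl// -monicE.
have froot x : root f x -> exists y, [/\ on_curve E (Some (x, y)) &
    mulP E n (Some (x, y)) = R] /\ f^`().[x] != 0.
  rewrite /root /f hornerD hornerN hornerZ subr_eq0 => /eqP fx.
  have [y cP] := exists_over E x; have tB := twoY_sqr char0 cP.
  pose e := dval E x (twoY E x y).
  have sqx : (psi_sq n).[x] = e n ^+ 2 by apply: horner_psi_sq.
  have adx : (psi_adj n).[x] = e n.+1 * e n.-1 by apply: horner_psi_adj.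
  have phx : (phi n).[x] = x * e n ^+ 2 - e n.+1 * e n.-1.
    by rewrite /phi hornerD hornerN hornerM hornerX sqx adx.
  (* A root of f where psi_n vanishes would be a zero of phi_n, hence of psi_{n+1} or psi_{n-1}, but
     consecutive terms have no common zero. *)
  have nzn : e n != 0.
    apply/eqP => en; have := dval_consecutive char0 E_nonsing cP n0 en.
    move/eqP: fx; rewrite phx sqx en expr0n !mulr0 sub0r oppr_eq0 mulf_eq0.
    move=> h1 h2; have {h1 h2} en1 : e n.-1 = 0.
      by apply/eqP; case/orP: h1 => [h|//]; rewrite h in h2.
    have n10 : (0 < n.-1)%N by nlia.
    have := dval_consecutive char0 E_nonsing cP n10 en1.
    by rewrite prednK// -/e en eqxx.
  have nzsq : (psi_sq n).[x] != 0 by rewrite sqx expf_neq0.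
  have : x \notin Z.
    apply: contra cZ => xZ; apply/mapP; exists x => //.
    by rewrite fx mulfK.
  rewrite HZ /root !hornerM !mulf_eq0 !negb_or => /andP[/andP[wx dx] Bx].
  have nzt : twoY E x y != 0.
    by apply: contraNneq Bx => t0; rewrite horner_two_tors -tB t0 expr0n.
  have nze k : (0 < k <= n)%N -> e k != 0.
    move=> kn; rewrite mulf_neq0 ?expf_neq0//; move: dx.
    rewrite horner_prod prodf_seq_neq0 => /allP/(_ k) /=; apply.
    by rewrite mem_index_iota ltnS.
  have [fin eq] := mulP_division nz2 E_nonsing cP (dval_division tB) n0 nze.
  have Xn : mulX E n (Some (x, y)) = c.
    have := eq n 1 ltac:(nlia) ltac:(nlia).
    rewrite [dval E x _ 1]/dval hornerC mulr1 mulr1 addn1 subn1 -/e => h.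
    apply: (mulIf (expf_neq0 2 nzn)); rewrite -sqx -fx phx sqx.
    apply/eqP; rewrite -subr_eq0; apply/eqP.
    transitivity ((mulX E n (Some (x, y)) - x) * e n ^+ 2 + e n.+1 * e n.-1).
      by ring.
    by rewrite h addNr.
  have nzf' : f^`().[x] != 0.
    rewrite /f derivB derivZ hornerD hornerN hornerZ; apply: contraNneq wx => f'0.
    rewrite /wronskian hornerD hornerN (hornerM (phi n)^`()) (hornerM (phi n)) fx; apply/eqP.
    transitivity (((phi n)^`().[x] - c * (psi_sq n)^`().[x]) * (psi_sq n).[x]).
      by ring.
    by rewrite f'0 mul0r.
  have cnP := on_curve_mulP nz2 n cP.
  have [e1|e1] : mulP E n (Some (x, y)) = R \/ mulP E n (Some (x, y)) = oppP E R.
    apply: oppP_eq_X => //; move: Xn (fin n) cnP; rewrite /mulX.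
    by case: (mulP E n _) => [[a b]|]; [move=> -> | move=> _ /(_ ltac:(nlia))].
  - by exists y.
  exists (- y - a1 E * x - a3 E); split=> //; split.
    by rewrite -[Some _]/(oppP E (Some (x, y))) on_curve_opp.
  rewrite -[Some _]/(oppP E (Some (x, y))).
  by rewrite mulP_opp// e1 oppPK.
have [r Df] := closed_field_poly_normal f.
rewrite (monicP mf) scale1r in Df.
have ur : uniq r.
  rewrite -separable_prod_XsubC -Df unlock.
  by apply: Pdiv.ClosedField.root_coprimep => x rx; have [y []] := froot x rx.
have szr : size r = (n ^ 2)%N.
  by apply/succn_inj; rewrite -szf Df size_prod_XsubC.
have rroot x : x \in r -> root f x by rewrite Df root_prod_XsubC.
have /choice[g Hg] : forall x, exists y, x \in r ->
    on_curve E (Some (x, y)) /\ mulP E n (Some (x, y)) = R.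
  move=> x; have [xr|nx] := boolP (x \in r); last by exists 0.
  by have [y [[h1 h2] _]] := froot _ (rroot x xr); exists y.
exists R, [seq Some (x, g x) | x <- r]; split=> //.
- by rewrite map_inj_uniq// => a b [].
- by rewrite size_map.
by move=> P /mapP[x xr ->]; have [] := Hg x xr.
Qed.

(** A fibre of [n], translated by the opposite of one of its points. *)
Lemma torsion_lower n : (0 < n)%N -> exists s : seq (ecpoint F),
  [/\ uniq s, size s = (n ^ 2)%N & forall P, P \in s -> torsion E n P].
Proof.
move=> n0; have [n1|] := ltnP 1 n; last first.
  move=> n1; have -> : n = 1 by nlia.
  by exists [:: None]; split=> // P; rewrite inE => /eqP->; split.
have [R [s [cR us ss Hs]]] := fibre_mulP n1.
case: s us ss Hs => [|P0 s] us ss Hs.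
  by move/esym/eqP: ss; rewrite /= expn_eq0; lia.
have [cP0 nP0] := Hs P0 (mem_head _ _).
have cN : on_curve E (oppP E P0) by rewrite on_curve_opp.
exists [seq addP E (oppP E P0) Q | Q <- P0 :: s]; split.
- rewrite map_inj_in_uniq// => Q Q' /Hs[cQ _] /Hs[cQ' _] e.
  rewrite -(addPKl nz2 E_nonsing cN cQ) e oppPK.
  by rewrite -{1}[P0](oppPK E) addPKl.
- by rewrite size_map.
move=> _ /mapP[Q /Hs[cQ nQ] ->]; split; first exact: on_curve_add.
rewrite mulP_add// mulP_opp// nP0 nQ.
by rewrite -{2}[R](oppPK E) addPN// on_curve_opp.
Qed.

End Counting.

(** * The order of E[n] and the separability of the division polynomials *)

Section TorsionCount.
Variables (F : closedFieldType) (E : weierstrass F).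
Hypothesis char0 : forall n, (n%:R == 0 :> F) = (n == 0)%N.
Hypothesis E_nonsing : nonsingular (two_tors_poly E).

Local Notation B := (two_tors_poly E).
Local Notation d := (dpoly E).
Let nz2 : 2 != 0 :> F. Proof. by rewrite char0. Qed.

Lemma two_torsionP x y : on_curve E (Some (x, y)) ->
  (mulP E 2 (Some (x, y)) = None) <-> (twoY E x y = 0).
Proof.
move=> cP; rewrite (mulP_eq_None char0 E_nonsing cP)//.
by rewrite /dval hornerC mul1r.
Qed.

Lemma odd_torsion_twoY n x y : odd n -> on_curve E (Some (x, y)) ->
  mulP E n (Some (x, y)) = None -> twoY E x y != 0.
Proof.
move=> on cP nP; apply/eqP => t0.
have h2 : mulP E 2 (Some (x, y)) = None by apply/two_torsionP.
have n1 : mulP E n.-1 (Some (x, y)) = None.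
  apply: (mulP_dvd nz2 E_nonsing cP _ h2); case: n on {nP} => //= n on.
  by rewrite dvdn2.
by move: nP; case: n on n1 => // n _ n1; rewrite mulPS n1.
Qed.

Lemma torsion_x n x y : (0 < n)%N -> on_curve E (Some (x, y)) ->
  (mulP E n (Some (x, y)) = None) <->
  (root (d n) x || ~~ odd n && root B x).
Proof.
move=> n0 cP; rewrite (mulP_eq_None char0 E_nonsing cP)//.
have tB := twoY_sqr char0 cP; rewrite /root /dval horner_two_tors -tB expf_eq0 /=.
by case: (odd n) => /=; rewrite ?expr0 ?expr1 ?mulr1 ?orbF -?mulf_eq0;
  split => /eqP.
Qed.

(** Every point of E[n] is at infinity, over a root of B if n is even, or one of two points over a
    root of [dpoly] that is not a root of B. As n^2 is 1 or 4 plus twice the degree of [dpoly], the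
    lower bound n^2 leaves no room for a repeated root or one shared with B. *)
Lemma torsion_count n : (0 < n)%N ->
  exists rs : seq F, [/\ uniq rs,
    d n = lead_coef (d n) *: \prod_(x <- rs) ('X - x%:P),
    forall x, x \in rs -> B.[x] != 0,
    finite_set (torsion E n) & #|` torsion_fset E n| = (n ^ 2)%N].
Proof.
move=> n0; have nzd := dpoly_neq0 E char0 n0.
have nzB := two_tors_poly_neq0 E char0.
have [r Dr] := closed_field_poly_normal (d n).
have [Z DZ] := closed_field_poly_normal B.
have szr : size r = dpoly_deg n.
  apply: succn_inj; rewrite -(size_dpoly E char0 n0) Dr size_scale ?lead_coef_eq0//.
  by rewrite size_prod_XsubC.
have szZ : size Z = 3.
  apply: succn_inj; rewrite -(size_two_tors_poly E nz2) DZ.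
  by rewrite size_scale ?lead_coef_eq0// size_prod_XsubC.
have rr x : (x \in r) = root (d n) x.
  by rewrite Dr rootZ ?lead_coef_eq0// root_prod_XsubC.
have rZ x : (x \in Z) = root B x.
  by rewrite DZ rootZ ?lead_coef_eq0// root_prod_XsubC.
pose rs := undup [seq x <- r | B.[x] != 0].
have /choice[g Hg] := exists_over E.
pose pts := None :: (if odd n then [::] else [seq Some (x, g x) | x <- Z])
  ++ [seq Some (x, g x) | x <- rs] ++ [seq oppP E (Some (x, g x)) | x <- rs].
have tors_pts P : torsion E n P -> P \in pts.
  case: P => [[x y]|]; last by rewrite inE.
  move=> [cP nP]; rewrite inE /= !mem_cat.
  have xg : Some (x, y) = Some (x, g x) \/ Some (x, y) = oppP E (Some (x, g x)).
    exact: oppP_eq_X.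
  have [t0|nzt] := eqVneq (twoY E x y) 0.
    have oddF : odd n = false.
      by apply: contraTF isT => on; have := odd_torsion_twoY on cP nP; rewrite t0 eqxx.
    rewrite oddF; apply/orP; left; apply/mapP; exists x.
      by rewrite rZ /root horner_two_tors -(twoY_sqr char0 cP) t0 expr0n.
    case: xg => // e; have := congr1 (oppP E) e; rewrite oppPK => <-.
    by apply/esym/eqP; rewrite oppP_eq_twoY// t0.
  have Bx : B.[x] != 0 by rewrite horner_two_tors -(twoY_sqr char0 cP) expf_neq0.
  have xrs : x \in rs.
    rewrite mem_undup mem_filter Bx rr /=; move: nP.
    by rewrite (torsion_x n0 cP) /= [root B x]/root (negPf Bx) andbF orbF.
  by case: xg => ->; apply/orP; right; apply/orP; [left|right]; apply/mapP; exists x.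
have [s [us ss Hs]] := torsion_lower char0 E_nonsing n0.
have spts : {subset s <= pts} by move=> P /Hs/tors_pts.
have szpts : size pts = ((if odd n then 1 else 4) + (size rs).*2)%N.
  by rewrite /= !size_cat !size_map; case: (odd n); rewrite ?size_map ?szZ /=; lia.
have rsr : (size rs <= size r)%N.
  by rewrite (leq_trans (size_undup _))// size_filter count_size.
have deg : (n ^ 2 = (if odd n then 1 else 4) + (dpoly_deg n).*2)%N.
  have [j [->|->]] := parityP n0; rewrite ?dpoly_deg_odd ?dpoly_deg_even /=;
    by rewrite ?odd_double -?mul2n /=; clear; nia.
have lepts := uniq_leq_size us spts; rewrite ss in lepts.
have szrs : size rs = size r.
  by move: lepts rsr; rewrite szpts deg szr; clear; case: (odd n); lia.
have fr : [seq x <- r | B.[x] != 0] = r.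
  apply/all_filterP; rewrite all_count -size_filter eqn_leq.
  by rewrite {1}size_filter count_size -szrs size_undup.
have ur : uniq r.
  have := szrs; rewrite /rs fr => e; apply: contraFT (ltnn (size r)).
  by rewrite -ltn_size_undup e.
have fin : finite_set (torsion E n).
  by apply: (sub_finite_set _ (finite_seq pts)) => P /tors_pts.
exists r; split=> //.
  by move=> x; rewrite -{1}fr mem_filter => /andP[].
have mT P : (P \in torsion_fset E n) = `[< torsion E n P >].
  by rewrite in_fset_set// unfold_in.
have szp : size pts = (n ^ 2)%N.
  by apply/eqP; rewrite eqn_leq lepts andbT szpts deg szrs szr.
have cs (q : seq (ecpoint F)) : #|` [fset P in q]%fset| = size (undup q).
  by rewrite card_fseq.
have iq (q : seq (ecpoint F)) P : (P \in [fset P in q]%fset) = (P \in q).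
  by rewrite !inE.
apply/eqP; rewrite eqn_leq; apply/andP; split.
  rewrite -szp (leq_trans _ (size_undup _))// -cs; apply: fsubset_leq_card.
  by apply/fsubsetP => P; rewrite mT iq => /asboolP/tors_pts.
rewrite -{1}ss -(undup_id us) -cs; apply: fsubset_leq_card.
by apply/fsubsetP => P; rewrite mT iq => /Hs/asboolP.
Qed.

Lemma mem_torsion_fset n P : (0 < n)%N ->
  (P \in torsion_fset E n) = `[< torsion E n P >].
Proof.
by move=> n0; have [rs [_ _ _ fin _]] := torsion_count n0;
  rewrite in_fset_set// unfold_in.
Qed.

End TorsionCount.

Section Homocyclic.
Local Open Scope group_scope.

(** The counts give G order n^2 and exponent n, so an element x of order n splits off with a
    complement H of order n. If f is the exponent of H, then H and x^(n/f) generate f n elements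
    killed by f, of which there are f^2. Hence f = n and H is cyclic. *)
Lemma homocyclic_rank2 (gT : finGroupType) (G : {group gT}) n :
    abelian G -> (0 < n)%N -> {in G, forall x, x ^+ n = 1} ->
    (forall d, (d %| n)%N -> #|[set x in G | x ^+ d == 1]| = (d ^ 2)%N) ->
  exists e1 e2, [/\ e1 \in G, e2 \in G,
    forall g, g \in G -> exists i j, g = e1 ^+ i * e2 ^+ j
  & forall i j, e1 ^+ i * e2 ^+ j = 1 -> (n %| i)%N && (n %| j)%N].
Proof.
move=> abG n0 Gn Gd.
have card_exp (H : {group gT}) : H \subset G -> (exponent H %| n)%N.
  by move=> sHG; apply/exponentP => x /(fintype.subsetP sHG)/Gn.
have cG : #|G| = (n ^ 2)%N.
  by rewrite -(Gd n)//; apply: eq_card => x; rewrite !inE; case: (boolP (x \in G)) => //= /Gn->; rewrite eqxx.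
have expG : exponent G = n.
  apply/eqP; rewrite -(@eqn_exp2r _ _ 2)// -cG -Gd ?card_exp//.
  apply/eqP/eq_card => x; rewrite !inE; case: (boolP (x \in G)) => //= xG.
  by rewrite expg_exponent ?eqxx.
have [H /(_ abG)[x ox defG]] := abelian_type_subproof G.
rewrite expG in ox; have [_ mulG cHx tiHx] := dprodP defG.
have sxG : <[x]> \subset G by rewrite -mulG mulG_subl.
have sHG : H \subset G by rewrite -mulG mulG_subr.
have xG : x \in G by rewrite -cycle_subG.
have cH : #|H| = n.
  have := cG; rewrite -(dprod_card defG) -[#|<[x]>|]/#[x] ox.
  by rewrite -mulnn => /eqP; rewrite eqn_pmul2l// => /eqP.
pose f := exponent H; have fn : (f %| n)%N by apply: card_exp.
have f0 : (0 < f)%N by apply: exponent_gt0.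
have nf : (n <= f)%N.
  rewrite -(leq_pmul2l f0) mulnn -Gd// -{1}cH.
  have oxf : #[x ^+ (n %/ f)] = f.
    rewrite orderXdiv ?ox; last by rewrite -{2}(divnK fn) dvdn_mulr.
    by rewrite -{1}(divnK fn) mulKn// divn_gt0// dvdn_leq.
  rewrite -{1}oxf -[#[_]]/#|<[_]>| -TI_cardMg; last first.
    by apply/trivgP; rewrite -tiHx finset.setSI// cycle_subG mem_cycle.
  apply: subset_leq_card; apply/fintype.subsetP => _ /mulsgP[a h /cycleP[k ->] hH ->].
  have hG := fintype.subsetP sHG h hH.
  rewrite inE groupM ?groupX//= expgMn; last first.
    by apply: (centsP abG) => //; rewrite !groupX.
  have -> : x ^+ (n %/ f) ^+ k ^+ f = 1.
    by rewrite -expgM mulnC expgM -[x ^+ _ ^+ f]expgM divnK// -ox expg_order expg1n.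
  rewrite mul1g.
  by rewrite expg_exponent ?eqxx.
have {nf} fE : f = n by apply/eqP; rewrite eqn_leq nf dvdn_leq.
have [y yH oy] := exponent_witness (abelian_nil (abelianS sHG abG)).
have defH : <[y]> = H.
  by apply/eqP; rewrite eqEcard cycle_subG yH cH -[#|<[y]>|]/#[y] -oy -/f fE leqnn.
exists x, y; split=> //; first exact: (fintype.subsetP sHG).
  move=> g; rewrite -mulG -defH => /mulsgP[_ _ /cycleP[i ->] /cycleP[j ->] ->].
  by exists i, j.
move=> i j xy1.
have xi : x ^+ i = 1.
  apply/set1gP; rewrite -tiHx inE mem_cycle /=.
  by have /eqP := xy1; rewrite -eq_invg_mul -groupV => /eqP ->; rewrite groupX.
rewrite xi mul1g in xy1.
by rewrite -ox order_dvdn xi eqxx /= ox -fE /f oy order_dvdn xy1 eqxx.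
Qed.

End Homocyclic.

Section TorsionBasis.
Variables (F : closedFieldType) (E : weierstrass F).
Hypothesis char0 : forall n, (n%:R == 0 :> F) = (n == 0)%N.
Hypothesis E_nonsing : nonsingular (two_tors_poly E).
Variable n : nat.
Hypothesis n_gt0 : (0 < n)%N.

Let nz2 : 2 != 0 :> F. Proof. by rewrite char0. Qed.
Local Notation T := (torsion_fset E n).

Lemma torsion_fsetP P : reflect (torsion E n P) (P \in T).
Proof. by rewrite mem_torsion_fset//; apply: asboolP. Qed.

Lemma torsion_add P Q : torsion E n P -> torsion E n Q -> torsion E n (addP E P Q).
Proof.
by move=> [cP nP] [cQ nQ]; split; [apply: on_curve_add | rewrite mulP_add// nP nQ].
Qed.

Lemma torsion_opp P : torsion E n P -> torsion E n (oppP E P).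
Proof. by move=> [cP nP]; split; rewrite ?on_curve_opp ?mulP_opp// nP. Qed.

Lemma torsion_mul k P : torsion E n P -> torsion E n (mulP E k P).
Proof.
move=> tP; elim: k => [|k IH]; last exact: torsion_add.
by split=> //; apply: mulP_None.
Qed.

Lemma torsion_basis : exists e1 e2, [/\ torsion E n e1, torsion E n e2,
    forall P, torsion E n P -> exists i j, P = addP E (mulP E i e1) (mulP E j e2)
  & forall i j, addP E (mulP E i e1) (mulP E j e2) = None ->
      (n %| i)%N && (n %| j)%N].
Proof.
have tT (P : T) : torsion E n (val P) by apply/torsion_fsetP/valP.
have inT P : torsion E n P -> P \in T by move/torsion_fsetP.
have addT (P Q : T) : addP E (val P) (val Q) \in T by apply/inT/torsion_add.
have oppT (P : T) : oppP E (val P) \in T by apply/inT/torsion_opp.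
have noneT : None \in T by apply/inT; split; [|apply: mulP_None].
pose mulT (P Q : T) : T := [` addT P Q]%fset.
pose invT (P : T) : T := [` oppT P]%fset.
pose oneT : T := [` noneT]%fset.
have cT (P : T) : on_curve E (val P) by have [] := tT P.
have mulTA : associative mulT by move=> P Q R; apply/val_inj/addPA.
have mulT1 : left_id oneT mulT by move=> P; apply/val_inj.
have mulTV : left_inverse oneT invT mulT.
  move=> P; apply/val_inj; rewrite /= -{2}[fsval P](oppPK E) addPN//.
  by rewrite on_curve_opp//; apply: cT.
pose gT : finGroupType := HB.pack (fset_sub_type T)
  (Finite_isGroup.Build (fset_sub_type T) mulTA mulT1 mulTV).
have valX (x : gT) k : val (x ^+ k)%g = mulP E k (val x).
  by elim: k => // k IH; rewrite expgS mulPS -IH.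
have card_d d : (d %| n)%N -> #|[set x in [set: gT] | x ^+ d == 1]%g| = (d ^ 2)%N.
  move=> dn; have d0 : (0 < d)%N by apply: dvdn_gt0 dn.
  have [rs [_ _ _ _ <-]] := torsion_count char0 E_nonsing d0.
  rewrite cardE -(size_map val).
  apply/perm_size/uniq_perm; rewrite ?fset_uniq ?map_inj_uniq ?enum_uniq//.
    exact: val_inj.
  move=> P; rewrite -[RHS]/(P \in torsion_fset E d) mem_torsion_fset//.
  apply/mapP/asboolP => [[x]|[cP dP]].
    rewrite mem_enum !inE /= => /eqP x1 ->; split; first exact: cT.
    by rewrite -valX x1.
  have tP : torsion E n P by split=> //; apply: (mulP_dvd nz2 E_nonsing cP dn).
  exists [` inT P tP]%fset => //; rewrite mem_enum !inE /=.
  by apply/eqP/val_inj; rewrite valX /= dP.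
have abT : abelian [set: gT].
  apply/centsP => P _ Q _; apply/val_inj; exact: addPC.
have xn : {in [set: gT], forall x, x ^+ n = 1}%g.
  by move=> x _; apply/val_inj; rewrite valX; have [] := tT x.
have [e1 [e2 [_ _ gen free]]] := homocyclic_rank2 abT n_gt0 xn card_d.
exists (val e1), (val e2); split=> //.
  move=> P tP; have [i [j e]] := gen [` inT P tP]%fset (finset.in_setT _).
  by exists i, j; rewrite -!valX; apply: (congr1 val e).
move=> i j e0; apply: free; apply/val_inj; rewrite -[RHS]e0 -!valX.
by [].
Qed.

End TorsionBasis.

(** In the main case s is the part of n prime to g: a prime factor of n divides exactly one of g and
    s, and if it divides g it does not divide d. *)
Lemma coprime_lift g d n : (0 < n)%N -> coprime g d ->
  exists s, coprime (g + d * s) n.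
Proof.
move=> n0 gd; have [d0|d_gt0] := posnP d.
  by exists 0; move: gd; rewrite d0 /coprime gcdn0 => /eqP->; rewrite gcd1n.
have [g0|g_gt0] := posnP g.
  by exists 1; move: gd; rewrite g0 /coprime gcd0n => /eqP->; rewrite gcd1n.
pose s := (n`_(\pi(g)^'))%N; exists s; rewrite coprime_has_primes//; last first.
  by rewrite addn_gt0 g_gt0.
apply/hasPn => p; rewrite mem_primes => /and3P[pp _ pn].
have ps : (p %| s)%N = ~~ (p %| g)%N.
  have : (p \in primes s) = ~~ (p %| g)%N.
    rewrite primes_part mem_filter (mem_primes p n) pp n0 pn !andbT.
    by rewrite -[LHS]/(p \notin primes g) mem_primes pp g_gt0.
  by rewrite mem_primes pp part_gt0.
rewrite /= mem_primes pp addn_gt0 g_gt0 /=.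
have [pg|npg] := boolP (p %| g)%N; last first.
  by rewrite addnC dvdn_addr// dvdn_mull// ps.
rewrite dvdn_addr// Euclid_dvdM// ps pg /= orbF.
apply: contraL gd => pd; rewrite /coprime; apply: contraL pp => /eqP g1.
have : (p %| gcdn g d)%N by rewrite dvdn_gcd pg.
by rewrite g1 dvdn1 => /eqP->.
Qed.

Section ExactOrder.
Variables (F : closedFieldType) (E : weierstrass F).
Hypothesis char0 : forall n, (n%:R == 0 :> F) = (n == 0)%N.
Hypothesis E_nonsing : nonsingular (two_tors_poly E).
Let nz2 : 2 != 0 :> F. Proof. by rewrite char0. Qed.

Lemma exact_orderP n P : (0 < n)%N ->
  exact_order E n P <->
  torsion E n P /\ forall k, mulP E k P = None -> (n %| k)%N.
Proof.
move=> n0; split=> [[cP nP mP]|[[cP nP] kP]]; last first.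
  split=> // m /andP[m0 mn] /kP; rewrite gtnNdvd//.
split=> // k kP; rewrite /dvdn -[_ == _]negbK -lt0n; apply/negP => k0.
apply: (mP (k %% n)%N); first by rewrite k0 ltn_pmod.
move: kP; rewrite {1}(divn_eq k n) mulPD// mulPM// nP mulP_None.
by case: (mulP E _ P) => [[]|].
Qed.

Lemma exact_order_torsion n P : exact_order E n P -> torsion E n P.
Proof. by case. Qed.

Lemma exact_order_exists n P : (0 < n)%N -> torsion E n P ->
  exists2 d, (d %| n)%N & exact_order E d P.
Proof.
move=> n0 [cP nP].
have ex : exists k, (0 < k)%N && (mulP E k P == None) by exists n; rewrite n0 nP eqxx.
case: (ex_minnP ex) => d /andP[d0 /eqP dP] dmin.
have eo : exact_order E d P.
  split=> // m /andP[m0 md] mP; have := dmin m; rewrite m0 mP eqxx => /(_ isT).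
  by rewrite leqNgt md.
by exists d => //; apply: (proj2 (proj1 (exact_orderP P d0) eo)).
Qed.

Variable n : nat.
Hypothesis n_gt0 : (0 < n)%N.
Local Notation comb e1 e2 i j := (addP E (mulP E i e1) (mulP E j e2)).

Section Basis.
Variables e1 e2 : ecpoint F.
Hypotheses (te1 : torsion E n e1) (te2 : torsion E n e2).
Hypothesis gen : forall P, torsion E n P -> exists i j, P = comb e1 e2 i j.
Hypothesis free : forall i j, comb e1 e2 i j = None -> (n %| i)%N && (n %| j)%N.

Let c1 : on_curve E e1. Proof. by case: te1. Qed.
Let c2 : on_curve E e2. Proof. by case: te2. Qed.

Lemma torsion_comb i j : torsion E n (comb e1 e2 i j).
Proof. by apply: torsion_add => //; apply: torsion_mul. Qed.

Lemma mulP_comb k i j :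
  mulP E k (comb e1 e2 i j) = comb e1 e2 (k * i) (k * j).
Proof. by rewrite mulP_add ?on_curve_mulP// !mulPM. Qed.

Lemma mulP_mod k P : torsion E n P -> mulP E k P = mulP E (k %% n) P.
Proof.
move=> [cP nP]; rewrite {1}(divn_eq k n) mulPD// mulPM// nP mulP_None.
by case: (mulP E _ P) => [[]|].
Qed.

Lemma comb_mod i j i' j' : i = i' %[mod n] -> j = j' %[mod n] ->
  comb e1 e2 i j = comb e1 e2 i' j'.
Proof.
by move=> ei ej; rewrite (mulP_mod i te1) (mulP_mod j te2) ei ej -!mulP_mod.
Qed.

Lemma exact_order_comb i j : coprime i j -> exact_order E n (comb e1 e2 i j).
Proof.
move=> cij; apply/exact_orderP => //; split=> [|k]; first exact: torsion_comb.
rewrite mulP_comb => /free/andP[ni nj].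
have := dvdn_gcd n (k * i) (k * j); rewrite ni nj -muln_gcdr.
by move: cij; rewrite /coprime => /eqP->; rewrite muln1.
Qed.

(** R = [n/d](i' e1 + j' e2), and the exact order d makes gcd(i', j') prime to d. Changing this gcd
    by a multiple of d does not affect R and can make it prime to n. *)
Lemma divide_exact_order d R : (1 < d)%N -> (d %| n)%N -> exact_order E d R ->
  exists2 W, exact_order E n W & R = mulP E (n %/ d) W.
Proof.
move=> d1 dn oR; have d0 := ltnW d1; have [[cR dR] kR] := proj1 (exact_orderP R d0) oR.
have tR : torsion E n R by split=> //; apply: (mulP_dvd nz2 E_nonsing cR dn).
have [i [j Rij]] := gen tR; pose q := (n %/ d)%N.
have Dn : n = (q * d)%N by rewrite divnK.
have q0 : (0 < q)%N by rewrite divn_gt0// dvdn_leq.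
have := dR; rewrite Rij mulP_comb => /free; rewrite {1 2}Dn !(mulnC d).
rewrite !dvdn_pmul2r// => /andP[/dvdnP[i' Di] /dvdnP[j' Dj]].
have cop : coprime (gcdn i' j') d.
  rewrite coprime_sym; apply/negPn/negP => ncop.
  have g1 : (1 < gcdn d (gcdn i' j'))%N.
    by rewrite ltn_neqAle eq_sym ncop gcdn_gt0 d0.
  have [g Dg] : exists g, g = gcdn d (gcdn i' j') by exists (gcdn d (gcdn i' j')).
  rewrite -Dg in g1.
  have gd : (g %| d)%N by rewrite Dg dvdn_gcdl.
  have gi : (g %| i')%N by rewrite Dg (dvdn_trans (dvdn_gcdr _ _))// dvdn_gcdl.
  have gj : (g %| j')%N by rewrite Dg (dvdn_trans (dvdn_gcdr _ _))// dvdn_gcdr.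
  have h k : (g %| k)%N -> (d %/ g * (k * q) = 0 %[mod n])%N.
    move=> /dvdnP[k' ->]; apply/eqP; rewrite mod0n -/(dvdn _ _) Dn.
    have -> : (d %/ g * (k' * g * q) = k' * (q * (d %/ g * g)))%N by ring.
    by rewrite divnK// dvdn_mull.
  have : mulP E (d %/ g) R = None.
    by rewrite Rij mulP_comb Di Dj (comb_mod (h _ gi) (h _ gj)).
  have dg0 : (0 < d %/ g)%N by rewrite divn_gt0 ?(ltnW g1)// dvdn_leq.
  by move/kR/(dvdn_leq dg0); rewrite leqNgt ltn_Pdiv.
have g0 : (0 < gcdn i' j')%N.
  rewrite lt0n; apply/eqP => g0; move: cop; rewrite g0 /coprime gcd0n => /eqP d1'.
  by move: d1; rewrite d1'.
have [g Dg] : exists g, g = gcdn i' j' by exists (gcdn i' j').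
rewrite -Dg in cop g0.
have [s cs] := coprime_lift n_gt0 cop.
pose i2 := (i' %/ g)%N; pose j2 := (j' %/ g)%N.
have Di2 : i' = (i2 * g)%N by rewrite divnK// Dg dvdn_gcdl.
have Dj2 : j' = (j2 * g)%N by rewrite divnK// Dg dvdn_gcdr.
have cij : coprime i2 j2.
  by rewrite /coprime -(eqn_pmul2r g0) muln_gcdl -Di2 -Dj2 mul1n Dg eqxx.
exists (comb e1 e2 ((g + d * s) * i2) ((g + d * s) * j2)).
  apply/exact_orderP => //; split=> [|k]; first exact: torsion_comb.
  rewrite coprime_sym in cs.
  rewrite mulP_comb => /free; rewrite !(mulnCA k) !(Gauss_dvdr _ cs).
  move=> /andP[ni nj]; have := dvdn_gcd n (k * i2) (k * j2).
  by rewrite ni nj -muln_gcdr; move: cij; rewrite /coprime => /eqP->; rewrite muln1.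
rewrite mulP_comb -/q Di Dj Di2 Dj2; apply: comb_mod.
  have -> : (q * ((g + d * s) * i2) = s * i2 * (q * d) + i2 * g * q)%N by ring.
  by rewrite -Dn modnMDl.
have -> : (q * ((g + d * s) * j2) = s * j2 * (q * d) + j2 * g * q)%N by ring.
by rewrite -Dn modnMDl.
Qed.

(** The points e1, e2 and e1 + e2 all have exact order n. Different signs at e1 and e2 would,
    whatever the sign at the sum, make e1 or e2 its own opposite, which n > 2 forbids. *)
Lemma pm_endomorphism (sg : ecpoint F -> ecpoint F) : (2 < n)%N ->
    (forall P Q, sg (addP E P Q) = addP E (sg P) (sg Q)) -> sg None = None ->
    (forall P, exact_order E n P -> sg P = P \/ sg P = oppP E P) ->
  (forall P, torsion E n P -> sg P = P)
  \/ (forall P, torsion E n P -> sg P = oppP E P).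
Proof.
move=> n2 sgD sg0 pm.
have sgM k P : sg (mulP E k P) = mulP E k (sg P).
  by elim: k => // k IH; rewrite !mulPS sgD IH.
have add0 P : addP E P None = P by case: P => [[]|].
have mul1 P : mulP E 1 P = P by exact: add0.
have o1 : exact_order E n e1.
  by have := exact_order_comb (coprime1n 0); rewrite -[mulP E 0 _]/None add0 mul1.
have o2 : exact_order E n e2 by have := exact_order_comb (coprimen1 0); rewrite mul1.
have o12 : exact_order E n (addP E e1 e2).
  by have := exact_order_comb (coprime1n 1); rewrite !mul1.
have not2 P : exact_order E n P -> oppP E P <> P.
  move=> oP eP; have [[cP _] kP] := proj1 (exact_orderP P n_gt0) oP.
  have : mulP E 2 P = None by rewrite mulPS mul1 -{1}eP -{2}[P](oppPK E) addPN// on_curve_opp.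
  by move/kP/dvdn_leq => /(_ isT); rewrite leqNgt n2.
have cN1 : on_curve E (oppP E e1) by rewrite on_curve_opp.
have cN2 : on_curve E (oppP E e2) by rewrite on_curve_opp.
have cancel A C D : on_curve E A -> on_curve E C -> on_curve E D ->
    addP E A C = addP E A D -> C = D.
  by move=> cA cC cD e; rewrite -(addPKl nz2 E_nonsing cA cC) e addPKl.
have pm12 := pm _ o12; rewrite sgD oppP_add// in pm12.
have [s1|s1] := pm _ o1; have [s2|s2] := pm _ o2; rewrite s1 s2 in pm12.
- by left=> P /gen[i [j ->]]; rewrite sgD !sgM s1 s2.
- exfalso; case: pm12 => h.
    by apply: (not2 _ o2); apply: (cancel _ _ _ c1 cN2 c2 h).
  apply: (not2 _ o1); apply/esym; rewrite addPC// [RHS]addPC// in h.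
  exact: (cancel _ _ _ cN2 c1 cN1 h).
- exfalso; case: pm12 => h.
    apply: (not2 _ o1); rewrite addPC// [RHS]addPC// in h.
    exact: (cancel _ _ _ c2 cN1 c1 h).
  by apply: (not2 _ o2); apply/esym; apply: (cancel _ _ _ cN1 c2 cN2 h).
right=> P /gen[i [j ->]]; rewrite sgD !sgM s1 s2 oppP_add ?on_curve_mulP//.
by rewrite !mulP_opp.
Qed.

End Basis.
End ExactOrder.

(** * The absolute Galois group *)

Section Subfields.
Variables (M : fieldType) (S : divringClosed M).

Inductive subfield_of : Type := SubfieldOf x & x \in S.
Definition subfield_val u := let: SubfieldOf x _ := u in x.

HB.instance Definition _ := [isSub for subfield_val].
HB.instance Definition _ := [Choice of subfield_of by <:].
HB.instance Definition _ := [SubChoice_isSubComUnitRing of subfield_of by <:].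
HB.instance Definition _ := [SubComUnitRing_isSubIntegralDomain of subfield_of by <:].
HB.instance Definition _ := [SubIntegralDomain_isSubField of subfield_of by <:].

End Subfields.

Section SimpleExtension.
Variables (K M C : fieldType) (i : {rmorphism K -> M}) (f : {rmorphism K -> C}).
Variable x : M.
Hypothesis x_alg : integralOver i x.

Local Notation "p ^i" := (map_poly i p) (at level 1, format "p ^i").
Local Notation "p ^f" := (map_poly f p).

Lemma min_poly_exists : exists p : {poly K}, [/\ p != 0, root p^i x &
  forall q, root q^i x = (p %| q)].
Proof.
pose P n := `[< exists p : {poly K}, [/\ p != 0, root p^i x & size p = n] >].
have ex : exists n, P n.
  have [p mp px] := x_alg; exists (size p); apply/asboolP; exists p.
  by rewrite monic_neq0.
case: (ex_minnP ex) => n /asboolP[p [nzp px <-]] pmin; exists p; split=> // q.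
apply/idP/idP => [qx|/dvdpP[r ->]]; last by rewrite rmorphM /= rootM px orbT.
rewrite /dvdp; apply: contraT => nzr.
have rx : root (q %% p)^i x.
  move: qx; rewrite {1}(divp_eq q p) rmorphD rmorphM /= /root !hornerE.
  by rewrite (rootP px) mulr0 add0r.
have /pmin : P (size (q %% p)) by apply/asboolP; exists (q %% p).
by rewrite leqNgt ltn_modp nzp.
Qed.

Variables (p : {poly K}) (y : C).
Hypotheses (px : forall q, root q^i x = (p %| q)) (py : root p^f y).

Definition adjoin_pred : {pred M} := [pred z | `[< exists q : {poly K}, z = q^i.[x] >]].

Lemma adjoin_coprime q : p != 0 -> q^i.[x] != 0 ->
  exists u v, u * p + v * q = 1.
Proof.
move=> nzp qx; suff : coprimep p q.
  move/Bezout_eq1_coprimepP => [[u v] /= e]; exists u, v.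
  by rewrite e.
apply/coprimepP => d dp dq; have /dvdpP[e Dp] := dp.
have dx : ~~ root d^i x.
  have /dvdpP[q' Dq] := dq; apply: contraNN qx => /rootP dx.
  by rewrite Dq rmorphM hornerM dx mulr0.
have : root p^i x by rewrite px.
rewrite Dp rmorphM rootM (negPf dx) orbF px => pe.
have nze : e != 0 by apply: contraNneq nzp => e0; rewrite Dp e0 mul0r.
have nzd : d != 0 by apply: contraNneq nzp => d0; rewrite Dp d0 mulr0.
have := dvdp_leq nze pe; rewrite Dp size_mul// => le.
rewrite -size_poly_eq1 eqn_leq size_poly_gt0 nzd andbT.
have : (0 < size e)%N by rewrite size_poly_gt0.
by move: le; move: (size e) (size d) => a b; lia.
Qed.

Lemma adjoin_divring : p != 0 -> divring_closed adjoin_pred.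
Proof.
move=> nzp; split.
- by apply/asboolP; exists 1; rewrite rmorph1 hornerC.
- move=> _ _ /asboolP[q ->] /asboolP[r ->]; apply/asboolP; exists (q - r).
  by rewrite rmorphB hornerD hornerN.
move=> _ _ /asboolP[q ->] /asboolP[r ->]; apply/asboolP.
have [r0|nzr] := eqVneq r^i.[x] 0.
  by exists 0; rewrite r0 invr0 mulr0 rmorph0 horner0.
have [u [v e]] := adjoin_coprime nzp nzr.
exists (q * v); rewrite rmorphM hornerM; congr (_ * _).
have := congr1 (fun w => w^i.[x]) e; rewrite rmorphD !rmorphM hornerD !hornerM rmorph1 hornerC.
have /rootP -> : root p^i x by rewrite px.
by rewrite mulr0 add0r => h; apply: (mulIf nzr); rewrite mulVf.
Qed.

Lemma adjoin_eval q r : q^i.[x] = r^i.[x] -> q^f.[y] = r^f.[y].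
Proof.
move=> e; have : root (q - r)^i x by rewrite /root rmorphB hornerD hornerN e subrr.
rewrite px => /dvdpP[w Dw].
apply/eqP; rewrite -subr_eq0 -hornerN -hornerD -rmorphB Dw rmorphM hornerM.
by rewrite (rootP py) mulr0.
Qed.

(** S is K[x], and g sends q(x) to q(y): this is well defined since p divides every polynomial
    vanishing at x. *)
Lemma simple_extension : p != 0 -> exists (S : divringClosed M)
    (g : {rmorphism subfield_of S -> C}),
  [/\ x \in S, forall a, i a \in S, forall u a, val u = i a -> g u = f a
    & forall u, val u = x -> g u = y].
Proof.
move=> nzp; have dcl := adjoin_divring nzp.
pose S : divringClosed M := HB.pack adjoin_pred
  (GRing.isDivringClosed.Build M adjoin_pred dcl).
have SP z : z \in S -> exists q : {poly K}, z = q^i.[x] by move/asboolP.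
pose q_ (u : subfield_of S) : {poly K} := xget 0 [set q | val u = q^i.[x]]%classic.
have qP u : val u = (q_ u)^i.[x].
  rewrite /q_; case: xgetP => [q _ //|none].
  by have [q qu] := SP _ (valP u); case: (none q).
pose g0 (u : subfield_of S) : C := (q_ u)^f.[y].
have g0E u q : val u = q^i.[x] -> g0 u = q^f.[y].
  by move=> uq; apply: adjoin_eval; rewrite -qP.
have gB : zmod_morphism g0.
  move=> u v; have e : val (u - v) = (q_ u - q_ v)^i.[x].
    by rewrite (rmorphB (map_poly i)) hornerD hornerN -!qP.
  by rewrite (g0E _ _ e) (rmorphB (map_poly f)) hornerD hornerN.
have gM : monoid_morphism g0.
  split.
    have e : val (1 : subfield_of S) = (1 : {poly K})^i.[x].
      by rewrite (rmorph1 (map_poly i)) hornerC.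
    by rewrite (g0E _ _ e) (rmorph1 (map_poly f)) hornerC.
  move=> u v; have e : val (u * v) = (q_ u * q_ v)^i.[x].
    by rewrite (rmorphM (map_poly i)) hornerM -!qP.
  by rewrite (g0E _ _ e) (rmorphM (map_poly f)) hornerM.
pose g : {rmorphism subfield_of S -> C} := HB.pack g0
  (GRing.isZmodMorphism.Build _ _ g0 gB) (GRing.isMonoidMorphism.Build _ _ g0 gM).
exists S, g; split.
- by apply/asboolP; exists 'X; rewrite map_polyX hornerX.
- by move=> a; apply/asboolP; exists a%:P; rewrite map_polyC hornerC.
- by move=> u a ua; rewrite /= (g0E u a%:P) ?map_polyC ?hornerC.
by move=> u ux; rewrite /= (g0E u 'X) ?map_polyX ?hornerX.
Qed.

End SimpleExtension.

Section ExtendEmbedding.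
Variables (L M : fieldType) (C : closedFieldType).
Variables (j1 : {rmorphism L -> M}) (j2 : {rmorphism L -> C}).
Hypothesis j1_int : integralRange j1.

Record partial_emb := PartialEmb {
  pe_dom : divringClosed M;
  pe_fun : {rmorphism subfield_of pe_dom -> C};
  pe_base : forall a, j1 a \in pe_dom;
  pe_ext : forall (u : subfield_of pe_dom) a, val u = j1 a -> pe_fun u = j2 a }.

Definition pe_le (s t : partial_emb) : bool :=
  `[< forall u : subfield_of (pe_dom s), exists v : subfield_of (pe_dom t),
        val v = val u /\ pe_fun t v = pe_fun s u >].

Lemma closed_root_exists (K : fieldType) (f : {rmorphism K -> C}) (p : {poly K}) :
  (1 < size p)%N -> exists y, root (map_poly f p) y.
Proof. by move=> sp; apply/closed_rootP; rewrite size_map_poly; lia. Qed.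

Lemma adjoin_embedding (K : fieldType) (i : {rmorphism K -> M})
    (f : {rmorphism K -> C}) (x : M) : integralOver i x ->
  exists (S : divringClosed M) (g : {rmorphism subfield_of S -> C}),
  [/\ x \in S, forall a, i a \in S & forall u a, val u = i a -> g u = f a].
Proof.
move=> ix; have [p [nzp px pP]] := min_poly_exists ix.
have sp : (1 < size p)%N.
  have := root_size_gt1 _ px; rewrite size_map_poly; apply.
  by rewrite map_poly_eq0.
have [y py] := closed_root_exists f sp.
have [S [g [xS iS gE _]]] := simple_extension pP py nzp.
by exists S, g.
Qed.

Lemma partial_emb_inhabited : exists t : partial_emb, True.
Proof.
have [S [g [_ inS gE]]] := adjoin_embedding j2 (j1_int 0).
by exists (PartialEmb inS gE).
Qed.

Lemma partial_emb_extend (t : partial_emb) x :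
  exists2 t', pe_le t t' & x \in pe_dom t'.
Proof.
case: t => S f inS fE; pose K := subfield_of S.
pose j0 (a : L) : K := SubfieldOf (inS a).
have j0B : zmod_morphism j0 by move=> a b; apply: val_inj; rewrite /= rmorphB.
have j0M : monoid_morphism j0.
  by split=> [|a b]; apply: val_inj; rewrite /= ?rmorph1 ?rmorphM.
pose j : {rmorphism L -> K} := HB.pack j0
  (GRing.isZmodMorphism.Build _ _ j0 j0B) (GRing.isMonoidMorphism.Build _ _ j0 j0M).
have ix : integralOver (val : K -> M) x.
  have [p mp px] := j1_int x; exists (map_poly j p); first by rewrite map_monic.
  by rewrite -map_poly_comp_id0 ?rmorph0.
have [S' [g [xS' inS' gE]]] := @adjoin_embedding K val f x ix.
have base a : j1 a \in S' by apply: (inS' (j a)).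
have ext (u : subfield_of S') a : val u = j1 a -> g u = j2 a.
  by move=> ua; rewrite (gE u (j a))//; apply: fE.
exists (PartialEmb base ext) => //; apply/asboolP => u /=.
by exists (SubfieldOf (inS' u)); split=> //; apply: gE.
Qed.

Lemma chain_bound (A : partial_emb -> Prop) :
    (forall s t, A s -> A t -> pe_le s t \/ pe_le t s) ->
  exists t, forall s, A s -> pe_le s t.
Proof.
move=> totA; have [[t1 At1]|none] := pselect (exists t, A t); last first.
  have [t _] := partial_emb_inhabited; exists t => s As.
  by case: none; exists s.
pose D : {pred M} := [pred z | `[< exists2 t, A t & z \in pe_dom t >]].
have common z w : z \in D -> w \in D -> exists2 t, A t & (z \in pe_dom t) && (w \in pe_dom t).
  move=> /asboolP[t At zt] /asboolP[t' At' wt'].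
  have [/asboolP le|/asboolP le] := totA t t' At At'.
    have [v [vz _]] := le (SubfieldOf zt); exists t' => //.
    by rewrite wt' andbT -[z]/(val (SubfieldOf zt)) -vz (valP v).
  have [v [vw _]] := le (SubfieldOf wt'); exists t => //.
  by rewrite zt -[w]/(val (SubfieldOf wt')) -vw (valP v).
have inD t z : A t -> z \in pe_dom t -> z \in D.
  by move=> At zt; apply/asboolP; exists t.
have Dcl : divring_closed D.
  split; first by apply: (inD t1) => //; apply: rpred1.
    move=> z w zD wD; have [t At /andP[zt wt]] := common z w zD wD.
    by apply: (inD t) => //; apply: rpredB.
  move=> z w zD wD; have [t At /andP[zt wt]] := common z w zD wD.
  by apply: (inD t) => //; apply: rpred_div.
pose S : divringClosed M := HB.pack D (GRing.isDivringClosed.Build M D Dcl).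
have agree t t' (v : subfield_of (pe_dom t)) (v' : subfield_of (pe_dom t')) :
    A t -> A t' -> val v = val v' -> pe_fun t v = pe_fun t' v'.
  move=> At At' vv'; have [/asboolP le|/asboolP le] := totA t t' At At'.
    have [w [wv <-]] := le v; congr (pe_fun t' _).
    by apply: val_inj; rewrite wv.
  have [w [wv <-]] := le v'; congr (pe_fun t _).
  by apply: val_inj; rewrite wv.
have /choice[g0 g0P] : forall u : subfield_of S, exists c : C,
    exists t (v : subfield_of (pe_dom t)), [/\ A t, val v = val u & c = pe_fun t v].
  move=> u; have /asboolP[t At ut] := valP u.
  by exists (pe_fun t (SubfieldOf ut)), t, (SubfieldOf ut).
have g0E u t (v : subfield_of (pe_dom t)) : A t -> val v = val u -> g0 u = pe_fun t v.
  move=> At vu; have [t' [v' [At' v'u ->]]] := g0P u.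
  by apply: agree => //; rewrite v'u vu.
have pair (u w : subfield_of S) : exists t (v v' : subfield_of (pe_dom t)),
    [/\ A t, val v = val u & val v' = val w].
  have [t At /andP[ut wt]] := common _ _ (valP u) (valP w).
  by exists t, (SubfieldOf ut), (SubfieldOf wt).
have gB : zmod_morphism g0.
  move=> u w; have [t [v [v' [At vu v'w]]]] := pair u w.
  rewrite (g0E u t v)// (g0E w t v')// (g0E (u - w) t (v - v'))//.
    by rewrite rmorphB.
  by rewrite !rmorphB /= -vu -v'w.
have gM : monoid_morphism g0.
  split; first by rewrite (g0E 1 t1 1)// rmorph1.
  move=> u w; have [t [v [v' [At vu v'w]]]] := pair u w.
  rewrite (g0E u t v)// (g0E w t v')// (g0E (u * w) t (v * v'))//.
    by rewrite rmorphM.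
  by rewrite !rmorphM /= -vu -v'w.
pose g : {rmorphism subfield_of S -> C} := HB.pack g0
  (GRing.isZmodMorphism.Build _ _ g0 gB) (GRing.isMonoidMorphism.Build _ _ g0 gM).
have base a : j1 a \in S by apply: (inD t1) => //; apply: pe_base.
have ext (u : subfield_of S) a : val u = j1 a -> g u = j2 a.
  move=> ua; rewrite /= (g0E u t1 (SubfieldOf (pe_base t1 a)))//.
  exact: pe_ext.
exists (PartialEmb base ext) => s As; apply/asboolP => u /=.
have uS : val u \in S by apply: (inD s) => //; apply: valP.
by exists (SubfieldOf uS); split=> //; apply: g0E.
Qed.

Definition pe_graph (t : partial_emb) (z : M) : option C :=
  if insub z is Some u then Some (pe_fun t u) else None.

Lemma pe_leE s t : pe_le s t <->
  (forall z c, pe_graph s z = Some c -> pe_graph t z = Some c).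
Proof.
rewrite /pe_graph; split=> [/asboolP le z c|le].
  case: insubP => // u _ uz [<-]; have [v [vu fv]] := le u.
  by rewrite -uz -vu valK fv.
apply/asboolP => u; have := le (val u) (pe_fun s u); rewrite valK => /(_ erefl).
by case: insubP => // v _ vu [<-]; exists v.
Qed.

(* Partial embeddings live in too large a universe for Zorn's lemma, which is
   therefore applied to their graphs. *)
Lemma maximal_partial_emb :
  exists t, forall t', pe_le t t' -> pe_le t' t.
Proof.
pose T := {h : M -> option C | exists t, h = pe_graph t}.
pose R (g h : T) : bool := `[< forall z c, sval g z = Some c -> sval h z = Some c >].
have [t0 _] := partial_emb_inhabited.
have [|||[h hP] tmax] := @ZL_preorder T (exist _ (pe_graph t0) (ex_intro _ t0 erefl)) R.
- by move=> g; apply/asboolP.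
- by move=> g h k /asboolP gh /asboolP hk; apply/asboolP => z c /gh/hk.
- move=> A totA.
  have [|t tP] := @chain_bound (fun t => A (exist _ (pe_graph t) (ex_intro _ t erefl))).
    by move=> s t As At; case: (totA _ _ As At) => /asboolP le; [left|right]; apply/pe_leE.
  exists (exist _ (pe_graph t) (ex_intro _ t erefl)) => -[h hP] Ah.
  case: (hP) => s hs; subst h; apply/asboolP => /=; apply/pe_leE/tP.
  by rewrite (_ : ex_intro _ s erefl = hP)//; apply: Prop_irrelevance.
case: (hP) => t ht; exists t => t' /pe_leE le; subst h.
pose g' : T := exist _ (pe_graph t') (ex_intro _ t' erefl).
have tt' : R (exist _ (pe_graph t) hP) g' by apply/asboolP.
by have /asboolP h := tmax _ tt'; apply/pe_leE.
Qed.

Lemma extend_embedding : exists s : {rmorphism M -> C}, forall a, s (j1 a) = j2 a.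
Proof.
have [t tmax] := maximal_partial_emb.
have all x : x \in pe_dom t.
  have [t' le xt'] := partial_emb_extend t x.
  have /asboolP := tmax t' le; move=> /(_ (SubfieldOf xt'))[v [vx _]].
  by rewrite -[x]/(val (SubfieldOf xt')) -vx (valP v).
pose s0 x : C := pe_fun t (SubfieldOf (all x)).
have sB : zmod_morphism s0.
  by move=> x y; rewrite /s0 -rmorphB; congr (pe_fun t _); apply: val_inj.
have sM : monoid_morphism s0.
  split; first by rewrite /s0 -[RHS](rmorph1 (pe_fun t)); congr (pe_fun t _); apply: val_inj.
  by move=> x y; rewrite /s0 -rmorphM; congr (pe_fun t _); apply: val_inj.
pose s : {rmorphism M -> C} := HB.pack s0
  (GRing.isZmodMorphism.Build _ _ s0 sB) (GRing.isMonoidMorphism.Build _ _ s0 sM).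
exists s => a; exact: pe_ext.
Qed.

End ExtendEmbedding.

Section AbsoluteGalois.
Variables (K : fieldType) (C : closedFieldType) (iota : {rmorphism K -> C}).
Hypothesis iota_int : integralRange iota.
Local Notation G := (absGal iota).

(** Each y is a root of a polynomial over K, and s, being injective, permutes the finite set of its
    roots. *)
Lemma endomorphism_bijective (s : {rmorphism C -> C}) :
  (forall c, s (iota c) = iota c) -> bijective s.
Proof.
move=> sK; have s_inj : injective s by apply: fmorph_inj.
have s_surj y : exists x, s x = y.
  have [p mp py] := iota_int y.
  have nzp : map_poly iota p != 0 by rewrite map_poly_eq0 monic_neq0.
  have [rs0 Dp] := closed_field_poly_normal (map_poly iota p).
  pose rs := undup rs0.
  have rsP x : (x \in rs) = root (map_poly iota p) x.
    by rewrite mem_undup Dp rootZ ?lead_coef_eq0// root_prod_XsubC.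
  have srs : {subset map s rs <= rs}.
    move=> _ /mapP[x + ->]; rewrite !rsP => /(rmorph_root s).
    by rewrite -map_poly_comp (eq_map_poly (g := iota)).
  have us : uniq (map s rs) by rewrite map_inj_uniq ?undup_uniq.
  have := (uniq_min_size us srs); rewrite size_map leqnn => /(_ isT)[_ h].
  have : y \in map s rs by rewrite h rsP.
  by case/mapP=> x _ ->; exists x.
have /choice[g gP] := s_surj.
by exists g => // x; apply: s_inj; rewrite gP.
Qed.

Lemma absGal_of_rmorph (s : {rmorphism C -> C}) :
  (forall c, s (iota c) = iota c) -> exists t : G, forall x, t x = s x.
Proof.
by move=> sK; exists (AbsGal (endomorphism_bijective sK) sK).
Qed.

Lemma absGal_comp (s t : G) : exists u : G, forall x, u x = s (t x).
Proof.
have [|u uE] := @absGal_of_rmorph (s \o t); last by exists u.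
by move=> c; rewrite /= !absGal_fix.
Qed.

Lemma absGal_id : exists u : G, forall x, u x = x.
Proof. by have [|u uE] := @absGal_of_rmorph idfun; last by exists u. Qed.

Lemma absGal_inv (s : G) : exists t : G, (forall x, t (s x) = x) /\ forall x, s (t x) = x.
Proof.
have [g gK Kg] := absGal_bij s; have s_inj := can_inj gK.
have gB : zmod_morphism g by move=> x y; apply: s_inj; rewrite Kg rmorphB !Kg.
have gM : monoid_morphism g.
  by split=> [|x y]; apply: s_inj; rewrite Kg ?rmorph1// rmorphM !Kg.
pose g' : {rmorphism C -> C} := HB.pack g
  (GRing.isZmodMorphism.Build _ _ g gB) (GRing.isMonoidMorphism.Build _ _ g gM).
have [|t tE] := @absGal_of_rmorph g'; last by exists t; split=> x; rewrite tE.
by move=> c; apply: s_inj; rewrite /= Kg absGal_fix.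
Qed.

Lemma absGal_root (s : G) (p : {poly K}) x :
  root (map_poly iota p) x -> root (map_poly iota p) (s x).
Proof.
move=> /(rmorph_root s); rewrite -map_poly_comp.
by rewrite (eq_map_poly (g := iota))// => c; apply: absGal_fix.
Qed.

Lemma absGal_extend (L : fieldType) (j1 j2 : {rmorphism L -> C}) (k : K -> L) :
    (forall c, j1 (k c) = iota c) -> (forall c, j2 (k c) = iota c) ->
    {morph k : x y / x - y} -> monoid_morphism k ->
  exists s : G, forall a, s (j1 a) = j2 a.
Proof.
move=> j1k j2k kB kM.
pose k' : {rmorphism K -> L} := HB.pack k
  (GRing.isZmodMorphism.Build _ _ k kB) (GRing.isMonoidMorphism.Build _ _ k kM).
have j1_int : integralRange j1.
  move=> z; have [p mp pz] := iota_int z; exists (map_poly k' p).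
    by rewrite map_monic.
  by rewrite -map_poly_comp (eq_map_poly (g := iota)).
have [s0 s0E] := extend_embedding j2 j1_int.
have [|s sE] := @absGal_of_rmorph s0; first by move=> c; rewrite -j1k s0E j2k.
by exists s => a; rewrite sE s0E.
Qed.

Lemma irreducible_transitive (p : {poly K}) a b : irreducible_poly p ->
    root (map_poly iota p) a -> root (map_poly iota p) b ->
  exists s : G, s a = b.
Proof.
move=> [sp irr] pa pb; have [p0 [nzp0 p0a p0P]] := min_poly_exists (iota_int a).
have p0p : p0 %= p.
  apply: irr; last by rewrite -p0P.
  apply/eqP => s1; have := root_size_gt1 _ p0a.
  by rewrite size_map_poly s1 map_poly_eq0 nzp0 => /(_ isT).
have p0b : root (map_poly iota p0) b.
  move: p0p; rewrite -(eqp_map iota) => /eqp_root -> //.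
have [S [g [aS inS gE gx]]] := simple_extension p0P p0b nzp0.
pose k c : subfield_of S := SubfieldOf (inS c).
have [||||s sE] := @absGal_extend _ (val : subfield_of S -> C) g k.
- by [].
- by move=> c; apply: gE.
- by move=> x y; apply: val_inj; rewrite /= rmorphB.
- by split=> [|x y]; apply: val_inj; rewrite /= ?rmorph1 ?rmorphM.
by exists s; rewrite -[a]/(val (SubfieldOf aS)) sE gx.
Qed.

Lemma transitive_irreducible (p : {poly K}) (rs : seq C) :
    uniq rs -> (0 < size rs)%N -> p != 0 ->
    map_poly iota p = lead_coef (map_poly iota p) *: \prod_(x <- rs) ('X - x%:P) ->
    (forall x y, x \in rs -> y \in rs -> exists s : G, s x = y) ->
  irreducible_poly p.
Proof.
move=> urs rs0 nzp Dp tr.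
have nzpi : map_poly iota p != 0 by rewrite map_poly_eq0.
have sp : size p = (size rs).+1.
  by rewrite -(size_map_poly iota) Dp size_scale ?lead_coef_eq0// size_prod_XsubC.
split=> [|q q1 qp]; first by rewrite sp ltnS.
have nzq : q != 0 by apply: contraTneq qp => ->; rewrite dvd0p.
have /closed_rootP[x qx] : size (map_poly iota q) != 1%N by rewrite size_map_poly.
have rP z : root (map_poly iota p) z = (z \in rs).
  by rewrite Dp rootZ ?lead_coef_eq0// root_prod_XsubC.
have xrs : x \in rs.
  by have /dvdpP[w Dw] := qp; rewrite -rP Dw rmorphM rootM qx orbT.
rewrite /eqp qp /= -(dvdp_map iota) Dp dvdpZl ?lead_coef_eq0//.
apply: uniq_roots_dvdp; last by rewrite uniq_rootsE.
by apply/allP => y yrs; have [s <-] := tr x y xrs yrs; apply: absGal_root.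
Qed.

Lemma irreducible_roots_uniq (p : {poly K}) (rs : seq C) :
    (forall n, (n%:R == 0 :> K) = (n == 0)%N) -> irreducible_poly p ->
    map_poly iota p = lead_coef (map_poly iota p) *: \prod_(x <- rs) ('X - x%:P) ->
  uniq rs.
Proof.
move=> char0 [sp irr] Dp; have nzp : p != 0 by rewrite -size_poly_gt0 ltnW.
have nzpi : map_poly iota p != 0 by rewrite map_poly_eq0.
have nzd : p^`() != 0.
  have : p^`()`_(size p).-2 != 0.
    rewrite coef_deriv -mulr_natr (_ : (size p).-2.+1 = (size p).-1).
      rewrite mulf_neq0 ?char0 -?lead_coefE ?lead_coef_eq0//.
      by case: (size p) sp => [|[]].
    by case: (size p) sp => [|[]].
  by apply: contraNneq => ->; rewrite coef0.
have cop : coprimep p p^`().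
  apply/coprimepP => d dp dd; rewrite -size_poly_eq1; apply: contraT => d1.
  have := irr d d1 dp; rewrite eqp_sym => /eqp_dvdl pd.
  move: dd; rewrite -pd => /dvdp_leq => /(_ nzd).
  by rewrite leqNgt lt_size_deriv.
rewrite -separable_prod_XsubC unlock.
move: cop; rewrite -(coprimep_map iota) -deriv_map Dp derivZ.
by rewrite coprimepZl ?coprimepZr ?lead_coef_eq0.
Qed.

End AbsoluteGalois.

(** * The Galois group of a polynomial as a quotient of the absolute one *)

Section GaloisGroupImage.
Variables (K : fieldType) (C : closedFieldType) (iota : {rmorphism K -> C}).
Hypothesis iota_int : integralRange iota.
Variables (L : splittingFieldType K).
Local Notation G := (absGal iota).

Lemma minPoly_over1 (a : L) : exists q : {poly K},
  q \is monic /\ map_poly (in_alg L) q = minPoly 1 a.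
Proof.
have /polyOver1P[q Dq] := minPolyOver 1 a; exists q; split=> //.
by rewrite -(map_monic (in_alg L)) -Dq monic_minPoly.
Qed.

Lemma splitting_embedding :
  exists j : {rmorphism L -> C}, forall c, j (in_alg L c) = iota c.
Proof.
apply: extend_embedding => a; have [q [mq qa]] := minPoly_over1 a.
by exists q => //; rewrite qa root_minPoly.
Qed.

Variable j : {rmorphism L -> C}.
Hypothesis j_iota : forall c, j (in_alg L c) = iota c.

Lemma gal_lift (g : gal_of {:L}) : exists s : G, forall a, s (j a) = j (g a).
Proof.
have g1 (c : K) : g (in_alg L c) = in_alg L c by rewrite /= rmorph_alg.
apply: (absGal_extend iota_int (j1 := j) (j2 := j \o g) (k := in_alg L)) => //.
- by move=> c; rewrite -[RHS]j_iota -[in RHS]g1.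
- by move=> x y; rewrite rmorphB.
- by split=> [|x y]; rewrite ?rmorph1 ?rmorphM.
Qed.

Lemma absGal_restrict (s : G) : exists2 g : gal_of {:L},
  g \in 'Gal({:L} / 1)%g & forall a, s (j a) = j (g a).
Proof.
have sj a : exists b, s (j a) = j b.
  have [q [mq qa]] := minPoly_over1 a.
  have [r /eqP Dr] := splitting_field_normal 1%AS a.
  have jq : map_poly iota q = \prod_(y <- map j r) ('X - y%:P).
    rewrite big_map -(eq_map_poly j_iota) map_poly_comp qa Dr rmorph_prod.
    by apply: eq_bigr => y _; rewrite rmorphB /= map_polyX map_polyC.
  have : root (map_poly iota q) (s (j a)).
    apply: absGal_root; rewrite -(eq_map_poly j_iota) map_poly_comp qa.
    by apply: rmorph_root; apply: root_minPoly.
  by rewrite jq root_prod_XsubC => /mapP[y _ ->]; exists y.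
have /choice[f fE] := sj.
have f_lin : linear f.
  move=> c x y; apply: (fmorph_inj j); rewrite -fE rmorphD -mulr_algl rmorphM.
  by rewrite j_iota rmorphD rmorphM absGal_fix !fE -j_iota -rmorphM -rmorphD mulr_algl.
pose f' : {linear L -> L} := HB.pack f (GRing.isLinear.Build _ _ _ _ f f_lin).
have f_hom : kHom 1 {:L} (linfun f').
  apply/kHomP; split=> [x y _ _|x /vlineP[c ->]]; rewrite !lfunE /=.
    by apply: (fmorph_inj j); rewrite -fE !rmorphM !fE.
  by apply: (fmorph_inj j); rewrite -fE j_iota absGal_fix.
have [|g gG fg] := kHom_to_gal _ (normalFieldf 1) f_hom.
  by rewrite sub1v subvv.
by exists g => // a; rewrite fE -fg ?memvf// lfunE.
Qed.

End GaloisGroupImage.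

(** The kernel condition makes [phi s] depend only on the restriction of s to the splitting field,
    so [phi] descends to an isomorphism. The order is reversed in its multiplicativity because
    permutations and elements of [gal_of] compose from left to right. *)
Lemma galoisGroup_isog (K : fieldType) (C : closedFieldType)
    (iota : {rmorphism K -> C}) (iota_int : integralRange iota) (p : {poly K})
    (gT : finGroupType) (H : {group gT}) (phi : absGal iota -> gT) :
    p != 0 -> (forall s, phi s \in H) ->
    (forall h, h \in H -> exists s, phi s = h) ->
    (forall s t u : absGal iota, (forall x, u x = s (t x)) -> phi u = phi t * phi s)%g ->
    (forall s : absGal iota, phi s = 1%g <->
      (forall x, root (map_poly iota p) x -> s x = x)) ->
  (galoisGroup p \isog H)%g.
Proof.
move=> nzp phiH surj phiM ker; have [rs Dp gen] := Defs.splittingFieldP nzp.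
set L := splittingField p in rs Dp gen.
have [j jE] := splitting_embedding iota L.
have jrs x : root (map_poly iota p) x = (x \in map j rs).
  rewrite -(eq_map_poly jE) map_poly_comp -(root_prod_XsubC (map j rs)) big_map.
  apply: eqp_root; move: Dp; rewrite -(eqp_map j) => /eqp_trans; apply.
  rewrite rmorph_prod.
  rewrite (eq_bigr (fun y => 'X - (j y)%:P)) ?eqpxx// => y _.
  by rewrite rmorphB /= map_polyX map_polyC.
have phi_eq (s t : absGal iota) : (forall a, s (j a) = t (j a)) -> phi s = phi t.
  move=> st; have [t' [t't tt']] := absGal_inv iota_int t.
  have [u uE] := absGal_comp iota_int t' s.
  have [v vE] := absGal_comp iota_int t' t.
  have phiu : phi u = 1%g.
    apply/ker => x; rewrite jrs => /mapP[a _ ->].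
    by rewrite uE st t't.
  have phiv : phi v = 1%g by apply/ker => x _; rewrite vE t't.
  apply: (mulIg (phi t')); rewrite -(phiM _ _ _ uE) -(phiM _ _ _ vE).
  by rewrite phiu phiv.
have /choice[sg sgE] := gal_lift iota_int jE.
pose f g := phi (sg g).
have fM : {in 'Gal({:L} / 1)%g &, {morph f : g h / g * h >-> g * h}}%g.
  move=> g h _ _; have [u uE] := absGal_comp iota_int (sg h) (sg g).
  rewrite /f -(phiM _ _ _ uE); apply: phi_eq => a.
  by rewrite uE !sgE galM ?memvf.
apply/isogP; exists (Morphism fM).
  apply/fintype.subsetP => g /morphpreP[gG]; move=> /set1P /= fg.
  apply/set1P/eqP/gal_eqP => a _; rewrite gal_id.
  have : (<<1 & rs>> <= fixedField [set g])%VS.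
    apply/Fadjoin_seqP; split=> [|z zrs]; first exact: sub1v.
    apply/fixedFieldP; first exact: memvf.
    move=> h /set1P ->; apply: (fmorph_inj j); rewrite -sgE.
    by apply: (iffLR (ker (sg g)) fg); rewrite jrs map_f.
  rewrite gen => /subvP/(_ a (memvf a))/fixedFieldP-/(_ (memvf a)); apply.
  exact: set11.
apply/setP => h; apply/morphimP/idP => [[g _ gG ->]|hH]; first exact: phiH.
have [s <-] := surj h hH; have [g gG sgj] := absGal_restrict jE s.
by exists g => //; apply: phi_eq => a; rewrite sgE sgj.
Qed.

(** * The function field and the primitive division polynomials *)

Lemma affine_poly_eq0 (R : nzRingType) (a b : R) :
  a%:P + b%:P * 'X = 0 -> a = 0 /\ b = 0.
Proof.
move=> e; have := congr1 (fun f : {poly R} => f`_1) e.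
have := congr1 (fun f : {poly R} => f`_0) e.
by rewrite !coefD !coefMX !coefC /= addr0 add0r.
Qed.

Section FunctionField.
Variables (K : fieldType) (E : weierstrass K).
Hypothesis two_neq0 : 2 != 0 :> K.
Local Notation FF := (functionField E).
Local Notation B := (two_tors_poly E).
Local Notation mi := (wKx_irreducible E).

Lemma polyFF_is_zmod_morphism : zmod_morphism (polyFF E).
Proof. by move=> f g; rewrite /polyFF tofracB; apply: (rmorphB (qfpoly_const mi)). Qed.

Lemma polyFF_is_monoid_morphism : monoid_morphism (polyFF E).
Proof.
split; first by rewrite /polyFF tofrac1; apply: (rmorph1 (qfpoly_const mi)).
by move=> f g; rewrite /polyFF tofracM; apply: (rmorphM (qfpoly_const mi)).
Qed.

HB.instance Definition _ := GRing.isZmodMorphism.Build {poly K} FF (polyFF E)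
  polyFF_is_zmod_morphism.
HB.instance Definition _ := GRing.isMonoidMorphism.Build {poly K} FF (polyFF E)
  polyFF_is_monoid_morphism.

Lemma polyFF_inj : injective (polyFF E).
Proof.
move=> f g /(fmorph_inj (qfpoly_const mi)) /eqP.
by rewrite tofrac_eq => /eqP.
Qed.

Lemma in_qpoly_const (c : {fraction {poly K}}) :
  in_qpoly (wKx E) c%:P = qpolyC (wKx E) c.
Proof.
apply: val_inj; apply: in_qpoly_small.
by rewrite (leq_ltn_trans (size_polyC_leq1 _)) ?size_mk_monic_gt1.
Qed.

Lemma mk_monic_wKx : mk_monic (wKx E) = wKx E.
Proof. by rewrite /mk_monic size_wpoly monic_wpoly. Qed.

Lemma wKx_yFF : yFF E ^+ 2 + polyFF E ((a1 E)%:P * 'X + (a3 E)%:P) * yFF E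
  = polyFF E ('X^3 + (a2 E)%:P * 'X^2 + (a4 E)%:P * 'X + (a6 E)%:P).
Proof.
pose q : {poly %/ wKx E} := in_qpoly (wKx E) 'X.
rewrite /yFF /polyFF /qfpoly_const -!in_qpoly_const.
rewrite -[LHS]/(q * q + in_qpoly (wKx E) _ * q) -!in_qpolyM -in_qpolyD.
set M := _ + _; set N := (_)%:P.
have Dw : wKx E = M - N.
  by rewrite /wKx /wpoly /= /M /N !(tofracD, tofracM, tofracXn) expr2.
have : in_qpoly (wKx E) (M - N) = 0.
  by apply: val_inj; rewrite /= mk_monic_wKx -Dw Pdiv.RingMonic.rmodpp ?monic_wpoly.
by rewrite linearB => /eqP; rewrite subr_eq0 => /eqP.
Qed.

Lemma polyFF_yFF_free (u v : {poly K}) :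
  polyFF E u + polyFF E v * yFF E = 0 -> u = 0 /\ v = 0.
Proof.
pose q : {poly %/ wKx E} := in_qpoly (wKx E) 'X.
rewrite /yFF /polyFF /qfpoly_const -!in_qpoly_const.
rewrite -[LHS]/(in_qpoly (wKx E) _ + in_qpoly (wKx E) _ * q) -in_qpolyM -in_qpolyD.
set w := _ + _ => w0; have : w = 0.
  apply: etrans (esym (@in_qpoly_small _ (wKx E) w _)) (congr1 val w0).
  rewrite mk_monic_wKx size_wpoly ltnS /w; apply: leq_sizeD.
    by rewrite (leq_trans (size_polyC_leq1 _)).
  exact: (leq_sizeCXn _ 1).
move/affine_poly_eq0 => [/eqP + /eqP].
by rewrite !tofrac_eq0 => /eqP -> /eqP ->.
Qed.

Lemma psi2E : psi2 E = 2 * yFF E + polyFF E ((a1 E)%:P * 'X + (a3 E)%:P).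
Proof. by rewrite /psi2 /= -addrA rmorphD rmorphM. Qed.

Lemma psi2_sqr : psi2 E ^+ 2 = polyFF E B.
Proof.
have sqrE (R : comNzRingType) (y l : R) :
  (2 * y + l) ^+ 2 = 4 * (y ^+ 2 + l * y) + l ^+ 2 by ring.
rewrite psi2E sqrE wKx_yFF -(rmorph_nat (polyFF E)) -rmorphM -rmorphXn -rmorphD.
by congr (polyFF E _); rewrite /two_tors_poly /b2 /b4 /b6; ring.
Qed.

Lemma polyFF_psi2_free (u v : {poly K}) :
  polyFF E u + polyFF E v * psi2 E = 0 -> u = 0 /\ v = 0.
Proof.
rewrite psi2E mulrDr addrC -addrA -(rmorphM (polyFF E)) -(rmorphD (polyFF E)).
rewrite addrC mulrCA mulrA.
rewrite -(rmorph_nat (polyFF E)) -(rmorphM (polyFF E)) => /polyFF_yFF_free.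
rewrite -polyC_natr => -[+ /eqP]; rewrite mulf_eq0 polyC_eq0 (negPf two_neq0) /=.
by move=> + /eqP v0; rewrite v0 mul0r add0r.
Qed.

Lemma psi2_neq0 : psi2 E != 0.
Proof.
apply/eqP => t0; have [|_ /eqP] := @polyFF_psi2_free 0 1.
  by rewrite t0 mulr0 addr0 rmorph0.
by rewrite oner_eq0.
Qed.

End FunctionField.

Section MorphismImages.
Variables (K : fieldType) (E : weierstrass K) (R : comNzRingType).
Variable f : {rmorphism {poly K} -> R}.

Lemma rmorph_psi3_poly : f (psi3_poly E) =
  3 * f 'X ^+ 4 + f (b2 E)%:P * f 'X ^+ 3 + 3 * f (b4 E)%:P * f 'X ^+ 2
  + 3 * f (b6 E)%:P * f 'X + f (b8 E)%:P.
Proof.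
by rewrite /psi3_poly !polyCM !polyC_natr !(rmorph_nat, rmorphXn, rmorphD, rmorphM).
Qed.

Lemma rmorph_psi4_poly : f (psi4_poly E) =
  2 * f 'X ^+ 6 + f (b2 E)%:P * f 'X ^+ 5 + 5 * f (b4 E)%:P * f 'X ^+ 4
    + 10 * f (b6 E)%:P * f 'X ^+ 3 + 10 * f (b8 E)%:P * f 'X ^+ 2
    + (f (b2 E)%:P * f (b8 E)%:P - f (b4 E)%:P * f (b6 E)%:P) * f 'X
    + (f (b4 E)%:P * f (b8 E)%:P - f (b6 E)%:P ^+ 2).
Proof.
rewrite /psi4_poly; move: (b2 E) (b4 E) (b6 E) (b8 E) => u v w z.
rewrite !(polyCB, polyC_exp, polyCM, polyC_natr).
by rewrite !(rmorph_nat, rmorphXn, rmorphB, rmorphD, rmorphM).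
Qed.

End MorphismImages.

Lemma psi_step (K R : fieldType) (f : {rmorphism {poly K} -> R}) (t : R)
    (B : {poly K}) (d : nat -> {poly K}) (m : nat) (b : bool) :
    t != 0 -> t ^+ 2 = f B -> (1 < m)%N ->
    let p k := f (d k) * t ^+ (~~ odd k) in
  (if b then p m.+2 * p m ^+ 3 - p m.-1 * p m.+1 ^+ 3
   else p m * (p m.+2 * p m.-1 ^+ 2 - p m.-2 * p m.+1 ^+ 2) / t) =
  f (if b then B ^+ (~~ odd m).*2 * (d m.+2 * d m ^+ 3)
       - B ^+ (odd m).*2 * (d m.-1 * d m.+1 ^+ 3)
     else d m * (d m.+2 * d m.-1 ^+ 2 - d m.-2 * d m.+1 ^+ 2)) * t ^+ (~~ b).
Proof.
case: m => [|[|m]]// nzt tB _ p; rewrite {}/p /= !negbK.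
case: b; rewrite !(rmorphXn, rmorphB, rmorphM) -?tB;
  move: (f (d m.+4)) (f (d m.+3)) (f (d m.+2)) (f (d m.+1)) (f (d m)) => x y z v w;
  case: (odd m) => /=; rewrite ?expr0 ?expr1 ?mulr1; try by field.
Qed.

Section DivisionPolynomials.
Variables (K : fieldType) (E : weierstrass K).
Hypothesis two_neq0 : 2 != 0 :> K.
Local Notation pF := (polyFF E).
Local Notation EF := (map_weierstrass (constFF E) E).

Lemma b2_FF : b2 EF = pF (b2 E)%:P.
Proof. exact: (map_b2 (pF \o polyC) E). Qed.

Lemma b4_FF : b4 EF = pF (b4 E)%:P.
Proof. exact: (map_b4 (pF \o polyC) E). Qed.

Lemma b6_FF : b6 EF = pF (b6 E)%:P.
Proof. exact: (map_b6 (pF \o polyC) E). Qed.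

Lemma b8_FF : b8 EF = pF (b8 E)%:P.
Proof. exact: (map_b8 (pF \o polyC) E). Qed.

Lemma psi3E : psi3 E = pF (psi3_poly E).
Proof. by rewrite (rmorph_psi3_poly E pF) /psi3 b2_FF b4_FF b6_FF b8_FF. Qed.

Lemma psi4E : psi4 E = psi2 E * pF (psi4_poly E).
Proof. by rewrite (rmorph_psi4_poly E pF) /psi4 b2_FF b4_FF b6_FF b8_FF. Qed.

Lemma psi_recE k n : (n <= k)%N ->
  psi_rec E k n = pF (dpoly E n) * psi2 E ^+ (~~ odd n).
Proof.
have sqrB : psi2 E ^+ 2 = pF (two_tors_poly E) := psi2_sqr E.
have nzt := psi2_neq0 E two_neq0.
elim: k n => [|k IH] n nk.
  by move: nk; rewrite leqn0 => /eqP ->; rewrite /= (rmorph0 pF) mul0r.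
have [n4|] := ltnP 4 n; last first.
  case: n nk => [|[|[|[|[|n]]]]]//= _ _.
  - by rewrite (rmorph0 pF) mul0r.
  - by rewrite (rmorph1 pF) mul1r.
  - by rewrite (rmorph1 pF) mul1r expr1.
  - by rewrite psi3E mulr1.
  - by rewrite psi4E expr1 mulrC.
have -> : psi_rec E k.+1 n = let m := n./2 in
      if odd n then
        psi_rec E k m.+2 * psi_rec E k m ^+ 3
        - psi_rec E k m.-1 * psi_rec E k m.+1 ^+ 3
      else
        psi_rec E k m
        * (psi_rec E k m.+2 * psi_rec E k m.-1 ^+ 2
           - psi_rec E k m.-2 * psi_rec E k m.+1 ^+ 2) / psi2 E.
  by case: n n4 {nk} => [|[|[|[|[|n]]]]].
have H m : (m <= n./2.+2)%N -> psi_rec E k m = pF (dpoly E m) * psi2 E ^+ (~~ odd m).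
  by move=> /(half_lt n4) mn; apply: IH; rewrite -ltnS (leq_trans mn).
have m_gt1 : (1 < n./2)%N.
  by clear -n4; have := odd_double_half n; case: (odd n) => /=; lia.
rewrite (dpolyE E n4) /=; move: (n./2) m_gt1 H => m m_gt1 H.
rewrite !H; try by (clear; lia).
exact: (@psi_step _ _ pF _ _ (dpoly E) m (odd n) nzt sqrB m_gt1).
Qed.

Lemma psiE n : psi E n = pF (dpoly E n) * psi2 E ^+ (~~ odd n).
Proof. exact: psi_recE. Qed.

Lemma primpsi_recE k n : (0 < n <= k)%N ->
  primpsi_rec E k n = psi E n / \prod_(m <- divisors n | m != n) primpsi E m.
Proof.
suff H k' l : (0 < l <= k')%N -> primpsi_rec E k' l = primpsi E l.
  case: k => [|k] /andP[n0 nk]; first by move: n0; rewrite ltnNge nk.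
  congr (_ / _); rewrite big_seq_cond [RHS]big_seq_cond; apply: eq_bigr => m.
  rewrite -dvdn_divisors// => /andP[mn m_neq]; apply: H.
  by rewrite (dvdn_gt0 n0 mn) -ltnS (leq_trans _ nk)// ltn_neqAle m_neq dvdn_leq.
have [j] := ubnP l; elim: j k' l => // j IH [|k'] l lj /andP[l0 lk].
  by move: l0; rewrite ltnNge lk.
rewrite /primpsi; case: l lj l0 lk => // l lj _ lk; congr (_ / _).
rewrite big_seq_cond [RHS]big_seq_cond; apply: eq_bigr => m.
rewrite -dvdn_divisors// => /andP[ml m_neq].
have ml1 : (m <= l)%N by rewrite -ltnS ltn_neqAle m_neq dvdn_leq.
have m0 := dvdn_gt0 (ltn0Sn l) ml.
change (primpsi_rec E k' m = primpsi_rec E l m).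
by rewrite !IH// ?m0 ?(leq_ltn_trans ml1 _)// (leq_trans ml1).
Qed.

Lemma primpsiE n : (0 < n)%N ->
  primpsi E n = psi E n / \prod_(m <- divisors n | m != n) primpsi E m.
Proof. by move=> n0; apply: primpsi_recE; rewrite n0 leqnn. Qed.

Lemma primpsi1 : primpsi E 1 = 1.
Proof. by rewrite primpsiE// psiE (rmorph1 pF) mulr1 big1_seq ?divr1// => m /andP[]; rewrite inE => /negPf ->. Qed.

Lemma primpsi2 : primpsi E 2 = psi2 E.
Proof.
rewrite primpsiE// psiE (rmorph1 pF) mul1r expr1.
by rewrite !big_cons big_nil /= primpsi1 mulr1 divr1.
Qed.

Lemma primdivpoly_unique n f : pF f = primpsi E n -> primdivpoly E n = f.
Proof.
move=> fn; apply: (@polyFF_inj _ E); rewrite /primdivpoly.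
by case: xgetP => [g _ -> //|none]; case: (none f).
Qed.

(* Dividing out psi_1, psi_2 and the primitive polynomials of smaller index
   leaves no trace of psi_2. *)
Lemma primdivpoly_quotient n (f : {poly K}) : (2 < n)%N ->
    (forall m, (m %| n)%N -> (2 < m < n)%N -> pF (primdivpoly E m) = primpsi E m) ->
    dpoly E n != 0 ->
    dpoly E n = f * \prod_(m <- divisors n | (2 < m)%N && (m != n)) primdivpoly E m ->
  pF f = primpsi E n /\ primdivpoly E n = f.
Proof.
move=> n2 IH nzd Dd; suff e : pF f = primpsi E n.
  by split=> //; apply: primdivpoly_unique.
have n0 : (0 < n)%N by apply: leq_trans n2.
set Q := \prod_(m <- _ | _) _ in Dd.
have nzQ : pF Q != 0.
  apply: contraNneq nzd => Q0.
  by rewrite Dd (polyFF_inj (etrans Q0 (esym (rmorph0 pF)))) mulr0.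
have DQ : pF Q = \prod_(m <- divisors n | (2 < m)%N && (m != n)) primpsi E m.
  rewrite (rmorph_prod pF) big_seq_cond [RHS]big_seq_cond; apply: eq_bigr => m.
  rewrite -dvdn_divisors// => /and3P[mn m2 m_neq]; apply: IH => //.
  by rewrite m2 ltn_neqAle m_neq dvdn_leq.
rewrite primpsiE// psiE Dd (rmorphM pF) -mulrA.
rewrite (bigID (fun m => 2 < m)%N) /=.
under eq_bigl do rewrite andbC.
rewrite -DQ.
have -> : \prod_(m <- divisors n | (m != n) && ~~ (2 < m)%N) primpsi E m
    = psi2 E ^+ (~~ odd n).
  rewrite -big_filter (perm_big (if odd n then [:: 1%N] else [:: 1%N; 2])) /=.
    by case: (odd n); rewrite !big_cons big_nil primpsi1 ?primpsi2 !mulr1 ?mul1r ?expr1.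
  apply: uniq_perm; first by rewrite filter_uniq ?divisors_uniq.
    by case: (odd n).
  move=> m; rewrite mem_filter -dvdn_divisors// -leqNgt.
  have -> : (m \in if odd n then [:: 1%N] else [:: 1%N; 2]) =
      (m == 1%N) || (m == 2) && ~~ odd n.
    by case: (odd n); rewrite !inE ?andbF ?andbT ?orbF.
  case: m => [|[|[|m]]]; rewrite /= ?andbF ?orbF ?dvd1n ?dvdn2 ?andbT//.
  - by apply/negbTE; rewrite dvd0n negb_and -lt0n n0 orbT.
  - by case: n n2 {IH nzd n0 Q Dd nzQ DQ} => [|[]].
  - by case: (n) n2 => [|[|[]]]//= *; rewrite ?andbT.
have cancel (R : fieldType) (x q t : R) :
  q != 0 -> t != 0 -> x * (q * t) / (q * t) = x by move=> *; field; apply/andP.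
rewrite -[LHS](cancel _ _ _ (psi2 E ^+ (~~ odd n)) nzQ) ?mulrA//.
by rewrite expf_neq0// psi2_neq0.
Qed.

End DivisionPolynomials.

Section Fractions.
Variables (A : comNzRingType) (M : fieldType) (f : {rmorphism A -> M}).

(** The subfield generated by the image of f. It serves as K(x) and as K(t), the two proper
    subfields of K(E) against which [generatesFF] is tested. *)
Definition fraction_pred : {pred M} :=
  [pred z | `[< exists p q, f q != 0 /\ z * f q = f p >]].

Lemma fraction_divring : divring_closed fraction_pred.
Proof.
split.
- by apply/asboolP; exists 1, 1; rewrite rmorph1 mulr1 oner_neq0.
- move=> x y /asboolP[p [q [nzq Dx]]] /asboolP[r [s [nzs Dy]]]; apply/asboolP.
  exists (p * s - r * q), (q * s); rewrite !rmorphM mulf_neq0//; split=> //.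
  by rewrite rmorphB !rmorphM -Dx -Dy; ring.
move=> x y /asboolP[p [q [nzq Dx]]] /asboolP[r [s [nzs Dy]]]; apply/asboolP.
have [->|nzy] := eqVneq y 0.
  by exists 0, 1; rewrite rmorph1 oner_neq0 invr0 mulr0 mul0r rmorph0.
have nzr : f r != 0 by rewrite -Dy mulf_neq0.
exists (p * s), (q * r); rewrite !rmorphM mulf_neq0//; split=> //.
by rewrite -Dx -Dy; field.
Qed.

Lemma fraction_base p : f p \in fraction_pred.
Proof. by apply/asboolP; exists p, 1; rewrite rmorph1 mulr1 oner_neq0. Qed.

End Fractions.

Lemma affine_in_subfield (R : fieldType) (S : divringClosed R) (h a b c l k x y : R) :
    h + h = b -> h * l = a -> h \in S -> c \in S -> k \in S -> 2 * y + l * x + k \in S ->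
  a * x + b * y + c \in S /\ a * x + b * (- y - l * x - k) + c \in S.
Proof.
move=> <- <- hS cS kS tS; set t := _ + k in tS.
have -> : h * l * x + (h + h) * y + c = h * (t - k) + c by rewrite /t; ring.
have -> : h * l * x + (h + h) * (- y - l * x - k) + c = - (h * (t + k)) + c.
  by rewrite /t; ring.
split; first by rewrite rpredD ?rpredM ?rpredB.
by apply: rpredD => //; rewrite rpredN; apply: rpredM => //; apply: rpredD.
Qed.

Lemma affine_combination (R : comNzRingType) (x a b c d t : R) :
  x * (a + b * t) - (c + d * t) = x * a - c + (x * b - d) * t.
Proof. by ring. Qed.

(** * What it means for u and its pull-back to generate K(E) *)

Section Generators.
Variables (K : fieldType) (E : weierstrass K).
Hypothesis two_neq0 : 2 != 0 :> K.
Variables (alpha beta gamma : K).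
Hypothesis gen : generatesFF (affFF E alpha beta gamma) (affFF_opp E alpha beta gamma).
Local Notation pF := (polyFF E).
Local Notation B := (two_tors_poly E).

(** For beta = 0 both functions lie in K(x), which does not contain y. *)
Lemma generates_beta_neq0 : beta != 0.
Proof.
apply/eqP => b0; pose S := fraction_pred pF.
have Scl : divring_closed S := fraction_divring pF.
have uS : pF (alpha%:P * 'X + gamma%:P) \in S := fraction_base pF _.
have uE : affFF E alpha beta gamma = pF (alpha%:P * 'X + gamma%:P).
  by rewrite /affFF b0 /constFF (rmorph0 pF) mul0r addr0 (rmorphD pF) (rmorphM pF).
have vE : affFF_opp E alpha beta gamma = pF (alpha%:P * 'X + gamma%:P).
  by rewrite /affFF_opp b0 /constFF (rmorph0 pF) mul0r addr0 (rmorphD pF) (rmorphM pF).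
have cS c : constFF E c \in S := fraction_base pF c%:P.
have /asboolP[p [q [nzq Dy]]] : yFF E \in S.
  by apply: (gen Scl cS); [rewrite uE|rewrite vE].
have [|_ q0] := @polyFF_yFF_free _ E (- p) q.
  by rewrite mulrC Dy (rmorphN pF) addNr.
by move: nzq; rewrite q0 (rmorph0 pF) eqxx.
Qed.

Let evt : {rmorphism {poly K} -> functionField E} :=
  horner_eval (psi2 E) \o map_poly (pF \o polyC).

Lemma eval_comp_sqr (g : {poly K}) : evt (g \Po 'X^2) = pF (g \Po B).
Proof.
rewrite /evt /= /horner_eval map_comp_poly horner_comp map_polyXn hornerXn.
rewrite psi2_sqr /comp_poly -(horner_map pF) -map_poly_comp.
by rewrite (eq_map_poly (g := pF \o polyC)).
Qed.

Lemma eval_psi2 (p : {poly K}) :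
  evt p = pF (even_poly p \Po B) + pF (odd_poly p \Po B) * psi2 E.
Proof.
rewrite -!eval_comp_sqr -{1}[p]poly_even_odd rmorphD rmorphM; congr (_ + _ * _).
by rewrite /evt /= /horner_eval map_polyX hornerX.
Qed.

(** As B is cubic, the two degrees are 1 and 0 modulo 3 unless q = 0. *)
Lemma mulX_comp_cubic (p q : {poly K}) : 'X * (q \Po B) = p \Po B -> q = 0.
Proof.
have sB : size B = 4%N by apply: size_two_tors_poly.
move=> e; apply: contraTeq isT => nzq.
have nzqB : q \Po B != 0 by rewrite comp_poly_eq0 ?sB.
have := congr1 (fun f : {poly K} => (size f).-1) e.
rewrite mulrC size_mulX//= size_comp_poly sB.
have := size_comp_poly q B; rewrite sB -size_poly_gt0 in nzqB *.
have aux (s a b : nat) : (0 < s)%N -> s.-1 = (a * 3)%N -> s <> (b * 3)%N.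
  by clear; lia.
by move=> h1 h2; case: (aux _ _ _ nzqB h1 h2).
Qed.

(** In case of equality u = (beta/2) t + constant, so u and its pull-back lie in K(t). Were x in
    K(t), say x q(t) = p(t), then splitting p and q into even and odd parts, with t^2 = B, would
    give two identities excluded by [mulX_comp_cubic]. *)
Lemma generates_slope : 2 * alpha != beta * a1 E.
Proof.
apply/eqP => e; pose S := fraction_pred evt.
have Scl : divring_closed S := fraction_divring evt.
pose Sd : divringClosed (functionField E) :=
  HB.pack S (GRing.isDivringClosed.Build (functionField E) S Scl).
have tS : psi2 E \in Sd.
  have <- : evt 'X = psi2 E by rewrite /evt /= /horner_eval map_polyX hornerX.
  exact: fraction_base.
have cS c : constFF E c \in Sd.
  have <- : evt c%:P = constFF E c by rewrite /evt /= /horner_eval map_polyC hornerC.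
  exact: fraction_base.
pose h := beta / 2; have h1 : constFF E h + constFF E h = constFF E beta.
  apply: etrans (esym (rmorphD pF h%:P h%:P)) (congr1 pF _).
  by rewrite -polyCD; congr (_%:P); rewrite /h; field.
have h2 : constFF E h * constFF E (a1 E) = constFF E alpha.
  apply: etrans (esym (rmorphM pF h%:P _)) (congr1 pF _).
  by rewrite -polyCM /h mulrAC -e mulrC mulKf.
have [uS vS] := affine_in_subfield h1 h2 (cS h) (cS gamma) (cS (a3 E)) tS.
have /asboolP[p [q [nzq Dx]]] := gen Scl cS uS vS (xFF E).
move: Dx; rewrite !eval_psi2 => /eqP; rewrite -subr_eq0.
rewrite affine_combination -!(rmorphM pF) -!(rmorphB pF) => /eqP.
move=> /(polyFF_psi2_free two_neq0)[/eqP + /eqP].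
rewrite !subr_eq0 => /eqP/mulX_comp_cubic q0 /eqP/mulX_comp_cubic q1.
move: nzq; rewrite -[q]poly_even_odd q0 q1 !comp_poly0 mul0r addr0 rmorph0.
by rewrite eqxx.
Qed.

End Generators.

Section SplitSets.
Variable C : fieldType.

Definition splits_on (p : {poly C}) (A : C -> Prop) :=
  p != 0 /\ exists rs : seq C, [/\ uniq rs,
    p = lead_coef p *: \prod_(x <- rs) ('X - x%:P) & forall x, x \in rs <-> A x].

Lemma splits_onM p q A B : splits_on p A -> splits_on q B ->
  (forall x, A x -> ~ B x) -> splits_on (p * q) (fun x => A x \/ B x).
Proof.
move=> [nzp [rs [urs Dp rsA]]] [nzq [ss [uss Dq ssB]]] dis; split; first exact: mulf_neq0.
exists (rs ++ ss); split.
- rewrite cat_uniq urs uss andbT; apply/hasPn => x /ssB Bx.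
  by apply/negP => /rsA /dis.
- by rewrite big_cat /= lead_coefM {1}Dp {1}Dq -scalerAl -scalerAr scalerA.
move=> x; rewrite mem_cat; split=> [/orP[/rsA|/ssB]|[/rsA ->|/ssB ->]]; rewrite ?orbT//; by [left|right].
Qed.

Lemma splits_on_prod (I : eqType) (r : seq I) (p : I -> {poly C}) (A : I -> C -> Prop) :
    uniq r -> (forall i, i \in r -> splits_on (p i) (A i)) ->
    (forall i j x, A i x -> A j x -> i = j) ->
  splits_on (\prod_(i <- r) p i) (fun x => exists2 i, i \in r & A i x).
Proof.
move=> + + dis; elim: r => [_ _|i r IH /= /andP[ir ur] h].
  rewrite big_nil; split; first exact: oner_neq0.
  exists [::]; split=> //; first by rewrite big_nil lead_coef1 scale1r.
  by move=> x; split=> // -[].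
rewrite big_cons; have [|||nz [rs [urs Dp rsP]]] := @splits_onM _ _ _ _ (h i _) (IH ur _).
- by rewrite mem_head.
- by move=> j jr; apply: h; rewrite inE jr orbT.
- by move=> x Ax [j jr Ajx]; rewrite (dis _ _ _ Ax Ajx) jr in ir.
split=> //; exists rs; split=> // x; rewrite rsP; split.
  by move=> [Ax|[j jr Ajx]]; [exists i|exists j]; rewrite ?mem_head// inE jr orbT.
by move=> [j]; rewrite inE => /orP[/eqP ->|jr] Ajx; [left|right; exists j].
Qed.

Lemma splits_on_root p A x : splits_on p A -> root p x <-> A x.
Proof.
by move=> [nzp [rs [_ Dp rsA]]]; rewrite -rsA Dp rootZ ?lead_coef_eq0// root_prod_XsubC.
Qed.

Lemma splits_on_dvd p q A B : splits_on p A -> splits_on q B ->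
  (forall x, B x -> A x) -> q %| p.
Proof.
move=> pA [nzq [ss [uss Dq ssB]]] BA; rewrite Dq dvdpZl ?lead_coef_eq0//.
apply: uniq_roots_dvdp; last by rewrite uniq_rootsE.
by apply/allP => x /ssB/BA/(splits_on_root x pA).
Qed.

Lemma splits_on_div p q A B : splits_on (p * q) A -> splits_on q B ->
  (forall x, B x -> A x) -> splits_on p (fun x => A x /\ ~ B x).
Proof.
move=> [nzpq [rs [urs Dp rsA]]] [nzq [ss [uss Dq ssB]]] BA.
have nzp : p != 0 by apply: contraNneq nzpq => ->; rewrite mul0r.
split=> //; exists [seq x <- rs | x \notin ss]; split; first exact: filter_uniq.
  apply: (mulIf nzq); rewrite {1}Dp lead_coefM -scalerAl mulrC [in RHS]Dq -scalerAr scalerA mulrC.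
  congr (_ *: _); rewrite -big_cat; apply: perm_big; apply: uniq_perm => //.
    rewrite cat_uniq filter_uniq// uss andbT; apply/hasPn => x xs.
    by rewrite mem_filter xs.
  move=> x; rewrite mem_cat mem_filter; case: (boolP (x \in ss)) => [/ssB/BA/rsA ->|_] //=.
  by rewrite orbF.
move=> x; rewrite mem_filter; split=> [/andP[/negP nx /rsA Ax]|[/rsA -> nB]].
  by split=> // /ssB.
by rewrite andbT; apply/negP => /ssB.
Qed.

End SplitSets.

Section PrimitiveRoots.
Variables (C : closedFieldType) (E : weierstrass C).
Hypothesis char0 : forall n, (n%:R == 0 :> C) = (n == 0)%N.
Hypothesis E_nonsing : nonsingular (two_tors_poly E).

Definition exact_x n x := exists y, exact_order E n (Some (x, y)).

Lemma exact_order_opp n P : (0 < n)%N -> exact_order E n P -> exact_order E n (oppP E P).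
Proof.
move=> n0 [cP nP mP]; have two_neq0 : 2 != 0 :> C by rewrite char0.
split; first by rewrite on_curve_opp.
- by rewrite mulP_opp// nP.
- move=> m mn; rewrite mulP_opp// => h; apply: (mP m mn).
  by rewrite -[LHS](oppPK E) h.
Qed.

Lemma exact_order_inj m n P : (0 < m)%N -> (0 < n)%N ->
  exact_order E m P -> exact_order E n P -> m = n.
Proof.
move=> m0 n0 /(exact_orderP char0 E_nonsing _ m0)[[_ mP] mmin].
move=> /(exact_orderP char0 E_nonsing _ n0)[[_ nP] nmin].
by apply/eqP; rewrite eqn_dvd mmin ?nmin.
Qed.

Lemma exact_x_over n x y : (0 < n)%N -> on_curve E (Some (x, y)) ->
  exact_x n x -> exact_order E n (Some (x, y)).
Proof.
move=> n0 xy [y' Q]; have [cQ _ _] := Q.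
have two_neq0 : 2 != 0 :> C by rewrite char0.
by have [->//|->] := oppP_eq_X two_neq0 xy cQ erefl; apply: exact_order_opp.
Qed.

Lemma exact_x_inj m n x : (0 < m)%N -> (0 < n)%N -> exact_x m x -> exact_x n x -> m = n.
Proof.
move=> m0 n0 [y P] xn; have [cP _ _] := P.
exact: (exact_order_inj m0 n0 P (exact_x_over n0 cP xn)).
Qed.

Lemma root_dpolyP n x : (0 < n)%N ->
  root (dpoly E n) x <-> exists m, [/\ (m %| n)%N, (2 < m)%N & exact_x m x].
Proof.
move=> n0; have two_neq0 : 2 != 0 :> C by rewrite char0.
have [rs [_ Dn nzB _ _]] := torsion_count char0 E_nonsing n0.
have nzd : dpoly E n != 0 by apply: dpoly_neq0.
have [y xy] := exists_over E x.
have sqrt2 := two_torsionP char0 E_nonsing xy.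
have B2 : twoY E x y = 0 <-> (two_tors_poly E).[x] = 0.
  rewrite horner_two_tors -(twoY_sqr char0 xy); split=> [->|/eqP]; first by rewrite expr0n.
  by rewrite expf_eq0 => /eqP.
split=> [nx|[m [mn m2 xm]]].
  have Bx : (two_tors_poly E).[x] != 0.
    by apply: nzB; move: nx; rewrite Dn rootZ ?lead_coef_eq0// root_prod_XsubC.
  have nP : mulP E n (Some (x, y)) = None.
    by apply/(torsion_x char0 E_nonsing n0 xy); rewrite nx.
  have [d dn dP] := exact_order_exists char0 E_nonsing n0 (conj xy nP : torsion E n _).
  exists d; split=> //; last by exists y.
  have d0 := dvdn_gt0 n0 dn; case: dP => _ + _.
  case: d d0 {dn} => [|[|[|d]]]// _.
  by move=> /sqrt2/B2/eqP; rewrite (negPf Bx).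
have m0 : (0 < m)%N by apply: leq_trans m2.
have [_ mP mmin] := exact_x_over m0 xy xm.
have nP := mulP_dvd two_neq0 E_nonsing xy mn mP.
move/(torsion_x char0 E_nonsing n0 xy)/orP: nP => [//|/andP[_ /rootP Bx]].
by case: (mmin 2); [rewrite m2|apply/sqrt2/B2].
Qed.

Lemma splits_on_dpoly n : (0 < n)%N -> splits_on (dpoly E n)
  (fun x => exists m, [/\ (m %| n)%N, (2 < m)%N & exact_x m x]).
Proof.
move=> n0; have [rs [urs Dn _ _ _]] := torsion_count char0 E_nonsing n0.
have nzd : dpoly E n != 0 by apply: dpoly_neq0.
split=> //; exists rs; split=> // x; rewrite -root_dpolyP//.
by rewrite Dn rootZ ?lead_coef_eq0// root_prod_XsubC.
Qed.

End PrimitiveRoots.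

Section PrimitiveDivision.
Variables (K : fieldType) (C : closedFieldType) (iota : {rmorphism K -> C}).
Variable E : weierstrass K.
Hypothesis char0 : forall n, (n%:R == 0 :> K) = (n == 0)%N.
Hypothesis E_nonsing : discriminant E != 0.
Local Notation EC := (map_weierstrass iota E).

Lemma char0_map n : (n%:R == 0 :> C) = (n == 0)%N.
Proof. by rewrite -(rmorph_nat iota) fmorph_eq0 char0. Qed.

Lemma nonsingular_map : nonsingular (two_tors_poly EC).
Proof.
by apply: discriminant_nonsingular; rewrite ?char0_map// map_discriminant fmorph_eq0.
Qed.

Lemma balanced_prod (mu : K) (r : seq nat) (p : nat -> {poly K}) :
    (forall i, i \in r -> exists d c, c != 0 /\ balanced mu (p i) d c) ->
  exists d c, c != 0 /\ balanced mu (\prod_(i <- r) p i) d c.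
Proof.
elim: r => [_|i r IH h].
  by rewrite big_nil; exists 0%N, 1; split; [exact: oner_neq0|exact: balanced1].
have [d [c [nzc b]]] := h i (mem_head _ _).
have [|d' [c' [nzc' b']]] := IH; first by move=> j jr; apply: h; rewrite inE jr orbT.
by exists (d + d')%N, (c * c'); rewrite big_cons mulf_neq0//; split=> //; apply: balancedM.
Qed.

(** By strong induction, the T_m for the divisors m of n with 2 < m < n have simple and pairwise
    disjoint roots, all of them roots of [dpoly E n]; so their product divides it over C, hence over
    K. The quotient keeps the roots of exact order n, and inherits the mean root by
    [balanced_divl]. *)
Lemma primdivpolyP n : (2 < n)%N -> [/\ polyFF E (primdivpoly E n) = primpsi E n,
  splits_on (map_poly iota (primdivpoly E n)) (exact_x EC n) &
  exists d c, c != 0 /\ balanced (mean_x E) (primdivpoly E n) d c].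
Proof.
have two_neq0 : 2 != 0 :> K by rewrite char0.
have [k] := ubnP n; elim: k n => // k IH n; rewrite ltnS => nk n2.
have n0 : (0 < n)%N by apply: leq_trans n2.
set ms := [seq m <- divisors n | (2 < m)%N && (m != n)].
have msP m : m \in ms -> [/\ (m %| n)%N, (2 < m)%N & (m < n)%N].
  rewrite mem_filter -dvdn_divisors// => /andP[/andP[m2 m_neq] mn].
  by split=> //; rewrite ltn_neqAle m_neq dvdn_leq.
have msP' m : (m %| n)%N -> (2 < m)%N -> m != n -> m \in ms.
  by move=> mn m2 m_neq; rewrite mem_filter m2 m_neq -dvdn_divisors.
have IHm m : m \in ms -> _ := fun h => let: And3 mn m2 ml := msP m h in
  IH m (leq_trans ml nk) m2.
set Q := \prod_(m <- ms) primdivpoly E m.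
have Qs : splits_on (map_poly iota Q)
    (fun x => exists2 m, m \in ms & (2 < m)%N /\ exact_x EC m x).
  rewrite rmorph_prod; apply: splits_on_prod; first by rewrite filter_uniq ?divisors_uniq.
    move=> m mms; have [_ m2 _] := msP m mms.
    have [_ [nz [rs [urs Drs rsP]]] _] := IHm m mms; split=> //; exists rs; split=> // x.
    by rewrite rsP; split=> [|[]].
  move=> i j x [i2 xi] [j2 xj].
  by apply: (exact_x_inj char0_map nonsingular_map _ _ xi xj); apply: leq_trans (_ : 2 < _)%N.
have Ds := splits_on_dpoly char0_map nonsingular_map n0; rewrite map_dpoly in Ds.
have sub x : (exists2 m, m \in ms & (2 < m)%N /\ exact_x EC m x) ->
    exists m, [/\ (m %| n)%N, (2 < m)%N & exact_x EC m x].
  by move=> [m mms [m2 xm]]; exists m; split=> //; have [] := msP m mms.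
have := splits_on_dvd Ds Qs sub; rewrite dvdp_map => /dvdpP[T DT].
have nzd : dpoly E n != 0 by apply: dpoly_neq0.
have small m : (m %| n)%N -> (2 < m < n)%N ->
    polyFF E (primdivpoly E m) = primpsi E m.
  by move=> mn /andP[m2 ml]; have [] := IHm m (msP' m mn m2 (negbT (ltn_eqF ml))).
have DT' := DT; rewrite /Q big_filter in DT'.
have [TE Tn] := primdivpoly_quotient two_neq0 n2 small nzd DT'.
rewrite Tn; split=> //.
  move: Ds; rewrite DT rmorphM => Ds; have [nz [rs [urs Drs rsP]]] := splits_on_div Ds Qs sub.
  split=> //; exists rs; split=> // x; rewrite rsP; split.
    move=> [[m [mn m2 xm]] h]; have [<-//|m_neq] := eqVneq m n.
    by case: h; exists m => //; apply: msP'.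
  move=> xn; split; first by exists n; rewrite dvdnn.
  move=> [m mms [m2 xm]]; have [_ _ ml] := msP m mms.
  have e : m = n.
    by apply: (exact_x_inj char0_map nonsingular_map _ _ xm xn); first apply: leq_trans m2.
  by rewrite e ltnn in ml.
have [|dQ [cQ [nzcQ bQ]]] := @balanced_prod (mean_x E) ms (primdivpoly E).
  by move=> m mms; have [] := IHm m mms.
have bD := balanced_dpoly E char0 n0.
have nzl : dpoly_lead K n != 0.
  rewrite /dpoly_lead; case: ifP => _; rewrite char0 -lt0n//.
  by rewrite half_gt0 ltnW.
have sQ := (top2_size nzcQ bQ).1; have sD := (top2_size nzl bD).1.
have le_d : (dQ <= dpoly_deg n)%N.
  by rewrite -ltnS -sQ -sD dvdp_leq// DT dvdp_mull.
exists (dpoly_deg n - dQ)%N, (dpoly_lead K n / cQ); split.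
  by rewrite mulf_neq0 ?invr_eq0.
apply: (balanced_divl nzcQ _ _ bQ); first by rewrite mulf_neq0 ?invr_eq0.
by rewrite subnKC// [cQ * _]mulrC mulfVK// mulrC -DT.
Qed.

End PrimitiveDivision.

(** * The characteristic polynomial of multiplication by u *)

(** Dedekind's argument: evaluating a relation at a b and subtracting [ev i a] times its value at b
    removes the i-th term. *)
Lemma dedekind_independence (A : nzRingType) (C : fieldType) (N : nat)
    (ev : 'I_N -> {rmorphism A -> C}) (w : 'I_N -> C) :
    (forall i j, i != j -> exists a, ev i a != ev j a) ->
    (forall a, \sum_i w i * ev i a = 0) -> forall i, w i = 0.
Proof.
move=> dis; have [k] := ubnP #|[pred i | w i != 0]|.
elim: k w => // k IH w; rewrite ltnS => wk rel.
have [/existsP[i wi]|/existsPn h] := boolP [exists i, w i != 0]; last first.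
  by move=> i; apply/eqP; have := h i; rewrite negbK.
suff wj j : j != i -> w j = 0.
  have := rel 1; rewrite (bigD1 i)//= big1 ?rmorph1 ?mulr1 ?addr0.
    by move/eqP; rewrite (negPf wi).
  by move=> j ji; rewrite wj// mul0r.
move=> ji; have [a ev_a] := dis j i ji.
pose w' l := w l * (ev l a - ev i a).
have : w' j = 0.
  apply: IH => [|b].
    apply: leq_trans wk; apply: proper_card; apply/properP; split.
      by apply/fintype.subsetP => l; rewrite !inE /w' mulf_eq0 negb_or => /andP[].
    by exists i; rewrite !inE ?wi// /w' subrr mulr0 eqxx.
  transitivity (\sum_l w l * ev l (a * b) - ev i a * \sum_l w l * ev l b).
    by rewrite mulr_sumr -sumrB; apply: eq_bigr => l _; rewrite /w' rmorphM; ring.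
  by rewrite !rel mulr0 subr0.
by move/eqP; rewrite /w' mulf_eq0 subr_eq0 (negPf ev_a) orbF => /eqP.
Qed.

Section QuotientEvaluation.
Variables (R S : comNzRingType) (h : {poly R}) (f : {rmorphism R -> S}) (y : S).
Hypotheses (h_monic : h \is monic) (sh : (1 < size h)%N).
Hypothesis hy : root (map_poly f h) y.

Definition qeval (v : {poly %/ h}) : S := (map_poly f (v : {poly R})).[y].

Lemma qeval_in p : qeval (in_qpoly h p) = (map_poly f p).[y].
Proof.
have Dh : mk_monic h = h by rewrite /mk_monic sh h_monic.
rewrite {2}(Pdiv.RingMonic.rdivp_eq h_monic p) rmorphD rmorphM hornerD hornerM.
by rewrite (rootP hy) mulr0 add0r /qeval /= Dh.
Qed.

Lemma qeval_is_zmod_morphism : zmod_morphism qeval.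
Proof. by move=> u v; rewrite /qeval -hornerN -hornerD -rmorphB. Qed.

Lemma qeval_is_monoid_morphism : monoid_morphism qeval.
Proof.
split; first by rewrite /qeval /= rmorph1 hornerC.
move=> u v; rewrite -[u * v]/(in_qpoly h ((u : {poly R}) * (v : {poly R}))).
by rewrite qeval_in rmorphM hornerM.
Qed.

Lemma qevalX : qeval 'qX = y.
Proof. by rewrite qeval_in map_polyX hornerX. Qed.

Lemma qevalC c : qeval (qpolyC h c) = f c.
Proof. by rewrite /qeval qpolyCE map_polyC hornerC. Qed.

Lemma quotient_evaluation : exists e : {rmorphism {poly %/ h} -> S},
  e 'qX = y /\ forall c, e (qpolyC h c) = f c.
Proof.
pose e : {rmorphism {poly %/ h} -> S} := HB.pack qeval
  (GRing.isZmodMorphism.Build _ _ qeval qeval_is_zmod_morphism)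
  (GRing.isMonoidMorphism.Build _ _ qeval qeval_is_monoid_morphism).
by exists e; split; [exact: qevalX|exact: qevalC].
Qed.

End QuotientEvaluation.

Section RegularCharPoly.
Variables (K C : fieldType) (iota : {rmorphism K -> C}) (A : falgType K).
Variable ev : 'I_(\dim {:A}) -> {rmorphism A -> C}.
Hypothesis evZ : forall i c a, ev i (c *: a) = iota c * ev i a.
Hypothesis ev_dis : forall i j, i != j -> exists a, ev i a != ev j a.

(** There are as many distinct characters as the dimension. Their values on a basis form a matrix V
    that is invertible by independence and that conjugates multiplication by u to the diagonal
    matrix of the [ev i u]. *)
Lemma map_char_poly_amull (u : A) :
  map_poly iota (char_poly_amull u) = \prod_i ('X - (ev i u)%:P).
Proof.
set b := vbasis {:A}; pose M := passmx.mxof b b (amull u).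
pose V : 'M[C]_(\dim {:A}) := \matrix_(i, j) ev j b`_i.
pose D : 'M[C]_(\dim {:A}) := diag_mx (\row_i ev i u).
have bP : basis_of {:A} b := vbasisP {:A}.
have ev_sum j (a : A) : ev j a = \sum_i iota (coord b i a) * ev j b`_i.
  rewrite {1}(coord_vbasis (memvf a)) rmorph_sum.
  by apply: eq_bigr => i _; rewrite evZ.
have MV : map_mx iota M *m V = V *m D.
  apply/matrixP => i j; rewrite mul_mx_diag !mxE.
  have -> : ev j b`_i * ev j u = ev j (amull u b`_i) by rewrite lfunE /= rmorphM mulrC.
  rewrite (ev_sum j (amull u _)); apply: eq_bigr => k _; rewrite !mxE; congr (iota _ * _).
  congr (coord b k (amull u _)); rewrite /passmx.vecof (bigD1 i)//= big1 => [|l li].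
    by rewrite mxE !eqxx scale1r addr0.
  by rewrite mxE (negPf li) andbF scale0r.
have V_unit : V \in unitmx.
  rewrite -unitmx_tr -row_free_unit -kermx_eq0; apply/rowV0P => w /sub_kermxP wV.
  apply/rowP => j; rewrite mxE; apply: (dedekind_independence ev_dis (w := fun j => w 0 j)).
  move=> a; under eq_bigr do rewrite ev_sum mulr_sumr.
  rewrite exchange_big big1// => i _.
  transitivity (iota (coord b i a) * (w *m V^T) 0 i); last by rewrite wV mxE mulr0.
  rewrite mxE mulr_sumr; apply: eq_bigr => k _; rewrite !mxE; ring.
rewrite /char_poly_amull map_char_poly -/M.
have nzV : (\det V)%:P != 0 by rewrite polyC_eq0 -unitfE -unitmxE.
rewrite -[RHS](_ : char_poly D = _); last first.
  rewrite char_poly_trig ?diag_mx_is_trig//; apply: eq_bigr => i _.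
  by rewrite !mxE eqxx mulr1n.
apply: (mulIf nzV); rewrite [RHS]mulrC -det_map_mx /char_poly -!det_mulmx.
congr (\det _); rewrite /char_poly_mx mulmxBl mulmxBr -!map_mxM MV.
by rewrite mul_scalar_mx mul_mx_scalar.
Qed.

End RegularCharPoly.

Lemma map_wpoly (R S : comNzRingType) (f : {rmorphism R -> S}) (E : weierstrass R) x :
  map_poly f (wpoly E x) = wpoly (map_weierstrass f E) (f x).
Proof.
rewrite /wpoly rmorphB rmorphD /= map_polyXn rmorphM /= map_polyX !map_polyC /=.
by rewrite !(rmorphD, rmorphM, rmorphXn).
Qed.

Lemma root_wpoly (F : fieldType) (E : weierstrass F) x y :
  root (wpoly E x) y = on_curve E (Some (x, y)).
Proof.
rewrite /root /wpoly /= hornerD hornerN hornerD hornerXn hornerM hornerX !hornerC.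
by rewrite subr_eq0 mulrDl addrA.
Qed.

Lemma qpoly_scaleE (R : comNzRingType) (h : {poly R}) (c : R) (v : {poly %/ h}) :
  c *: v = qpolyC h c * v.
Proof.
rewrite -{1}(mul1r v) scalerAl; congr (_ * _); apply: val_inj.
by rewrite /= alg_polyC.
Qed.

Section PointEvaluation.
Variables (K : fieldType) (C : closedFieldType) (iota : {rmorphism K -> C}).
Variables (E : weierstrass K) (T : {poly K}).
Hypothesis sT : (1 < size T)%N.
Local Notation EC := (map_weierstrass iota E).
Let g : {poly K} := (lead_coef T)^-1 *: T.
Local Notation A := (quotAlg E T).

Lemma monic_associate : g \is monic.
Proof.
have nzT : T != 0 by rewrite -size_poly_gt0 ltnW.
by rewrite monicE lead_coefZ mulVf// lead_coef_eq0.
Qed.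

Lemma size_associate : size g = size T.
Proof.
have nzT : T != 0 by rewrite -size_poly_gt0 ltnW.
by rewrite size_scale// invr_eq0 lead_coef_eq0.
Qed.

Lemma dim_quotAlg : \dim {:A} = (2 * (size T).-1)%N.
Proof.
rewrite dimvf -[LHS]/(((size (mk_monic (wquot E T))).-1 * (size (mk_monic g)).-1)%N).
have -> : mk_monic g = g by rewrite /mk_monic size_associate sT monic_associate.
have -> : mk_monic (wquot E T) = wquot E T by rewrite /mk_monic size_wpoly monic_wpoly.
by rewrite size_wpoly size_associate.
Qed.

Variables (x y : C).
Hypotheses (Tx : root (map_poly iota T) x) (xy : on_curve EC (Some (x, y))).

Lemma root_associate : root (map_poly iota g) x.
Proof. by rewrite map_polyZ /root hornerZ (rootP Tx) mulr0. Qed.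

Lemma point_evaluation : exists ev : {rmorphism A -> C},
  [/\ forall c a, ev (c *: a) = iota c * ev a, ev (xA E T) = x & ev (yA E T) = y].
Proof.
have sg : (1 < size g)%N by rewrite size_associate.
have [e1 [e1X e1C]] := quotient_evaluation monic_associate sg root_associate.
have wy : root (map_poly e1 (wquot E T)) y.
  rewrite /wquot map_wpoly e1X /map_weierstrass /= !e1C.
  by rewrite -[Weierstrass _ _ _ _ _]/EC root_wpoly.
have sw : (1 < size (wquot E T))%N by rewrite size_wpoly.
have [e2 [e2X e2C]] := quotient_evaluation (monic_wpoly _ _) sw wy.
exists e2; split=> //; last by rewrite /xA e2C e1X.
move=> c a; rewrite -[c *: a]/((qpolyC g c : {poly %/ g}) *: (a : {poly %/ wquot E T})).
by rewrite qpoly_scaleE (rmorphM e2) e2C e1C.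
Qed.

End PointEvaluation.

Section CharPolyRoots.
Variables (K : fieldType) (C : closedFieldType) (iota : {rmorphism K -> C}).
Variable E : weierstrass K.
Hypothesis char0 : forall n, (n%:R == 0 :> K) = (n == 0)%N.
Hypothesis E_nonsing : discriminant E != 0.
Local Notation EC := (map_weierstrass iota E).
Let char0C := char0_map iota char0.
Let EC_nonsing : nonsingular (two_tors_poly EC).
Proof. exact: nonsingular_map. Qed.

Lemma exact_order_twoY n x y : (2 < n)%N -> exact_order EC n (Some (x, y)) ->
  twoY EC x y != 0.
Proof.
move=> n2 [xy _ mP]; apply/eqP => /(two_torsionP char0C EC_nonsing xy).
by apply: mP; rewrite n2.
Qed.

Lemma exact_order_points n : (2 < n)%N -> exists ps : seq (C * C),
  [/\ uniq ps, size ps = (2 * (size (primdivpoly E n)).-1)%N,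
      forall p, p \in ps <-> exact_order EC n (Some p) &
      exists2 rs, map fst ps = rs ++ rs & map_poly iota (primdivpoly E n) =
        lead_coef (map_poly iota (primdivpoly E n)) *: \prod_(x <- rs) ('X - x%:P)].
Proof.
move=> n2; have n0 : (0 < n)%N by apply: leq_trans n2.
have [_ [nzT [rs [urs DT rsP]]] _] := primdivpolyP iota char0 E_nonsing n2.
have [y_ y_P] := choice (exists_over EC).
pose y' x := - y_ x - a1 EC * x - a3 EC.
have yy' x : x \in rs -> y_ x != y' x.
  move=> /rsP/(exact_x_over char0C EC_nonsing n0 (y_P x))/(exact_order_twoY n2).
  have -> : twoY EC x (y_ x) = y_ x - y' x by rewrite /twoY /y'; ring.
  by rewrite subr_eq0.
exists ([seq (x, y_ x) | x <- rs] ++ [seq (x, y' x) | x <- rs]); split.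
- rewrite cat_uniq !map_inj_uniq ?urs => [|x z [->]|x z [->]]//.
  rewrite andbT; apply/hasPn => _ /mapP[x xrs ->]; apply/negP => /mapP[z _ [<- e]].
  by have := yy' x xrs; rewrite e eqxx.
- rewrite size_cat !size_map addnn -mul2n -(size_map_poly iota) DT.
  by rewrite size_scale ?lead_coef_eq0// size_prod_XsubC.
2: by exists rs => //; rewrite map_cat -!map_comp !map_id.
move=> [x y]; rewrite mem_cat; split.
  move=> /orP[/mapP[z /rsP zn [-> ->]]|/mapP[z /rsP zn [-> ->]]].
    exact: exact_x_over.
  have := exact_x_over char0C EC_nonsing n0 (y_P z) zn.
  by move/(exact_order_opp char0C EC_nonsing n0).
move=> xyn; have [cP _ _] := xyn; have xrs : x \in rs by apply/rsP; exists y.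
have two_neq0 : 2 != 0 :> C by rewrite char0C.
have [[->]|[->]] := oppP_eq_X two_neq0 cP (y_P x) erefl.
  by rewrite (map_f (fun x => (x, y_ x))).
by rewrite (map_f (fun x => (x, y' x))) ?orbT.
Qed.

Lemma map_chi alpha beta gamma n : (2 < n)%N -> exists ps : seq (C * C),
  [/\ uniq ps, forall p, p \in ps <-> exact_order EC n (Some p),
      (1 < size (primdivpoly E n))%N ->
      map_poly iota (chi E alpha beta gamma n) =
      \prod_(p <- ps) ('X - (iota alpha * p.1 + iota beta * p.2 + iota gamma)%:P)
    & size ps = (2 * (size (primdivpoly E n)).-1)%N].
Proof.
move=> n2; have [ps [ups sps psP _]] := exact_order_points n2.
have [_ Tn _] := primdivpolyP iota char0 E_nonsing n2.
exists ps; split=> // sT; set T := primdivpoly E n in sT Tn sps *.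
have Dps : \dim {:quotAlg E T} = size ps by rewrite dim_quotAlg.
pose p_ (i : 'I_(\dim {:quotAlg E T})) := nth (0, 0) ps i.
have p_ps i : p_ i \in ps by rewrite mem_nth// -Dps.
have ex_ev i : exists e : {rmorphism quotAlg E T -> C},
    [/\ forall c a, e (c *: a) = iota c * e a, e (xA E T) = (p_ i).1 & e (yA E T) = (p_ i).2].
  have /psP := p_ps i; case: (p_ i) => x y xyn /=; have [cP _ _] := xyn.
  by apply: point_evaluation => //; apply/(splits_on_root x Tn); exists y.
have /choice[ev evP] := ex_ev.
have ev_dis i j : i != j -> exists a, ev i a != ev j a.
  move=> ij; have [_ xi yi] := evP i; have [_ xj yj] := evP j.
  apply: contrapT => h; move: ij; rewrite -val_eqE /=.
  have e a : ev i a = ev j a by apply/eqP/negPn/negP => na; apply: h; exists a.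
  have pij : p_ i = p_ j.
    by rewrite [LHS]surjective_pairing [RHS]surjective_pairing -xi -yi -xj -yj !e.
  by rewrite -(nth_uniq (0, 0) _ _ ups) -?Dps// -/(p_ i) pij eqxx.
rewrite /chi (map_char_poly_amull (iota := iota) (ev := ev))//; last first.
  by move=> i c a; have [] := evP i.
rewrite (big_nth (0, 0)) big_mkord -Dps; apply: eq_bigr => i _.
have [evZ xi yi] := evP i; rewrite /affA !rmorphD /= !evZ xi yi rmorph1 mulr1.
by [].
Qed.

End CharPolyRoots.

(** * The Galois action on torsion points *)

Lemma uniq_map_inj_in (S T : eqType) (f : S -> T) (s : seq S) :
  uniq (map f s) -> {in s &, injective f}.
Proof.
elim: s => // z s IH /= /andP[zs us] x y; rewrite !inE.
move=> /orP[/eqP ->|xs] /orP[/eqP ->|ys] e //; last exact: IH.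
  by rewrite e map_f in zs.
by rewrite -e map_f in zs.
Qed.

Section GaloisPoints.
Variables (K : fieldType) (C : closedFieldType) (iota : {rmorphism K -> C}).
Hypothesis iota_int : integralRange iota.
Variable E : weierstrass K.
Hypothesis char0 : forall n, (n%:R == 0 :> K) = (n == 0)%N.
Hypothesis E_nonsing : discriminant E != 0.
Local Notation EC := (map_weierstrass iota E).
Local Notation G := (absGal iota).
Let char0C := char0_map iota char0.
Let EC_nonsing : nonsingular (two_tors_poly EC).
Proof. exact: nonsingular_map. Qed.
Let two_neq0 : 2 != 0 :> C.
Proof. by rewrite char0C. Qed.

Lemma galP_mul (s : G) n P : galP s (mulP EC n P) = mulP EC n (galP s P).
Proof. by elim: n => [//|n IH]; rewrite !mulPS galP_add IH. Qed.

Lemma galP_opp (s : G) P : galP s (oppP EC P) = oppP EC (galP s P).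
Proof.
by case: P => [[x y]|]//=; rewrite !(rmorphB, rmorphN, rmorphM)/= !absGal_fix.
Qed.

Lemma galP_comp (s t u : G) P : (forall x, u x = s (t x)) ->
  galP u P = galP s (galP t P).
Proof. by move=> uE; case: P => [[x y]|]//=; rewrite !uE. Qed.

Lemma galP_exact (s : G) n P : exact_order EC n P -> exact_order EC n (galP s P).
Proof.
move=> [cP nP mP]; split; first exact: galP_on_curve.
  by rewrite -galP_mul nP.
by move=> m mn; rewrite -galP_mul => h; apply: (mP m mn); apply: (@galP_inj _ _ iota s).
Qed.

Variable n : nat.
Hypothesis n2 : (2 < n)%N.
Let n0 : (0 < n)%N. Proof. exact: leq_trans n2. Qed.
Local Notation X := (torsion_fset EC n).

Lemma rhoE (s : G) (P : X) : val (rho E n s P) = galP s (val P).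
Proof. by rewrite permE. Qed.

Lemma rho_comp (s t u : G) : (forall x, u x = s (t x)) ->
  (rho E n u = rho E n t * rho E n s)%g.
Proof.
move=> uE; apply/permP => P; apply: val_inj.
by rewrite permM !rhoE; apply: galP_comp.
Qed.

Lemma rho_in s : rho E n s \in rho_image iota E n.
Proof. by rewrite inE; apply/asboolP; exists s. Qed.

Lemma rho_imageP h : h \in rho_image iota E n -> exists s, rho E n s = h.
Proof. by rewrite inE => /asboolP[s ->]; exists s. Qed.

Lemma rho_image_group : group_set (rho_image iota E n).
Proof.
apply/group_setP; split.
  have [u uE] := absGal_id iota_int.
  have -> : 1%g = rho E n u; last exact: rho_in.
  apply/permP => P; apply: val_inj; rewrite perm1 rhoE.
  by case: (val P) => [[x y]|]//=; rewrite !uE.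
move=> _ _ /rho_imageP[s <-] /rho_imageP[t <-].
have [u uE] := absGal_comp iota_int t s.
by rewrite -(rho_comp uE) rho_in.
Qed.

Lemma pm_idP (g : {perm X}) : reflect
  ((forall P, g P = P) \/ (forall P, val (g P) = oppP EC (val P)))
  (g \in pm_id iota E n).
Proof.
rewrite inE; apply: (iffP orP) => -[h|h].
- by left=> P; apply/eqP; move/forallP: h.
- by right=> P; apply/eqP; move/forallP: h.
- by left; apply/forallP => P; rewrite h.
by right; apply/forallP => P; rewrite h.
Qed.

Lemma pm_id_group : group_set (pm_id iota E n).
Proof.
apply/group_setP; split; first by apply/pm_idP; left=> P; rewrite perm1.
move=> g h /pm_idP gP /pm_idP hP; apply/pm_idP.
case: gP hP => gP [hP|hP].
- by left=> P; rewrite permM gP hP.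
- by right=> P; rewrite permM gP hP.
- by right=> P; rewrite permM hP gP.
by left=> P; apply: val_inj; rewrite permM hP gP oppPK.
Qed.

Lemma rho_norm_pm_id (s : G) : rho E n s \in 'N(pm_id iota E n)%g.
Proof.
rewrite inE; apply/fintype.subsetP => _ /imsetP[x /pm_idP xP ->]; apply/pm_idP.
case: xP => xP; [left|right] => P; rewrite /conjg !permM; first by rewrite xP permKV.
by rewrite rhoE xP galP_opp -rhoE permKV.
Qed.

Lemma torsion_elt P : exact_order EC n P -> P \in X.
Proof. by move/exact_order_torsion => ?; apply/(torsion_fsetP char0C EC_nonsing n0). Qed.

Lemma torsion_eltP (P : X) : torsion EC n (val P).
Proof. by apply/(torsion_fsetP char0C EC_nonsing n0)/(valP P). Qed.

Lemma rho_pm_id (s : G) :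
    (forall P, exact_order EC n P -> galP s P = P \/ galP s P = oppP EC P) ->
  (forall P : X, rho E n s P = P) \/ (forall P : X, val (rho E n s P) = oppP EC (val P)).
Proof.
move=> h; have [e1 [e2 [te1 te2 gen free]]] := torsion_basis char0C EC_nonsing n0.
have [H|H] := pm_endomorphism char0C EC_nonsing n0 te1 te2 gen free n2
  (galP_add E s) (erefl _) h.
  by left=> P; apply: val_inj; rewrite rhoE; apply/H/torsion_eltP.
by right=> P; rewrite rhoE; apply/H/torsion_eltP.
Qed.

Lemma exact_point_exists : exists p, exact_order EC n (Some p).
Proof.
have [e1 [e2 [te1 te2 gen free]]] := torsion_basis char0C EC_nonsing n0.
have := exact_order_comb char0C EC_nonsing n0 te1 te2 free (coprimen1 0).
case: addP => [p|[_ _ mP]]; first by exists p.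
by case: (mP 1%N (ltnW n2)).
Qed.

Lemma size_primdivpoly : (1 < size (primdivpoly E n))%N.
Proof.
have [_ Tn _] := primdivpolyP iota char0 E_nonsing n2.
have [[x y] xyn] := exact_point_exists.
have /root_size_gt1 : root (map_poly iota (primdivpoly E n)) x.
  by apply/(splits_on_root x Tn); exists y.
by rewrite size_map_poly; apply; have [] := Tn.
Qed.

Lemma primdivpoly_isog :
  (galoisGroup (primdivpoly E n) \isog rho_image iota E n / pm_id iota E n)%g.
Proof.
have [_ Tn _] := primdivpolyP iota char0 E_nonsing n2.
pose P : {group {perm X}} := group pm_id_group.
pose H : {group {perm X}} := group rho_image_group.
have nP s : rho E n s \in 'N(P)%g := rho_norm_pm_id s.
apply: (galoisGroup_isog iota_int (H := (H / P)%G) (phi := fun s => coset P (rho E n s))).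
- by rewrite -size_poly_gt0; apply: ltnW size_primdivpoly.
- by move=> s; apply: mem_quotient; apply: rho_in.
- move=> _ /morphimP[h _ /rho_imageP[s <-] ->]; by exists s.
- by move=> s t u uE; rewrite (rho_comp uE) (morphM (coset_morphism P)) ?nP.
move=> s; split=> [/(coset_idr (nP s))/pm_idP h x /(splits_on_root x Tn)[y xyn]|h].
  have e := rhoE s [` torsion_elt xyn]%fset.
  by case: h => h; rewrite h /= in e; case: e => <-.
apply: coset_id; apply/pm_idP/rho_pm_id => -[[x y]|]; last by left.
move=> xyn; have [cP _ _] := xyn; have cs := galP_on_curve s cP.
apply: oppP_eq_X => //=; congr Some; apply: h.
by apply/(splits_on_root x Tn); exists y.
Qed.

Lemma transitive_primdivpoly :
  gal_transitive iota E n -> irreducible_poly (primdivpoly E n).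
Proof.
move=> tr; have [_ [nzT [rs [urs DT rsP]]] _] := primdivpolyP iota char0 E_nonsing n2.
apply: (transitive_irreducible (rs := rs) (iota := iota)) => //.
- have [[x y] xyn] := exact_point_exists.
  have : x \in rs by apply/rsP; exists y.
  by case: (rs).
- by move: nzT; rewrite map_poly_eq0.
move=> x x' /rsP[y xyn] /rsP[y' xyn'].
by have [s [<- _]] := tr _ _ xyn xyn'; exists s.
Qed.

Variables (alpha beta gamma : K).
Hypothesis beta_neq0 : beta != 0.
Hypothesis slope : 2 * alpha != beta * a1 E.
Local Notation u p := (iota alpha * p.1 + iota beta * p.2 + iota gamma).

Lemma chi_neq0 : chi E alpha beta gamma n != 0.
Proof. exact: monic_neq0 (char_poly_monic _). Qed.

Lemma u_galP (s : G) p q : galP s (Some p) = Some q -> s (u p) = u q.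
Proof. by move=> [<-]; rewrite !(rmorphD, rmorphM) /= !absGal_fix. Qed.

(* The two hypotheses read u(P) = u(P') and u(-P) = u(-P'). *)
Lemma u_pair_inj x y x' y' : u (x, y) = u (x', y') ->
    u (x, - y - a1 EC * x - a3 EC) = u (x', - y' - a1 EC * x' - a3 EC) ->
  x = x' /\ y = y'.
Proof.
move=> /= e1 e2; have nzb : iota beta != 0 by rewrite fmorph_eq0.
have nzs : 2 * iota alpha - iota beta * iota (a1 E) != 0.
  by rewrite -(rmorph_nat iota) -!rmorphM -rmorphB fmorph_eq0 subr_eq0.
(* Adding the two equations: u(P) + u(-P) = (2 alpha - beta a1) x(P) - beta a3 + 2 gamma. *)
have xx' : x = x'.
  apply/eqP; rewrite -subr_eq0 -(mulrI_eq0 _ (lregP nzs)); apply/eqP.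
  apply: etrans (_ : (_ + _) - (_ + _) = 0); last first.
    by apply/eqP; rewrite subr_eq0; apply/eqP; apply: congr2 e1 e2.
  by rewrite /=; ring.
split=> //; apply: (mulfI nzb); move: e1; rewrite xx' => /addIr/addrI.
by [].
Qed.

Lemma chi_isog : (galoisGroup (chi E alpha beta gamma n) \isog rho_image iota E n)%g.
Proof.
have [ps [ups psP Dchi _]] := map_chi iota char0 E_nonsing alpha beta gamma n2.
have {}Dchi := Dchi size_primdivpoly.
have uroot p : exact_order EC n (Some p) ->
    root (map_poly iota (chi E alpha beta gamma n)) (u p).
  move=> /psP pp; rewrite Dchi -(big_map (fun p => u p) predT (fun z => 'X - z%:P)).
  by rewrite root_prod_XsubC (map_f (fun p => u p)).
apply: (galoisGroup_isog iota_int (H := group rho_image_group) (phi := rho E n)).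
- exact: chi_neq0.
- exact: rho_in.
- by move=> h /rho_imageP.
- by move=> s t v vE; apply: rho_comp.
move=> s; split=> [s1 z|h].
  rewrite Dchi -(big_map (fun p => u p) predT (fun z => 'X - z%:P)) root_prod_XsubC.
  move=> /mapP[p /psP pn ->]; apply: u_galP.
  by have := rhoE s [` torsion_elt pn]%fset; rewrite s1 perm1 /= => ->.
have fix_exact P : exact_order EC n P -> galP s P = P.
  case: P => [[x y]|]// xyn.
  have [s1 s2] : s x = x /\ s y = y.
    have e1 := h _ (uroot _ xyn); have e2 := h _ (uroot _ (exact_order_opp char0C EC_nonsing n0 xyn)).
    apply: u_pair_inj.
      by rewrite -[RHS]e1 !(rmorphD, rmorphM) /= !absGal_fix.
    by rewrite -[RHS]e2 !(rmorphD, rmorphB, rmorphN, rmorphM) /= !absGal_fix.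
  by rewrite /= s1 s2.
(* The other possibility, that s acts as -id, is refuted by a fixed point of exact order n > 2,
   which differs from its opposite. *)
have [||h1] := @rho_pm_id s.
- by move=> P Pn; left; apply: fix_exact.
- by move=> h1; apply/permP => P; rewrite h1 perm1.
have [[x y] xyn] := exact_point_exists; have := exact_order_twoY char0 E_nonsing n2 xyn.
have := h1 [` torsion_elt xyn]%fset; rewrite rhoE /= => -[] _.
have [_ ->] : s x = x /\ s y = y by have [-> ->] := fix_exact _ xyn.
move=> e; rewrite /twoY => /negP[]; apply/eqP.
by apply: etrans (_ : y - (- y - a1 EC * x - a3 EC) = 0); [ring|rewrite -e subrr].
Qed.

Lemma irreducible_chi_transitive :
  irreducible_poly (chi E alpha beta gamma n) -> gal_transitive iota E n.
Proof.
have [ps [ups psP Dchi _]] := map_chi iota char0 E_nonsing alpha beta gamma n2.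
have {}Dchi := Dchi size_primdivpoly.
rewrite -(big_map (fun p => u p) predT (fun z => 'X - z%:P)) in Dchi.
have lc : lead_coef (map_poly iota (chi E alpha beta gamma n)) = 1.
  by apply/eqP; rewrite -monicE map_monic char_poly_monic.
move=> irr; have Dchi' := Dchi; rewrite -[RHS]scale1r -lc in Dchi'.
have uu := irreducible_roots_uniq char0 irr Dchi'.
have rootP p : p \in ps -> root (map_poly iota (chi E alpha beta gamma n)) (u p).
  by move=> pp; rewrite Dchi root_prod_XsubC (map_f (fun p => u p)).
move=> [p|] [q|]; last first.
- by move=> _ _; have [s _] := absGal_id iota_int; exists s.
- by move=> [_ _ /(_ 1%N (ltnW n2))].
- by move=> _ [_ _ /(_ 1%N (ltnW n2))].
move=> pn qn; have pp := (psP p).2 pn; have qq := (psP q).2 qn.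
have [s se] := irreducible_transitive iota_int irr (rootP p pp) (rootP q qq).
exists s; have sn := galP_exact s pn; rewrite /= in sn *; congr Some.
move: se; rewrite (@u_galP s p (s p.1, s p.2))//.
set p' := (s p.1, s p.2) in sn *; have pp' : p' \in ps by apply/psP.
exact: (uniq_map_inj_in uu).
Qed.

End GaloisPoints.

(** * The mean abscissa of the points of exact order d *)

Section ExactOrderMean.
Variables (K : fieldType) (C : closedFieldType) (iota : {rmorphism K -> C}).
Variable E : weierstrass K.
Hypothesis char0 : forall n, (n%:R == 0 :> K) = (n == 0)%N.
Hypothesis E_nonsing : discriminant E != 0.
Local Notation EC := (map_weierstrass iota E).
Let char0C := char0_map iota char0.
Let EC_nonsing : nonsingular (two_tors_poly EC).
Proof. exact: nonsingular_map. Qed.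
Let two_neq0 : 2 != 0 :> C.
Proof. by rewrite char0C. Qed.

Lemma map_mean_x : mean_x EC = iota (mean_x E).
Proof. by rewrite /mean_x map_b2 fmorph_div rmorph_nat. Qed.

Lemma balanced_map mu (p : {poly K}) d c :
  balanced mu p d c -> balanced (iota mu) (map_poly iota p) d (iota c).
Proof.
move=> [r sr Dp]; exists (map_poly iota r); first by rewrite size_map_poly.
have := congr1 (map_poly iota) Dp; rewrite rmorphM rmorphD rmorphM rmorphD rmorphM /=.
by rewrite !map_polyXn map_polyX !map_polyC /= rmorphM rmorph_nat.
Qed.

Lemma balanced_roots_sum (F : fieldType) (mu : F) (p : {poly F}) (rs : seq F) d c :
    c != 0 -> balanced mu p d c -> p = lead_coef p *: \prod_(x <- rs) ('X - x%:P) ->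
  \sum_(x <- rs) x = - ((size rs)%:R * mu).
Proof.
move=> nzc b Dp; have [sp lp] := top2_size nzc b.
have nzl : lead_coef p != 0 by rewrite lp.
apply: (balanced_sum nzl (c := c)); rewrite mul_polyC -Dp.
have -> // : size rs = d.
by apply: succn_inj; rewrite -sp Dp size_scale// size_prod_XsubC.
Qed.

(** For order 2 the primitive division polynomial is psi_2, no polynomial in x; its square B takes
    its place, with a single point over each root. *)
Lemma two_tors_points : exists ps : seq (C * C),
  [/\ uniq ps, forall p, p \in ps <-> exact_order EC 2 (Some p) &
      \sum_(p <- ps) p.1 = - ((size ps)%:R * mean_x EC)].
Proof.
set B := two_tors_poly EC.
have b := balanced_two_tors EC char0C; have four0 : 4 != 0 :> C by rewrite char0C.
have [sB lB] := top2_size four0 b; rewrite -/B in sB lB.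
have nzB : B != 0 by rewrite -size_poly_gt0 sB.
have [rs DB] := closed_field_poly_normal B.
have rsP x : (x \in rs) = (B.[x] == 0).
  by rewrite -[RHS]/(root B x) DB rootZ ?lB// root_prod_XsubC.
have urs : uniq rs.
  rewrite -separable_prod_XsubC.
  rewrite unlock; apply/Pdiv.ClosedField.coprimepP => x /rootP Px; apply/negP => /rootP P'x.
  have /EC_nonsing/eqP[] : (two_tors_poly EC).[x] = 0 by rewrite -/B DB hornerZ Px mulr0.
  by rewrite -/B DB derivZ hornerZ P'x mulr0.
have [y_ y_P] := choice (exists_over EC).
exists [seq (x, y_ x) | x <- rs]; split.
- by rewrite map_inj_uniq// => x z [].
- move=> [x y]; split.
    move=> /mapP[z zrs [-> ->]]; split=> //.
      apply/(two_torsionP char0C EC_nonsing (y_P z)).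
      by apply/eqP; rewrite -sqrf_eq0 (twoY_sqr char0C)// -horner_two_tors -rsP.
    by move=> [|[|m]].
  move=> [xy /(two_torsionP char0C EC_nonsing xy) y0 _]; apply/mapP; exists x.
    by rewrite rsP horner_two_tors -(twoY_sqr char0C xy) y0 expr0n.
  congr pair; apply: (twoY_inj two_neq0 (E := EC) (x := x)); rewrite y0; apply/esym/eqP.
  by rewrite -sqrf_eq0 (twoY_sqr char0C)// -(twoY_sqr char0C xy) y0 expr0n.
by rewrite big_map size_map /=; apply: (balanced_roots_sum four0 b).
Qed.

Lemma exact_order_mean d : (1 < d)%N -> exists ps : seq (C * C),
  [/\ uniq ps, forall p, p \in ps <-> exact_order EC d (Some p) &
      \sum_(p <- ps) p.1 = - ((size ps)%:R * mean_x EC)].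
Proof.
rewrite leq_eqVlt => /orP[/eqP <-|d2]; first exact: two_tors_points.
have [ps [ups sps psP [rs prs DT]]] := exact_order_points iota char0 E_nonsing d2.
have [_ _ [k [c [nzc b]]]] := primdivpolyP iota char0 E_nonsing d2.
have nzc' : iota c != 0 by rewrite fmorph_eq0.
exists ps; split=> //.
(* Two opposite points lie over each root, so the roots are listed twice and the mean is that of the
   roots. *)
rewrite -(big_map fst predT id) prs big_cat /= -(size_map fst) prs size_cat map_mean_x.
by rewrite (balanced_roots_sum nzc' (balanced_map b) DT) natrD mulrDl opprD.
Qed.
End ExactOrderMean.

Section Averaging.
Variables (K : fieldType) (C : closedFieldType) (iota : {rmorphism K -> C}).
Hypothesis iota_int : integralRange iota.
Variable E : weierstrass K.
Hypothesis char0 : forall n, (n%:R == 0 :> K) = (n == 0)%N.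
Hypothesis E_nonsing : discriminant E != 0.
Local Notation EC := (map_weierstrass iota E).
Local Notation G := (absGal iota).
Let char0C := char0_map iota char0.
Let EC_nonsing : nonsingular (two_tors_poly EC).
Proof. exact: nonsingular_map. Qed.
Let two_neq0 : 2 != 0 :> C.
Proof. by rewrite char0C. Qed.
Variable n : nat.
Hypothesis n2 : (2 < n)%N.
Let n0 : (0 < n)%N. Proof. exact: leq_trans n2. Qed.
Local Notation X := (torsion_fset EC n).

(* 0 at infinity. *)
Definition xcoord (P : ecpoint C) : C := if P is Some (x, _) then x else 0.

Lemma xcoord_galP (s : G) P : xcoord (galP s P) = s (xcoord P).
Proof. by case: P => [[x y]|]//=; rewrite rmorph0. Qed.

Let H : {group {perm X}} := group (rho_image_group iota_int E n).

(** Double counting over the pairs (Q, h) with Q of exact order d: the sum over h is the same for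
    every Q by transitivity, and the sum over Q the same for every h, which permutes these
    points. *)
Lemma orbit_mean d (P : X) : (1 < d)%N -> (d %| n)%N -> exact_order EC d (val P) ->
    gal_transitive iota E d ->
  \sum_(h in H) xcoord (val (h P)) = - (#|H|%:R * mean_x EC).
Proof.
move=> d1 dn Pd tr; have d0 : (0 < d)%N := ltnW d1.
pose Xd := [set Q : X | `[< exact_order EC d (val Q) >]].
have XdP Q : reflect (exact_order EC d (val Q)) (Q \in Xd) by rewrite inE; apply: asboolP.
pose F (Q : X) := xcoord (val Q).
have e1 Q : Q \in Xd -> \sum_(h in H) F (h Q) = \sum_(h in H) F (h P).
  move=> /XdP Qd; have [s sPQ] := tr _ _ Pd Qd.
  have <- : rho E n s P = Q by apply: val_inj; rewrite rhoE.
  rewrite [RHS](reindex_inj (mulgI (rho E n s))) /=.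
  apply: eq_big => [h|h _]; last by rewrite permM.
  exact: esym (groupMl h (rho_in E n s : rho E n s \in H)).
have stab h Q : h \in H -> Q \in Xd -> h Q \in Xd.
  by move=> /rho_imageP[s <-] /XdP Qd; apply/XdP; rewrite rhoE; apply: galP_exact.
have e2 h : h \in H -> \sum_(Q in Xd) F (h Q) = \sum_(Q in Xd) F Q.
  move=> hH; rewrite [RHS](reindex_inj (@perm_inj _ h)); apply: eq_bigl => Q.
  apply/idP/idP => [|hQ]; first exact: stab.
  by rewrite -[Q](permK h); apply: stab; rewrite ?groupV.
have [ps [ups psP sps]] := exact_order_mean iota char0 E_nonsing d1.
have pe : perm_eq [seq val Q | Q <- enum Xd] [seq Some p | p <- ps].
  apply: uniq_perm; first by rewrite map_inj_uniq ?enum_uniq//; apply: val_inj.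
    by rewrite map_inj_uniq// => p q [].
  move=> Q; apply/mapP/mapP => [[R + ->]|[p /psP pd ->]].
    rewrite mem_enum => /XdP Rd; case: (val R) Rd => [p pd|[_ _ /(_ 1%N d1)]//].
    by exists p => //; apply/psP.
  have pX : Some p \in X.
    apply/(torsion_fsetP char0C EC_nonsing n0); have [cp dp _] := pd.
    by split=> //; apply: (mulP_dvd two_neq0 EC_nonsing cp dn).
  by exists [` pX]%fset => //; rewrite mem_enum; apply/XdP.
have cXd : #|Xd| = size ps by rewrite cardE -(size_map val) (perm_size pe) size_map.
have sXd : \sum_(Q in Xd) F Q = - (#|Xd|%:R * mean_x EC).
  rewrite cXd -sps -big_enum -(big_map val predT xcoord) (perm_big _ pe) big_map.
  by apply: eq_bigr => -[].
have nzX : #|Xd|%:R != 0 :> C.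
  by rewrite char0C -lt0n; apply/card_gt0P; exists P; apply/XdP.
apply: (mulfI nzX); transitivity (\sum_(Q in Xd) \sum_(h in H) F (h Q)).
  by rewrite (eq_bigr _ e1) sumr_const mulr_natl.
rewrite exchange_big /= (eq_bigr _ e2) sumr_const sXd -mulr_natl; ring.
Qed.

End Averaging.

(** * Irreducibility of chi from transitivity *)

Section TransitiveChi.
Variables (K : fieldType) (C : closedFieldType) (iota : {rmorphism K -> C}).
Hypothesis iota_int : integralRange iota.
Variable E : weierstrass K.
Hypothesis char0 : forall n, (n%:R == 0 :> K) = (n == 0)%N.
Hypothesis E_nonsing : discriminant E != 0.
Local Notation EC := (map_weierstrass iota E).
Let char0C := char0_map iota char0.
Let EC_nonsing : nonsingular (two_tors_poly EC).
Proof. exact: nonsingular_map. Qed.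
Let two_neq0 : 2 != 0 :> C.
Proof. by rewrite char0C. Qed.
Variable n : nat.
Hypothesis n2 : (2 < n)%N.
Let n0 : (0 < n)%N. Proof. exact: leq_trans n2. Qed.
Hypothesis tr : gal_transitive iota E n.

Lemma gal_transitive_dvd d : (1 < d)%N -> (d %| n)%N -> gal_transitive iota E d.
Proof.
move=> d1 dn P Q Pd Qd.
have [e1 [e2 [te1 te2 gen free]]] := torsion_basis char0C EC_nonsing n0.
have div := divide_exact_order char0C EC_nonsing n0 te1 te2 gen free d1 dn.
have [W Wn ->] := div P Pd; have [W' Wn' ->] := div Q Qd.
by have [s sW] := tr Wn Wn'; exists s; rewrite galP_mul sW.
Qed.

Variables (alpha beta gamma : K).
Hypothesis beta_neq0 : beta != 0.
Hypothesis slope : 2 * alpha != beta * a1 E.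
Local Notation u p := (iota alpha * p.1 + iota beta * p.2 + iota gamma).

(** For l = -alpha/beta, the difference of the two sides is l^2 + a1 l - a2 + b2/4 = (l + a1/2)^2,
    because b2 = a1^2 + 4 a2. *)
Lemma mean_slope : (alpha / beta) ^+ 2 - a1 E * (alpha / beta) - a2 E
  != - (3 * mean_x E).
Proof.
have twelve : 12 != 0 :> K by rewrite char0.
have four : 4 != 0 :> K by rewrite char0.
apply: contraNneq slope => e; rewrite -subr_eq0 -sqrf_eq0.
have -> : (2 * alpha - beta * a1 E) ^+ 2 = 4 * beta ^+ 2 *
    ((alpha / beta) ^+ 2 - a1 E * (alpha / beta) - a2 E + 3 * mean_x E).
  by rewrite /mean_x /b2; field; rewrite beta_neq0 twelve.
by rewrite e addNr mulr0.
Qed.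

(* If u(P) = u(Q) with P != Q, then P, Q and -(P + Q) lie on a line of slope
   -alpha/beta; averaging the sum of their x-coordinates over the Galois group
   determines this slope up to sign. *)
Lemma u_inj p q : exact_order EC n (Some p) -> exact_order EC n (Some q) ->
  u p = u q -> p = q.
Proof.
case: p q => [x1 y1] [x2 y2] pn qn /= uu.
have nzb : iota beta != 0 by rewrite fmorph_eq0.
have [x12|x12] := eqVneq x1 x2.
  by congr pair => //; apply: (mulfI nzb); move: uu; rewrite x12 => /addIr/addrI.
have nzx : x2 - x1 != 0 by rewrite subr_eq0 eq_sym.
have lE : (y2 - y1) / (x2 - x1) = - (iota (alpha / beta)).
  have e : iota beta * (y2 - y1) = - (iota alpha * (x2 - x1)).
    apply/eqP; rewrite -addr_eq0; apply/eqP.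
    apply: etrans (_ : iota alpha * x2 + iota beta * y2 + iota gamma
      - (iota alpha * x1 + iota beta * y1 + iota gamma) = 0); last by rewrite uu subrr.
    by ring.
  apply: (mulIf nzx); rewrite mulfVK//; apply: (mulfI nzb).
  by rewrite e fmorph_div; field.
set S := addP EC (Some (x1, y1)) (Some (x2, y2)).
pose k := (alpha / beta) ^+ 2 - a1 E * (alpha / beta) - a2 E.
have xS : x1 + x2 + xcoord S = iota k.
  rewrite /S /addP (negPf x12) /= lE /k !rmorphB rmorphXn !rmorphM /=; ring.
have tS : torsion EC n S.
  by apply: (torsion_add char0C EC_nonsing); apply: exact_order_torsion.
(* The sum S may have an order d smaller than n, but d > 1 since x1 != x2; its orbit is averaged
   with transitivity on the points of exact order d. *)
have [d dn Sd] := exact_order_exists char0C EC_nonsing n0 tS.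
have d1 : (1 < d)%N.
  have d0 := dvdn_gt0 n0 dn; case: d Sd d0 {dn} => [|[|d]]// [_ + _] _.
  by rewrite /S /addP (negPf x12).
have pX := torsion_elt char0 E_nonsing n2 pn.
have qX := torsion_elt char0 E_nonsing n2 qn.
have SX : S \in torsion_fset EC n by apply/(torsion_fsetP char0C EC_nonsing n0).
pose H := group (rho_image_group iota_int E n).
have sumk : \sum_(h in H) (xcoord (val (h [` pX]%fset)) + xcoord (val (h [` qX]%fset))
    + xcoord (val (h [` SX]%fset))) = #|H|%:R * iota k.
  rewrite -mulr_natl -sumr_const mulr1 mulr_suml; apply: eq_bigr => h.
  move=> /rho_imageP[s <-]; rewrite !rhoE !xcoord_galP -!rmorphD /= xS mul1r.
  exact: absGal_fix.
have n1 : (1 < n)%N := ltnW n2.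
have := sumk; rewrite !big_split /=.
rewrite (orbit_mean iota_int char0 E_nonsing n2 n1 (dvdnn n) (pn : exact_order EC n (val [` pX]%fset)) tr).
rewrite (orbit_mean iota_int char0 E_nonsing n2 n1 (dvdnn n) (qn : exact_order EC n (val [` qX]%fset)) tr).
rewrite (orbit_mean iota_int char0 E_nonsing n2 d1 dn (Sd : exact_order EC d (val [` SX]%fset))
  (gal_transitive_dvd d1 dn)).
move=> e; have nzH : #|H|%:R != 0 :> C by rewrite char0C -lt0n cardG_gt0.
have /(mulfI nzH) : #|H|%:R * - (3 * mean_x EC) = #|H|%:R * iota k by rewrite -e; ring.
rewrite map_mean_x -(rmorph_nat iota) -rmorphM -rmorphN => /(fmorph_inj iota) /eqP.
by rewrite eq_sym (negPf mean_slope).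
Qed.

Lemma transitive_chi : irreducible_poly (chi E alpha beta gamma n).
Proof.
have [ps [ups psP Dchi _]] := map_chi iota char0 E_nonsing alpha beta gamma n2.
have {}Dchi := Dchi (size_primdivpoly iota char0 E_nonsing n2).
rewrite -(big_map (fun p => u p) predT (fun z => 'X - z%:P)) in Dchi.
have lc : lead_coef (map_poly iota (chi E alpha beta gamma n)) = 1.
  by apply/eqP; rewrite -monicE map_monic char_poly_monic.
apply: (transitive_irreducible (rs := [seq u p | p <- ps]) (iota := iota)).
- by rewrite map_inj_in_uniq// => p q /psP pn /psP qn; apply: u_inj.
- have [p /psP] := exact_point_exists iota char0 E_nonsing n2.
  by rewrite size_map; case: (ps).
- exact: chi_neq0.
- by rewrite lc scale1r.
move=> _ _ /mapP[p /psP pn ->] /mapP[q /psP qn ->].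
by have [s spq] := tr pn qn; exists s; apply: u_galP spq.
Qed.

End TransitiveChi.

Theorem mainTheorem1 (K : fieldExtType rat)
    (Kbar : closedFieldType) (iota : {rmorphism K -> Kbar})
    (Kbar_algebraic : integralRange iota)
    (E : weierstrass K) (E_nonsingular : discriminant E != 0)
    (alpha beta gamma : K) (u_degree1 : (alpha != 0) || (beta != 0))
    (u_generates : generatesFF (affFF E alpha beta gamma)
                               (affFF_opp E alpha beta gamma))
    (n : nat) (n_ge3 : (3 <= n)%N) :
  [/\ (galoisGroup (primdivpoly E n) \isog rho_image iota E n / pm_id iota E n)%g,
      gal_transitive iota E n -> irreducible_poly (primdivpoly E n),
      (galoisGroup (chi E alpha beta gamma n) \isog rho_image iota E n)%g
    & irreducible_poly (chi E alpha beta gamma n) <-> gal_transitive iota E n].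
Proof.
have char0 m : (m%:R == 0 :> K) = (m == 0)%N.
  by rewrite -(rmorph_nat (in_alg K)) fmorph_eq0 Num.Theory.pnatr_eq0.
have two_neq0 : 2 != 0 :> K by rewrite char0.
have beta_neq0 := generates_beta_neq0 u_generates.
have slope := generates_slope two_neq0 u_generates.
split.
- exact: primdivpoly_isog.
- exact: transitive_primdivpoly.
- exact: chi_isog.
split; first exact: irreducible_chi_transitive.
by move=> tr; apply: transitive_chi.
Qed.
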